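(* Let $\mathcal N$ be one of the primitive posets $(1,1,1)$, $(2,1,1)$, $(2,2,1)$, $(3,2,1)$, $(4,2,1)$; write $\mathcal N=(k,l,1)$, so that $\mathcal N$ is the disjoint union of chains of lengths $k$, $l$ and $1$. Write dimension vectors as $D=(a_1,\dots,a_k;\,b_1,\dots,b_l;\,d;\,d_0)$ and weights as $\chi=(\alpha_1,\dots,\alpha_k;\beta_1,\dots,\beta_l;\delta;\gamma)$ (see the context). For each dimension vector $D$ of $\mathcal N$ listed in (1)--(6) below, an indecomposable linear representation $\pi$ of $\mathcal N$ with dimension vector $D$ can be unitarized with every weight $\chi$ that satisfies the trace equality $$\sum_{i=1}^k a_i\alpha_i+\sum_{i=1}^l b_i\beta_i+d\,\delta=d_0\gamma$$ together with the strict inequalities attached to $D$ in that item. For $1\le j\le d_0$ put $A_j=\sum_{i:\,a_i=j}\alpha_i$. (1) $d_0=1$ (all five posets): all $D$ with $a_i,b_i,d\in\{0,1\}$, $a_1\le\dots\le a_k$ and $b_1\le\dots\le b_l$. No inequalities are required (only the trace equality). (2) $d_0=2$ (all five posets): all $D$ with $a_1\le\dots\le a_k$ in $\{0,1,2\}$ taking the value $1$ at least once, $b_1\le\dots\le b_l$ in $\{0,1,2\}$ taking the value $1$ at least once, and $d=1$. Let $S=\sum_{i:\,a_i=2}\alpha_i+\sum_{i:\,b_i=2}\beta_i$. Inequalities: $$S+\sum_{i:\,a_i=1}\alpha_i<\gamma,\qquad S+\sum_{i:\,b_i=1}\beta_i<\gamma,\qquad S+\delta<\gamma .$$ (3) $d_0=3$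 (posets $(2,2,1),(3,2,1),(4,2,1)$): all $D$ with $(b_1,b_2)=(1,2)$, $d\in\{1,2\}$, and $a_1\le\dots\le a_k$ in $\{0,1,2,3\}$ taking both values $1$ and $2$. Put $\gamma'=\gamma-A_3$. If $d=1$, the inequalities are: $A_1+A_2<\gamma'$; $A_1+A_2+\beta_2+\delta<2\gamma'$; $\beta_1+\beta_2<\gamma'$; $A_2+\beta_1+\beta_2+\delta<2\gamma'$; $A_2+\beta_2<\gamma'$. If $d=2$, the inequalities are: $\beta_2+\delta<\gamma'$; $A_2+\beta_1+2\beta_2+\delta<2\gamma'$; $A_2+\delta<\gamma'$; $A_1+2A_2+\beta_2+\delta<2\gamma'$; $A_1+A_2+\beta_1+\beta_2+\delta<2\gamma'$. (4) $d_0=4$ (posets $(3,2,1),(4,2,1)$): all $D$ with $d=2$, $(b_1,b_2)\in\{(1,2),(1,3),(2,3)\}$, and $a_1\le\dots\le a_k$ in $\{0,1,2,3,4\}$ taking all three values $1,2,3$. Put $\gamma'=\gamma-A_4$. If $(b_1,b_2)=(1,2)$: $A_1+A_2+A_3<\gamma'$; $A_1+A_2+A_3+\beta_2+\delta<2\gamma'$; $A_1+A_2+2A_3+\beta_1+2\beta_2+\delta<3\gamma'$; $A_3+\delta<\gamma'$; $A_2+2A_3+\beta_2+\delta<2\gamma'$; $A_2+A_3+\beta_1+\beta_2+\delta<2\gamma'$. If $(b_1,b_2)=(1,3)$: $\beta_2+\delta<\gamma'$; $A_3+\beta_1+2\beta_2+\delta<2\gamma'$; $A_2+2A_3+\beta_1+2\beta_2+2\delta<3\gamma'$;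 $A_2+A_3+\beta_2<\gamma'$; $A_1+2A_2+2A_3+\beta_1+2\beta_2+\delta<3\gamma'$; $A_1+A_2+2A_3+\beta_2+\delta<2\gamma'$. If $(b_1,b_2)=(2,3)$: $A_3+\beta_1+\beta_2<\gamma'$; $A_2+2A_3+\beta_1+\beta_2+\delta<2\gamma'$; $A_1+2A_2+3A_3+\beta_1+2\beta_2+\delta<3\gamma'$; $A_1+A_2+A_3+\beta_1+\beta_2+\delta<2\gamma'$; $A_1+A_2+2A_3+\beta_1+2\beta_2+2\delta<3\gamma'$; $A_2+A_3+\beta_1+2\beta_2+\delta<2\gamma'$. In (5) and (6) the poset is $(4,2,1)$, and the symbol $[x_1x_2x_3x_4|y_1y_2|z|c]$ (with digits $x_i,y_i,z,c$) denotes the inequality $x_1\alpha_1+x_2\alpha_2+x_3\alpha_3+x_4\alpha_4+y_1\beta_1+y_2\beta_2+z\delta<c\gamma$. (5) $d_0=5$: $D=(1,2,3,4;1,3;2;5)$: $[1111|00|0|1]$, $[1111|01|1|2]$, $[1112|12|1|3]$, $[1123|12|2|4]$, $[0011|01|0|1]$, $[0122|12|1|3]$, $[0112|01|1|2]$. $D=(1,2,3,4;2,3;2;5)$: $[1111|00|0|1]$, $[0001|11|0|1]$, $[0012|11|1|2]$, $[0123|12|1|3]$, $[0111|11|1|2]$, $[1223|12|2|4]$, $[1122|12|1|3]$. $D=(1,2,3,4;2,4;2;5)$: $[0001|11|0|1]$, $[0111|01|0|1]$, $[1222|12|1|3]$, $[1223|13|2|4]$, $[0011|12|1|2]$, $[0123|23|2|4]$,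 $[1123|12|1|3]$. $D=(1,2,3,4;1,3;3;5)$: $[0000|01|1|1]$, $[0011|00|1|1]$, $[0122|01|1|2]$, $[1233|12|2|4]$, $[1112|01|1|2]$, $[1123|13|2|4]$, $[0112|12|2|3]$. $D=(1,2,3,4;2,3;3;5)$: $[0011|00|1|1]$, $[1111|11|1|2]$, $[1112|12|2|3]$, $[1123|23|2|4]$, $[0112|11|1|2]$, $[1234|12|2|4]$, $[0122|12|2|3]$. $D=(1,2,3,4;2,4;3;5)$: $[0001|01|1|1]$, $[0012|12|1|2]$, $[0123|12|2|3]$, $[1234|13|2|4]$, $[0111|12|1|2]$, $[1223|23|2|4]$, $[1122|12|2|3]$. (6) $d_0=6$: $D=(1,2,3,4;2,4;3;6)$: $[0000|01|1|1]$, $[0001|12|1|2]$, $[0012|12|2|3]$, $[0123|13|2|4]$, $[0111|11|1|2]$, $[1223|12|2|4]$, $[1122|12|1|3]$. $D=(1,2,3,5;2,4;3;6)$: $[0001|11|0|1]$, $[0012|11|1|2]$, $[0123|12|1|3]$, $[1234|23|2|5]$, $[1112|01|1|2]$, $[1123|13|2|4]$, $[0112|12|2|3]$. $D=(1,2,4,5;2,4;3;6)$: $[0011|00|1|1]$, $[0122|01|1|2]$, $[1233|12|2|4]$, $[1234|13|3|5]$, $[0011|12|1|2]$, $[0123|23|2|4]$, $[1123|12|1|3]$. $D=(1,3,4,5;2,4;3;6)$: $[0111|01|0|1]$, $[1222|12|1|3]$, $[1223|13|2|4]$, $[1234|24|2|5]$, $[0112|11|1|2]$, $[1234|12|2|4]$,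 $[0122|12|2|3]$. $D=(2,3,4,5;2,4;3;6)$: $[1111|11|1|2]$, $[1112|12|2|3]$, $[1123|23|2|4]$, $[1234|23|3|5]$, $[1122|01|1|2]$, $[1233|13|2|4]$, $[1223|12|1|3]$.
   Context: For positive integers $k_1,\dots,k_m$, the primitive poset $(k_1,\dots,k_m)$ is the disjoint (cardinal) sum of $m$ chains with $k_1,\dots,k_m$ elements (elements of different chains are incomparable). A linear representation $\pi=(V;(V_x)_{x\in\mathcal N})$ of a finite poset $\mathcal N$ is a finite-dimensional complex vector space $V$ together with a subspace $V_x\subseteq V$ for each $x\in\mathcal N$ such that $x\prec y$ implies $V_x\subseteq V_y$. Two representations $(V;V_x)$ and $(W;W_x)$ are isomorphic if there is an invertible linear map $C:V\to W$ with $C(V_x)=W_x$ for all $x$. The direct sum is $(V\oplus W; V_x\oplus W_x)$. A representation is indecomposable if it is not isomorphic to a direct sum of two non-zero representations (non-zero means that the ambient space is non-zero). For $\mathcal N=(k,l,1)$, let the elements of the three chains, in increasing order, be $x_1\prec\dots\prec x_k$, $y_1\prec\dots\prec y_l$, and $z$. The dimension vector of $\pi$ is $D=(a_1,\dots,a_k;b_1,\dots,b_l;d;d_0)$ with $a_i=\dim V_{x_i}$, $b_i=\dim V_{y_i}$, $d=\dim V_z$, $d_0=\dim V$. A weight $\chi=(\alpha_1,\dots,\alpha_k;\beta_1,\dots,\beta_l;\delta;\gamma)$ assigns real numbers $\alpha_i>0$ to $x_i$, $\beta_i>0$ to $y_i$, $\delta>0$ to $z$, together with a real number $\gamma\ge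 0$. The representation $\pi$ can be unitarized with the weight $\chi$ if there is a Hermitian inner product on $V$ such that the orthogonal projections $P_x$ of $V$ onto $V_x$ satisfy $$\sum_{i=1}^k\alpha_iP_{x_i}+\sum_{i=1}^l\beta_iP_{y_i}+\delta P_z=\gamma I_V .$$ *)

(* Defs.v *)
From HB Require Import structures.
From mathcomp Require Import all_boot all_order all_algebra.
From mathcomp Require Import complex reals.

Set Implicit Arguments.
Unset Strict Implicit.
Unset Printing Implicit Defensive.

Import Order.TTheory GRing.Theory Num.Theory.

Local Open Scope ring_scope.
Local Open Scope complex_scope.

(* Cardinal sum of posets: the two summands keep their order and elements of  *)
(* different summands are incomparable. [csum] is an alias of the sum type.   *)
Definition csum (T1 T2 : Type) := (T1 + T2)%type.

Fact csum_display (d1 d2 : Order.disp_t) : Order.disp_t.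
Proof. exact: Order.Disp tt tt. Qed.

Section CardinalSum.
Variables (d1 d2 : Order.disp_t).

HB.instance Definition _ (T1 T2 : finType) :=
  Finite.copy (csum T1 T2) (T1 + T2)%type.

Section POrder.
Variables (T1 : finPOrderType d1) (T2 : finPOrderType d2).

Definition csum_le : rel (csum T1 T2) := fun u v =>
  match u, v with
  | inl x, inl y => (x <= y)%O
  | inr x, inr y => (x <= y)%O
  | _, _ => false
  end.

Fact csum_le_refl : reflexive csum_le.
Proof. by case=> x /=. Qed.

Fact csum_le_anti : antisymmetric csum_le.
Proof. by case=> x [] y //= /le_anti ->. Qed.

Fact csum_le_trans : transitive csum_le.
Proof. by case=> y [] x [] z //=; apply: le_trans. Qed.

HB.instance Definition _ := Order.Le_isPOrder.Build (csum_display d1 d2)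
  (csum T1 T2) csum_le_refl csum_le_anti csum_le_trans.

End POrder.
End CardinalSum.

(* The primitive poset (k, l, 1); the chain with n elements is ['I_n]. *)
Definition primitive3 (k l : nat) := csum (csum 'I_k 'I_l) 'I_1.

HB.instance Definition _ (k l : nat) := Order.FinPOrder.on (primitive3 k l).

Definition eltx (k l : nat) (i : 'I_k) : primitive3 k l := inl (inl i).
Definition elty (k l : nat) (i : 'I_l) : primitive3 k l := inl (inr i).
Definition eltz (k l : nat) : primitive3 k l := inr ord0.
Arguments eltx {k l}.
Arguments elty {k l}.
Arguments eltz {k l}.

Record representation (R : realType) (disp : Order.disp_t)
    (N : finPOrderType disp) := Representation {
  rspace : vectType R[i];
  rsub :> N -> {vspace rspace};
  rsub_homo : forall x y : N, (x < y)%O -> (rsub x <= rsub y)%VS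
}.

Section Representations.
Variables (R : realType) (disp : Order.disp_t) (N : finPOrderType disp).
Implicit Types pi rho : representation R N.

Definition isomorphic pi rho :=
  exists C : 'Hom(rspace pi, rspace rho),
    [/\ lker C = 0%VS, limg C = fullv & forall x, (C @: pi x)%VS = rho x].

Section DirectSum.
Variables V W : vectType R[i].

Definition pair_inl (v : V) : V * W := (v, 0).
Definition pair_inr (w : W) : V * W := (0, w).

Fact pair_inl_is_linear : linear pair_inl.
Proof. by move=> c u v; congr pair; rewrite /= ?scaler0 ?addr0. Qed.

Fact pair_inr_is_linear : linear pair_inr.
Proof. by move=> c u v; congr pair; rewrite /= ?scaler0 ?addr0. Qed.

HB.instance Definition _ :=
  GRing.isLinear.Build R[i] V (V * W)%type _ pair_inl pair_inl_is_linear.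
HB.instance Definition _ :=
  GRing.isLinear.Build R[i] W (V * W)%type _ pair_inr pair_inr_is_linear.

Definition dsumv (A : {vspace V}) (B : {vspace W}) : {vspace (V * W)} :=
  (linfun pair_inl @: A + linfun pair_inr @: B)%VS.

Lemma mem_dsumv (A : {vspace V}) (B : {vspace W}) (u : V * W) :
  (u \in dsumv A B) = (u.1 \in A) && (u.2 \in B).
Proof.
apply/idP/idP => [/memv_addP[_ /memv_imgP[v vA ->]]|].
  case=> _ /memv_imgP[w wB ->] ->; rewrite !lfunE /=.
  by rewrite addr0 add0r vA wB.
case: u => v w /= /andP[vA wB].
have -> : (v, w) = linfun pair_inl v + linfun pair_inr w.
  by rewrite !lfunE; congr pair; rewrite /= ?addr0 ?add0r.
by rewrite memv_add // memv_img.
Qed.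

End DirectSum.

Fact dsum_homo pi rho (x y : N) :
  (x < y)%O -> (dsumv (pi x) (rho x) <= dsumv (pi y) (rho y))%VS.
Proof.
by move=> xy; apply: addvS; apply: limgS; exact: rsub_homo.
Qed.

Definition dsum pi rho : representation R N :=
  Representation (@dsum_homo pi rho).

Definition nonzero_rep pi := (fullv : {vspace rspace pi}) != 0%VS.

Definition indecomposable pi :=
  ~ exists rho sigma : representation R N,
      [/\ nonzero_rep rho, nonzero_rep sigma & isomorphic pi (dsum rho sigma)].

End Representations.

(* The vector (a_1, ..., a_k; b_1, ..., b_l; d; d_0); positions are 0-based,  *)
(* so a_i is [tnth da] at index i - 1.                                        *)
Record dimvec (k l : nat) := Dimvec {
  da : k.-tuple nat;
  db : l.-tuple nat;
  dz : nat;
  d0 : nat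
}.

Record weight (R : realType) (k l : nat) := Weight {
  walpha : k.-tuple R;
  wbeta : l.-tuple R;
  wdelta : R;
  wgamma : R;
  walpha_gt0 : forall i, 0 < tnth walpha i;
  wbeta_gt0 : forall i, 0 < tnth wbeta i;
  wdelta_gt0 : 0 < wdelta;
  wgamma_ge0 : 0 <= wgamma
}.

Section Unitarization.
Variables (R : realType) (k l : nat).
Implicit Types (pi : representation R (primitive3 k l)) (D : dimvec k l)
  (chi : weight R k l).

Definition has_dimvec pi D :=
  [/\ forall i, \dim (pi (eltx i)) = tnth (da D) i,
      forall i, \dim (pi (elty i)) = tnth (db D) i,
      \dim (pi eltz) = dz D
    & \dim {: rspace pi} = d0 D].

Definition orthogonal_projection (V : vectType R[i])
    (h : {dot V for Num.conj}) (U : {vspace V}) (P : 'End(V)) :=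
  forall v, P v \in U /\ {in U, forall u, h (v - P v) u = 0}.

Definition unitarizable pi chi :=
  exists (h : {dot rspace pi for Num.conj})
         (P : primitive3 k l -> 'End(rspace pi)),
    (forall x, orthogonal_projection h (pi x) (P x)) /\
    \sum_(i < k) (tnth (walpha chi) i)%:C *: P (eltx i)
      + \sum_(i < l) (tnth (wbeta chi) i)%:C *: P (elty i)
      + (wdelta chi)%:C *: P eltz = (wgamma chi)%:C *: \1%VF.

Definition trace_equality D chi :=
  \sum_(i < k) (tnth (da D) i)%:R * tnth (walpha chi) i
    + \sum_(i < l) (tnth (db D) i)%:R * tnth (wbeta chi) i
    + (dz D)%:R * wdelta chi = (d0 D)%:R * wgamma chi.

End Unitarization.

(* [level s w j] is the sum of the w_i with s_i = j; applied to (a_i) and     *)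
(* (alpha_i) it is A_j.                                                       *)
Definition level (R : realType) (n : nat) (s : n.-tuple nat) (w : n.-tuple R)
    (j : nat) : R :=
  \sum_(i < n | tnth s i == j) tnth w i.

Section Items.
Variables (R : realType) (k l : nat) (D : dimvec k l) (chi : weight R k l).

Local Notation a := (da D).
Local Notation b := (db D).
Local Notation alpha := (walpha chi).
Local Notation beta := (wbeta chi).
Local Notation delta := (wdelta chi).
Local Notation gamma := (wgamma chi).
Local Notation A j := (level a alpha j).
Local Notation B j := (level b beta j).
Local Notation beta1 := (beta`_0).
Local Notation beta2 := (beta`_1).

(* s_1 <= ... <= s_n <= m *)
Definition flag_dims (m : nat) (s : seq nat) :=
  sorted leq s && all (fun j => j <= m)%N s.

(* [item j] says that D is one of the vectors with d_0 = j and that chi       *)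
(* satisfies the strict inequalities attached to D.                           *)

Definition item1 :=
  [/\ d0 D = 1%N, flag_dims 1 a, flag_dims 1 b & (dz D <= 1)%N].

Definition item2 :=
  let S := A 2 + B 2 in
  [/\ d0 D = 2%N, dz D = 1%N,
      flag_dims 2 a && (1%N \in (a : seq nat)),
      flag_dims 2 b && (1%N \in (b : seq nat))
    & [&& S + A 1 < gamma, S + B 1 < gamma & S + delta < gamma]].

Definition item3_ineqs1 (g : R) :=
  [&& A 1 + A 2 < g,
      A 1 + A 2 + beta2 + delta < 2 * g,
      beta1 + beta2 < g,
      A 2 + beta1 + beta2 + delta < 2 * g
    & A 2 + beta2 < g].

Definition item3_ineqs2 (g : R) :=
  [&& beta2 + delta < g,
      A 2 + beta1 + 2 * beta2 + delta < 2 * g,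
      A 2 + delta < g,
      A 1 + 2 * A 2 + beta2 + delta < 2 * g
    & A 1 + A 2 + beta1 + beta2 + delta < 2 * g].

Definition item3 :=
  let g := gamma - A 3 in
  [/\ (k, l) \in [:: (2, 2); (3, 2); (4, 2)]%N,
      d0 D = 3%N,
      b = [:: 1; 2]%N :> seq nat,
      flag_dims 3 a /\ {subset [:: 1; 2]%N <= a}
    & (dz D = 1%N /\ item3_ineqs1 g) \/ (dz D = 2%N /\ item3_ineqs2 g)].

Definition item4_ineqs12 (g : R) :=
  [&& A 1 + A 2 + A 3 < g,
      A 1 + A 2 + A 3 + beta2 + delta < 2 * g,
      A 1 + A 2 + 2 * A 3 + beta1 + 2 * beta2 + delta < 3 * g,
      A 3 + delta < g,
      A 2 + 2 * A 3 + beta2 + delta < 2 * g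
    & A 2 + A 3 + beta1 + beta2 + delta < 2 * g].

Definition item4_ineqs13 (g : R) :=
  [&& beta2 + delta < g,
      A 3 + beta1 + 2 * beta2 + delta < 2 * g,
      A 2 + 2 * A 3 + beta1 + 2 * beta2 + 2 * delta < 3 * g,
      A 2 + A 3 + beta2 < g,
      A 1 + 2 * A 2 + 2 * A 3 + beta1 + 2 * beta2 + delta < 3 * g
    & A 1 + A 2 + 2 * A 3 + beta2 + delta < 2 * g].

Definition item4_ineqs23 (g : R) :=
  [&& A 3 + beta1 + beta2 < g,
      A 2 + 2 * A 3 + beta1 + beta2 + delta < 2 * g,
      A 1 + 2 * A 2 + 3 * A 3 + beta1 + 2 * beta2 + delta < 3 * g,
      A 1 + A 2 + A 3 + beta1 + beta2 + delta < 2 * g,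
      A 1 + A 2 + 2 * A 3 + beta1 + 2 * beta2 + 2 * delta < 3 * g
    & A 2 + A 3 + beta1 + 2 * beta2 + delta < 2 * g].

Definition item4 :=
  let g := gamma - A 4 in
  [/\ (k, l) \in [:: (3, 2); (4, 2)]%N,
      d0 D = 4%N, dz D = 2%N,
      flag_dims 4 a /\ {subset [:: 1; 2; 3]%N <= a}
    & [\/ b = [:: 1; 2]%N :> seq nat /\ item4_ineqs12 g,
          b = [:: 1; 3]%N :> seq nat /\ item4_ineqs13 g
        | b = [:: 2; 3]%N :> seq nat /\ item4_ineqs23 g]].

End Items.

Definition dimdata : Type := (seq nat * seq nat * nat * nat)%type.

Definition dimdata_of (k l : nat) (D : dimvec k l) : dimdata :=
  (val (da D), val (db D), dz D, d0 D).

(* The inequality [x_1 ... x_k | y_1 ... y_l | z | c]. *)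
Definition bracket (R : realType) (k l : nat) (chi : weight R k l)
    (q : dimdata) : bool :=
  let: (x, y, z, c) := q in
  \sum_(i < k) (nth 0%N x i)%:R * tnth (walpha chi) i
    + \sum_(i < l) (nth 0%N y i)%:R * tnth (wbeta chi) i
    + z%:R * wdelta chi < c%:R * wgamma chi.

Local Notation "[# x1 x2 x3 x4 | y1 y2 | z | c ]" :=
  ([:: x1; x2; x3; x4], [:: y1; y2], z, c)
  (at level 0, x1 at level 0, x2 at level 0, x3 at level 0, x4 at level 0,
   y1 at level 0, y2 at level 0, z at level 0, c at level 0, only parsing).

(* Each entry pairs a dimension vector with its list of inequalities. *)

Definition table5 : seq (dimdata * seq dimdata) := ([::
  ([# 1 2 3 4 | 1 3 | 2 | 5],
   [:: [# 1 1 1 1 | 0 0 | 0 | 1]; [# 1 1 1 1 | 0 1 | 1 | 2];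
       [# 1 1 1 2 | 1 2 | 1 | 3]; [# 1 1 2 3 | 1 2 | 2 | 4];
       [# 0 0 1 1 | 0 1 | 0 | 1]; [# 0 1 2 2 | 1 2 | 1 | 3];
       [# 0 1 1 2 | 0 1 | 1 | 2]]);
  ([# 1 2 3 4 | 2 3 | 2 | 5],
   [:: [# 1 1 1 1 | 0 0 | 0 | 1]; [# 0 0 0 1 | 1 1 | 0 | 1];
       [# 0 0 1 2 | 1 1 | 1 | 2]; [# 0 1 2 3 | 1 2 | 1 | 3];
       [# 0 1 1 1 | 1 1 | 1 | 2]; [# 1 2 2 3 | 1 2 | 2 | 4];
       [# 1 1 2 2 | 1 2 | 1 | 3]]);
  ([# 1 2 3 4 | 2 4 | 2 | 5],
   [:: [# 0 0 0 1 | 1 1 | 0 | 1]; [# 0 1 1 1 | 0 1 | 0 | 1];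
       [# 1 2 2 2 | 1 2 | 1 | 3]; [# 1 2 2 3 | 1 3 | 2 | 4];
       [# 0 0 1 1 | 1 2 | 1 | 2]; [# 0 1 2 3 | 2 3 | 2 | 4];
       [# 1 1 2 3 | 1 2 | 1 | 3]]);
  ([# 1 2 3 4 | 1 3 | 3 | 5],
   [:: [# 0 0 0 0 | 0 1 | 1 | 1]; [# 0 0 1 1 | 0 0 | 1 | 1];
       [# 0 1 2 2 | 0 1 | 1 | 2]; [# 1 2 3 3 | 1 2 | 2 | 4];
       [# 1 1 1 2 | 0 1 | 1 | 2]; [# 1 1 2 3 | 1 3 | 2 | 4];
       [# 0 1 1 2 | 1 2 | 2 | 3]]);
  ([# 1 2 3 4 | 2 3 | 3 | 5],
   [:: [# 0 0 1 1 | 0 0 | 1 | 1]; [# 1 1 1 1 | 1 1 | 1 | 2];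
       [# 1 1 1 2 | 1 2 | 2 | 3]; [# 1 1 2 3 | 2 3 | 2 | 4];
       [# 0 1 1 2 | 1 1 | 1 | 2]; [# 1 2 3 4 | 1 2 | 2 | 4];
       [# 0 1 2 2 | 1 2 | 2 | 3]]);
  ([# 1 2 3 4 | 2 4 | 3 | 5],
   [:: [# 0 0 0 1 | 0 1 | 1 | 1]; [# 0 0 1 2 | 1 2 | 1 | 2];
       [# 0 1 2 3 | 1 2 | 2 | 3]; [# 1 2 3 4 | 1 3 | 2 | 4];
       [# 0 1 1 1 | 1 2 | 1 | 2]; [# 1 2 2 3 | 2 3 | 2 | 4];
       [# 1 1 2 2 | 1 2 | 2 | 3]])
])%N.

Definition table6 : seq (dimdata * seq dimdata) := ([::
  ([# 1 2 3 4 | 2 4 | 3 | 6],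
   [:: [# 0 0 0 0 | 0 1 | 1 | 1]; [# 0 0 0 1 | 1 2 | 1 | 2];
       [# 0 0 1 2 | 1 2 | 2 | 3]; [# 0 1 2 3 | 1 3 | 2 | 4];
       [# 0 1 1 1 | 1 1 | 1 | 2]; [# 1 2 2 3 | 1 2 | 2 | 4];
       [# 1 1 2 2 | 1 2 | 1 | 3]]);
  ([# 1 2 3 5 | 2 4 | 3 | 6],
   [:: [# 0 0 0 1 | 1 1 | 0 | 1]; [# 0 0 1 2 | 1 1 | 1 | 2];
       [# 0 1 2 3 | 1 2 | 1 | 3]; [# 1 2 3 4 | 2 3 | 2 | 5];
       [# 1 1 1 2 | 0 1 | 1 | 2]; [# 1 1 2 3 | 1 3 | 2 | 4];
       [# 0 1 1 2 | 1 2 | 2 | 3]]);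
  ([# 1 2 4 5 | 2 4 | 3 | 6],
   [:: [# 0 0 1 1 | 0 0 | 1 | 1]; [# 0 1 2 2 | 0 1 | 1 | 2];
       [# 1 2 3 3 | 1 2 | 2 | 4]; [# 1 2 3 4 | 1 3 | 3 | 5];
       [# 0 0 1 1 | 1 2 | 1 | 2]; [# 0 1 2 3 | 2 3 | 2 | 4];
       [# 1 1 2 3 | 1 2 | 1 | 3]]);
  ([# 1 3 4 5 | 2 4 | 3 | 6],
   [:: [# 0 1 1 1 | 0 1 | 0 | 1]; [# 1 2 2 2 | 1 2 | 1 | 3];
       [# 1 2 2 3 | 1 3 | 2 | 4]; [# 1 2 3 4 | 2 4 | 2 | 5];
       [# 0 1 1 2 | 1 1 | 1 | 2]; [# 1 2 3 4 | 1 2 | 2 | 4];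
       [# 0 1 2 2 | 1 2 | 2 | 3]]);
  ([# 2 3 4 5 | 2 4 | 3 | 6],
   [:: [# 1 1 1 1 | 1 1 | 1 | 2]; [# 1 1 1 2 | 1 2 | 2 | 3];
       [# 1 1 2 3 | 2 3 | 2 | 4]; [# 1 2 3 4 | 2 3 | 3 | 5];
       [# 1 1 2 2 | 0 1 | 1 | 2]; [# 1 2 3 3 | 1 3 | 2 | 4];
       [# 1 2 2 3 | 1 2 | 1 | 3]])
])%N.

Definition tabulated (R : realType) (k l : nat)
    (table : seq (dimdata * seq dimdata)) (D : dimvec k l)
    (chi : weight R k l) :=
  exists2 qs, (dimdata_of D, qs) \in table & all (bracket chi) qs.

(* Main.v *)
(** Stability. By the Kempf-Ness argument, an inner product as required exists
    as soon as [sum_x chi_x dim (V_x :&: U) < gamma dim U] for every proper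
    nonzero subspace [U]: fixing bases of the [V_x], the function
    [g |-> sum_x chi_x ln det (B_x g g^* B_x^* ) - gamma ln det (g g^* )] is
    bounded below by a positive multiple of the logarithm of the condition
    number of [g] up to a constant, hence it has a minimum, and its critical
    points are the solutions.

    Stability of indecomposables. The poset corresponds to a Dynkin diagram of
    type D or E, whose Tits form is positive. An indecomposable representation
    is therefore a brick (Ringel's argument), and a brick has no
    self-extensions. Hence, for all subspaces [U1] and [U2], the flag conditions
    [f (U1 :&: X) <= U2 + X] on the endomorphisms [f] are independent, and
    comparing dimensions with the space of [f] mapping [U1] into [U2] gives
    [sum_Y codim_Y <= dim U1 * codim U2], where [codim_Y] is the codimension
    of the conditions given by the chain [Y]. Applied to [U1 = U :&: X] and
    [U2 = U + X'], with [X] and [X'] in the chains or trivial, these inequalities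
    rule out many values of the dimensions of the intersections of [U] with the
    chains. Each remaining value is bounded by a nonnegative combination of the
    listed inequalities modulo the trace equality; as there are finitely many
    values, this is a computation. *)

(* Everything happens inside one space [V]: subrepresentations are subspaces [U], and homomorphisms
   are elements of [End(V)] of which only the values on [U] matter, so all codimensions are counted
   in one space. A chain of [k] subspaces imposes at most [k / (2 (k + 1))] times [m ^ 2] conditions
   on the endomorphisms of an [m]-dimensional space. For lengths 4, 2, 1 these fractions add up to
   2/5 + 1/3 + 1/4 = 59/60 < 1; this is the form in which positivity of the Tits form enters.

   The tests by [U :&: Y] and [U + Y] involve triple intersections and sums, whose dimensions are
   not determined by those of the [U :&: X]. They are replaced by bounds, which is legitimate
   because the codimensions are monotone.

   In the analytic half the obstacle is uniformity: the Cauchy-Binet term behind the lower bound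
   depends on the unitary factor of [g] and cannot be chosen continuously. The estimate depends,
   however, only on the chosen indices and on lower bounds for minors; it persists nearby, and
   compactness of the unitary group yields one constant. *)
Require Import Defs.
From HB Require Import structures.
From mathcomp Require Import all_boot all_order all_algebra all_fingroup.
From mathcomp Require Import sesquilinear spectral complex.
From mathcomp Require Import all_classical all_reals.
From mathcomp Require Import topology normedtype sequences derive exp.
From mathcomp Require Import zify ring lra.

Set Implicit Arguments.
Unset Strict Implicit.
Unset Printing Implicit Defensive.

Import Order.TTheory GRing.Theory Num.Theory numFieldNormedType.Exports.

(** * Homomorphisms preserving flags *)

Section HomDimension.
Local Open Scope ring_scope.
Variables (F : fieldType) (V : vectType F).
Implicit Types A B U W : {vspace V}.
Implicit Types f g : 'End(V).

(** It vanishes exactly when [f] maps [A] into [B], and every homomorphism from [A] to [B^C] arises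
    in this way; this gives the codimension of [homset A B]. *)
Definition hom_obstruction A B f : 'Hom(subvs_of A, subvs_of B^C%VS) :=
  (linfun (vsproj B^C) \o ((\1 - projv B) \o (f \o linfun vsval)))%VF.

Lemma hom_obstructionE A B f u :
  vsval (hom_obstruction A B f u) = f (vsval u) - projv B (f (vsval u)).
Proof.
rewrite /hom_obstruction !comp_lfunE lfunE /= vsprojK.
  by rewrite add_lfunE opp_lfunE id_lfunE lfunE.
by rewrite add_lfunE opp_lfunE id_lfunE memv_projC.
Qed.

Fact hom_obstruction_is_linear A B : linear (hom_obstruction A B).
Proof.
move=> c f g; apply/lfunP => u; apply: val_inj.
rewrite add_lfunE scale_lfunE linearP /= !hom_obstructionE add_lfunE scale_lfunE.
by rewrite linearP /= scalerBr opprD addrACA.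
Qed.

HB.instance Definition _ A B :=
  GRing.isLinear.Build F _ _ _ (hom_obstruction A B) (hom_obstruction_is_linear A B).

Definition homset A B : {vspace 'End(V)} := lker (linfun (hom_obstruction A B)).

Lemma homsetP A B f : reflect {in A, forall u, f u \in B} (f \in homset A B).
Proof.
rewrite /homset memv_ker lfunE /=; apply: (iffP eqP) => [H u uA | H].
  move/(congr1 (fun h : 'Hom(_, _) => vsval (h (vsproj A u)))): H.
  rewrite hom_obstructionE vsprojK // zero_lfunE /= => /eqP.
  by rewrite subr_eq0 => /eqP ->; exact: memv_proj.
apply/lfunP => u; apply: val_inj.
by rewrite /= hom_obstructionE zero_lfunE /= projv_id ?subrr // H // subvsP.
Qed.

Lemma codim_homset A B :
  (\dim (homset A B) + \dim A * (\dim {:V} - \dim B) = \dim {:'End(V)})%N.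
Proof.
rewrite /homset -(limg_ker_dim (linfun (hom_obstruction A B)) fullv) capfv.
congr addn; rewrite -dimv_compl.
suff -> : limg (linfun (hom_obstruction A B)) = fullv by rewrite dimvf.
apply/eqP; rewrite eqEsubv subvf; apply/subvP => h _; apply/memv_imgP.
exists (linfun vsval \o h \o linfun (vsproj A))%VF; rewrite ?memvf //.
apply/lfunP => u; apply: val_inj; rewrite /= lfunE /= hom_obstructionE /=.
rewrite !comp_lfunE !lfunE /= vsvalK.
suff -> : projv B (vsval (h u)) = 0 by rewrite subr0.
by apply/eqP; rewrite -memv_ker lker_proj subvsP.
Qed.

Lemma homsetS A A' B B' : (A' <= A -> B <= B' -> homset A B <= homset A' B')%VS.
Proof.
move=> /subvP sA /subvP sB; apply/subvP => f /homsetP H; apply/homsetP => u uA.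
by apply: sB; apply: H; apply: sA.
Qed.

(** Split [f] into [f - f \o projv A] and [f \o projv A]: the first kills [A], hence lies in [H];
    the second has its image in that of [A] under [f], hence in [B']. *)
Lemma add_homset A A' B B' (H : {vspace 'End(V)}) :
  (A <= A')%VS -> (B <= B')%VS ->
  (homset A 0 <= H)%VS -> (H <= homset A B)%VS ->
  (H + homset A' B' = homset A B')%VS.
Proof.
move=> sA sB sH Hs; apply/eqP; rewrite eqEsubv subv_add homsetS // andbT.
rewrite (subv_trans Hs) /=; last exact: homsetS.
apply/subvP => f /homsetP fAB.
have -> : f = (f - (f \o projv A)%VF) + (f \o projv A)%VF by rewrite subrK.
apply: memv_add.
  apply: (subvP sH); apply/homsetP => u uA.
  by rewrite add_lfunE opp_lfunE comp_lfunE projv_id // subrr mem0v.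
by apply/homsetP => u _; rewrite comp_lfunE; apply: fAB; exact: memv_proj.
Qed.

Definition flag_homset (s : seq ({vspace V} * {vspace V})) : {vspace 'End(V)} :=
  (\bigcap_(p <- s) homset p.1 p.2)%VS.

Fixpoint flag_codim (a : nat) (s : seq ({vspace V} * {vspace V})) : nat :=
  if s is p :: s' then ((\dim p.1 - a) * (\dim {:V} - \dim p.2) + flag_codim (\dim p.1) s')%N
  else 0%N.

Lemma flag_homsetP (s : seq ({vspace V} * {vspace V})) f :
  reflect (forall A B, (A, B) \in s -> {in A, forall u, f u \in B}) (f \in flag_homset s).
Proof.
rewrite /flag_homset; elim: s => [|p s IH].
  by rewrite big_nil memvf; apply: ReflectT.
rewrite big_cons memv_cap; apply: (iffP andP) => [[/homsetP Hp /IH Hs] A B | H].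
  by rewrite inE => /predU1P [pE | /Hs //]; rewrite -pE in Hp.
split; first by apply/homsetP; apply: H; rewrite -surjective_pairing mem_head.
by apply/IH => A B qs; apply: H; rewrite inE qs orbT.
Qed.

(** By [add_homset], imposing the next condition on [H] costs as much as passing from [homset A B']
    to [homset A' B']. The smaller space again lies between [homset A' 0] and [homset A' B'], so the
    sandwich hypotheses propagate along the flag. *)
Lemma codim_flag_homset_path A B (H : {vspace 'End(V)}) s :
  path (fun p q => (p.1 <= q.1)%VS && (p.2 <= q.2)%VS) (A, B) s ->
  (homset A 0 <= H)%VS -> (H <= homset A B)%VS ->
  (\dim (H :&: flag_homset s) + flag_codim (\dim A) s = \dim H)%N.
Proof.
rewrite /flag_homset; elim: s A B H => [|[A' B'] s IH] A B H /=.
  by move=> _ _ _; rewrite big_nil capvf addn0.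
move=> /andP[/andP[/= sA sB] pth] H0 HA.
rewrite big_cons capvA addnCA.
have cap0 : (homset A' 0 <= H :&: homset A' B')%VS.
  by rewrite subv_cap (subv_trans _ H0) !homsetS // sub0v.
rewrite (IH A' B') //= ?capvSr //.
have := dimv_sum_cap H (homset A' B'); rewrite (add_homset sA sB) //.
have := codim_homset A B'; have := codim_homset A' B'.
have := dimvS sA; rewrite mulnBl.
have := leq_mul (dimvS sA) (leqnn (\dim {:V} - \dim B')%N).
lia.
Qed.

Lemma codim_flag_homset s :
  sorted (fun p q => (p.1 <= q.1)%VS && (p.2 <= q.2)%VS) s ->
  (\dim (flag_homset s) + flag_codim 0 s = \dim {:'End(V)})%N.
Proof.
move=> srt; have := @codim_flag_homset_path 0%VS 0%VS fullv s.
rewrite dimv0 capfv; apply; last 2 first.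
- by apply/subvP => f _; apply: memvf.
- by apply/subvP => f _; apply/homsetP => u; rewrite memv0 => /eqP ->; rewrite linear0 mem0v.
by case: s srt => //= p s ->; rewrite !sub0v.
Qed.

End HomDimension.

Fixpoint chain_codim (m x : nat) (s : seq nat) : nat :=
  if s is y :: s' then ((y - x) * (m - y) + chain_codim m y s')%N else 0%N.

(** For [size s = k], let [d_0, ..., d_k] be the steps of the chain, the last one leading to [m].
    The codimension is the sum of the products [d_i d_j] over [i < j], which is half of
    [(m - x) ^ 2] minus the sum of the squares; equal steps are extremal. *)
Lemma chain_codim_bound k m x s :
  (size s <= k)%N -> path leq x s -> all (geq m) s -> (x <= m)%N ->
  (2 * k.+1 * chain_codim m x s <= k * (m - x) ^ 2)%N.
Proof.
elim: s k x => [|y s IH] k x /=; first by rewrite muln0.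
case: k => // k; rewrite ltnS => sk /andP[xy ys] /andP[ym sm] xm.
have := IH k y sk ys sm ym.
have [a [b [-> ->]]] : exists a b, y = (x + a)%N /\ m = (x + a + b)%N.
  by exists (y - x)%N, (m - y)%N; split; lia.
rewrite (_ : x + a - x = a)%N; last lia.
rewrite (_ : x + a + b - (x + a) = b)%N; last lia.
rewrite (_ : x + a + b - x = a + b)%N; last lia.
move: (chain_codim _ _ _) => q Hq.
have {Hq} : (k.+1 * (2 * k.+2 * (a * b + q)) <= k.+1 * (k.+1 * (a + b) ^ 2))%N.
  have : (k.+2 * (2 * k.+1 * q) <= k.+2 * (k * b ^ 2))%N by rewrite leq_mul2l Hq orbT.
  (* After multiplication by [k.+1], the slack left by the induction hypothesis is exactly this
     square; it vanishes when the first step [a] is the average of the remaining [k.+1] steps, whose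
     sum is [b]. *)
  have := sqr_ge0 ((k.+1 * a)%N%:Z - b%:Z)%R.
  nia.
by rewrite leq_pmul2l.
Qed.

Section Representation.
Local Open Scope ring_scope.
Variables (F : numClosedFieldType) (V : vectType F).
Implicit Types A B D K U W X : {vspace V}.
Implicit Types f g : 'End(V).
Implicit Types Y : seq {vspace V}.

Lemma daddv_pi0 A B u : (A :&: B = 0)%VS -> u \in B -> daddv_pi A B u = 0.
Proof.
move=> AB0 uB; have := daddv_pi_add AB0 (subvP (addvSr A B) _ uB).
by rewrite (daddv_pi_id _ uB) ?(capvC B) // => /(canRL (addrK _)) ->; rewrite subrr.
Qed.

(** A single chain never obstructs an extension: going up the chain, at each new member [X] the map
    is kept on [K] and on what was already treated, and is set to zero on a complement of these in
    [U :&: X]. Obstructions only arise from comparing different chains. *)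
Lemma chain_extension Y K U B g :
  sorted subsetv Y -> (K <= U)%VS ->
  (forall X, X \in Y -> {in (K :&: X)%VS, forall u, g u \in (B :&: X)%VS}) ->
  exists2 r : 'End(V), {in K, r =1 g} &
    forall X, X \in Y -> {in (U :&: X)%VS, forall u, r u \in (B :&: X)%VS}.
Proof.
move=> + KU; elim/last_ind: Y => [|Y X IH] srt gK; first by exists g.
have sortedY : sorted subsetv Y.
  by case: Y srt {IH gK} => //= X' Y; rewrite rcons_path => /andP[].
have leX X' : X' \in Y -> (X' <= X)%VS.
  move: srt; rewrite -cats1 sorted_pairwise; last exact: subv_trans.
  by rewrite pairwise_cat allrel1r => /and3P[/allP + _ _] => /[apply].
have [|r rK rY] := IH sortedY.
  by move=> X' X'Y; apply: gK; rewrite mem_rcons inE X'Y orbT.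
pose L := last 0%VS Y.
have YL X' : X' \in Y -> (X' <= L)%VS.
  move=> X'Y; rewrite /L; case: (lastP Y) X'Y sortedY => // Z L' + ZL'.
  rewrite last_rcons mem_rcons inE => /predU1P[-> //|X'Z].
  move: ZL'; rewrite -cats1 sorted_pairwise; last exact: subv_trans.
  by rewrite pairwise_cat allrel1r => /and3P[/allP + _ _] => /(_ _ X'Z).
have LX : (L <= X)%VS.
  by rewrite /L; case: (lastP Y) leX => [|Z L' H]; rewrite ?sub0v // last_rcons H // mem_rcons mem_head.
have rL : {in (U :&: L)%VS, forall u, r u \in (B :&: X)%VS}.
  rewrite /L; case: (lastP Y) rY leX => [|Z L'] H leX u.
    by rewrite capv0 memv0 => /eqP ->; rewrite linear0 mem0v.
  have L'in : L' \in rcons Z L' by rewrite mem_rcons mem_head.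
  by rewrite last_rcons => /(H _ L'in); apply/subvP/capvS; rewrite ?leX.
pose S := (K + U :&: L)%VS.
have SX : (S :&: (U :&: X) = K :&: X + U :&: L)%VS.
  by rewrite /S addvC -vspace_modl ?capvS // addvC capvA (capv_idPl KU).
pose D := ((U :&: X) :\: S)%VS.
have DS : (D :&: S = 0)%VS by exact: capv_diff.
pose r' := (r \o (\1 - daddv_pi D S))%VF.
have r'S : {in S, r' =1 r}.
  move=> u uS; rewrite comp_lfunE add_lfunE opp_lfunE id_lfunE.
  by rewrite (daddv_pi0 DS uS) subr0.
exists r' => [u uK | X' ].
  by rewrite r'S ?rK // (subvP (addvSl K _)).
rewrite mem_rcons inE => /predU1P[-> | X'Y] u uUX; last first.
  rewrite r'S; first exact: rY.
  by apply: subvP uUX; rewrite (subv_trans _ (addvSr _ _)) // capvS // YL.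
have : u \in (D + (U :&: X) :&: S)%VS by rewrite addv_diff_cap.
case/memv_addP => d dD [w]; rewrite capvC SX => /memv_addP[x xK [y yL ->]] ->.
rewrite !linearD /= memvD //.
  by rewrite comp_lfunE add_lfunE opp_lfunE id_lfunE daddv_pi_id // subrr linear0 mem0v.
have xS : x \in S by apply: subvP xK; rewrite (subv_trans _ (addvSl _ _)) // capvSl.
have yS : y \in S by apply: subvP yL; rewrite addvSr.
rewrite !r'S // memvD //; last exact: rL.
rewrite rK; last by move: xK; rewrite memv_cap => /andP[].
by apply: gK => //; rewrite mem_rcons mem_head.
Qed.

Lemma factor_through U (h k : 'End(V)) :
  {in U, forall u, k u = 0 -> h u = 0} ->
  exists psi : 'End(V), {in U, forall u, psi (k u) = h u}.
Proof.
move=> hk; pose kU := (k \o projv U)%VF.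
exists (h \o (projv U \o kU^-1))%VF => u uU.
have kuE : k u = kU u by rewrite comp_lfunE projv_id.
rewrite !comp_lfunE; set w := projv U _.
have wU : w \in U by exact: memv_proj.
have kw : k w = k u.
  rewrite kuE; have <- : (kU (kU^-1 (kU u)))%VF = kU u by apply/limg_lfunVK/memv_img/memvf.
  by rewrite [RHS]comp_lfunE /w kuE.
apply/eqP; rewrite -subr_eq0 -linearB /= hk ?memvB // linearB /= kw subrr //.
Qed.

End Representation.

(** * Indecomposable representations are rigid bricks *)

Section ThreeChains.
Import VectorInternalTheory.
Local Open Scope ring_scope.
Variables (F : numClosedFieldType) (V : vectType F).
Implicit Types A B D K U W X : {vspace V}.
Implicit Types f g : 'End(V).
Implicit Types Y : seq {vspace V}.

Lemma eigenvector_in U f : {in U, forall u, f u \in U} -> U != 0%VS ->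
  exists (c : F) (v : V), [/\ v \in U, v != 0 & f v = c *: v].
Proof.
move=> fU U0.
pose g : 'End(subvs_of U) := (linfun (vsproj U) \o (f \o linfun vsval))%VF.
have [|c /eigenvalueP[v vg v0]] := eigenvalue_closed (f2mx g).
  by rewrite lt0n dimv_eq0.
exists c, (vsval (r2v v)); split; first exact: subvsP.
  apply: contra_neq v0 => rv0; rewrite -(r2vK v).
  by rewrite (_ : r2v v = 0) ?linear0 //; apply: val_inj.
have gv : g (r2v v) = c *: r2v v by rewrite unlock /= r2vK vg linearZ.
move/(congr1 (@vsval _ _ _)): gv; rewrite !comp_lfunE !lfunE /= vsprojK //.
by apply: fU; exact: subvsP.
Qed.

Variables (a b c : seq {vspace V}).
Hypotheses (sorted_a : sorted subsetv a) (sorted_b : sorted subsetv b)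
  (sorted_c : sorted subsetv c).
Hypotheses (size_a : (size a <= 4)%N) (size_b : (size b <= 2)%N)
  (size_c : (size c <= 1)%N).

Definition poset_endo U f :=
  {in U, forall u, f u \in U} /\
  forall X, X \in a ++ b ++ c -> {in (U :&: X)%VS, forall u, f u \in (U :&: X)%VS}.

Definition brick U := forall f, poset_endo U f ->
  exists x : F, {in U, forall u, f u = x *: u}.

Definition decomposes U A B := [/\ (A + B = U)%VS, (A :&: B = 0)%VS &
  forall X, X \in a ++ b ++ c -> (U :&: X <= A :&: X + B :&: X)%VS].

Definition indecomposable_in U := forall A B, decomposes U A B -> A = 0%VS \/ B = 0%VS.

(** For a complement [W] of [U], adding [W] to the targets leaves the components along [W] free. The
    codimension in [End(V)] is then the one that the chain conditions have in [End(U)]. *)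
Definition preserving U W Y : {vspace 'End(V)} :=
  flag_homset [seq (U :&: X, (U :&: X) + W)%VS | X <- Y].

Lemma sorted_preserving U W Y : sorted subsetv Y ->
  sorted (fun p q => (p.1 <= q.1)%VS && (p.2 <= q.2)%VS)
    [seq (U :&: X, (U :&: X) + W)%VS | X <- Y].
Proof.
rewrite sorted_map; apply: sub_sorted => X X' XX' /=.
by rewrite addvS ?capvS.
Qed.

Lemma codim_preserving U W Y : (U :&: W = 0)%VS -> (U + W = fullv)%VS ->
  flag_codim 0 [seq (U :&: X, (U :&: X) + W)%VS | X <- Y] =
  chain_codim (\dim U) 0 [seq \dim (U :&: X) | X <- Y].
Proof.
move=> UW0 UWf; elim: Y 0%N => //= X Y IH n; rewrite IH; congr (_ * _ + _)%N.
rewrite dimv_disjoint_sum; last first.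
  by apply/eqP; rewrite -subv0 -UW0 capvS // capvSl.
by rewrite -UWf dimv_disjoint_sum // subnDr.
Qed.

Lemma chain_codim_dims U Y k : sorted subsetv Y -> (size Y <= k)%N ->
  (2 * k.+1 * chain_codim (\dim U) 0 [seq \dim (U :&: X) | X <- Y] <=
   k * (\dim U) ^ 2)%N.
Proof.
move=> srt sk; rewrite -[in leqRHS](subn0 (\dim U)).
apply: chain_codim_bound => //; first by rewrite size_map.
  case: Y srt sk => //= X Y XY _;  rewrite (path_map (f := fun X => \dim (U :&: X)%VS)).
  by apply: sub_path XY => X1 X2 X12; rewrite /= dimvS // capvS.
by apply/allP => _ /mapP[X _ ->]; rewrite /= dimvS // capvSl.
Qed.

(* [Ext(U, U) = 0]: the Tits form of the Dynkin diagram is positive, so the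
   codimensions add up to at most [(\dim U) ^ 2 - 1]. *)
Lemma brick_rigid U W : U != 0%VS -> (U :&: W = 0)%VS -> (U + W = fullv)%VS ->
  brick U ->
  let P := preserving U W in
  (P a + P b = fullv)%VS /\ (P a :&: P b + P c = fullv)%VS.
Proof.
move=> U0 UW0 UWf brU P.
have m_gt0 : (0 < \dim U)%N by rewrite lt0n dimv_eq0.
have PE Y : sorted subsetv Y ->
  (\dim (P Y) + chain_codim (\dim U) 0 [seq \dim (U :&: X) | X <- Y] = \dim {:'End(V)})%N.
  move=> srt; rewrite -(codim_preserving Y UW0 UWf).
  by apply: codim_flag_homset; apply: sorted_preserving.
have := PE _ sorted_a; have := PE _ sorted_b; have := PE _ sorted_c.
have := chain_codim_dims U sorted_a size_a.
have := chain_codim_dims U sorted_b size_b.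
have := chain_codim_dims U sorted_c size_c.
(* Followed by the projection to [U] along [W], such an [f] is an endomorphism of the representation
   on [U], hence a scalar [x] there; so [f - x] maps [U] into [W]. *)
have capP : (P a :&: P b :&: P c <= homset U W + <[\1%VF]>)%VS.
  apply/subvP => f; rewrite !memv_cap => /andP[/andP[fa fb] fc].
  have fX X : X \in a ++ b ++ c ->
      {in (U :&: X)%VS, forall u, f u \in ((U :&: X) + W)%VS}.
    move=> XY; suff [Y XinY] : exists2 Y, X \in Y & f \in P Y.
      by move/flag_homsetP; apply; apply: map_f.
    by move: XY; rewrite !mem_cat => /or3P[] ?; [exists a|exists b|exists c].
  have [|x fx] := brU (daddv_pi U W \o f)%VF.
    split=> [u _|X XY u uUX]; first by rewrite comp_lfunE memv_pi.
    rewrite comp_lfunE; have /memv_addP[v vUX [w wW ->]] := fX X XY u uUX.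
    rewrite linearD /= daddv_pi_id //; last by move: vUX; rewrite memv_cap => /andP[].
    by rewrite (daddv_pi0 UW0 wW) addr0.
  have -> : f = (f - x *: \1%VF) + x *: \1%VF by rewrite subrK.
  apply: memv_add; last by rewrite memvZ ?memv_line.
  apply/homsetP => u uU; rewrite add_lfunE opp_lfunE scale_lfunE id_lfunE.
  rewrite -fx // comp_lfunE.
  have /(daddv_pi_add UW0) {1}<- : f u \in (U + W)%VS by rewrite UWf memvf.
  by rewrite addrC addKr memv_pi.
have := codim_homset U W; rewrite -UWf dimv_disjoint_sum // addnK.
have := leq_trans (dimvS capP) (dimv_add_leqif _ _).
rewrite dim_vline.
have -> : ((\1%VF : 'End(V)) != 0) = true.
  apply/eqP => /lfunP/(_ (vpick U)); rewrite id_lfunE zero_lfunE => /eqP.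
  by rewrite vpick0 (negPf U0).
have := dimv_sum_cap (P a) (P b); have := dimv_sum_cap (P a :&: P b) (P c).
have := dimvS (subvf (P a + P b)%VS); have := dimvS (subvf (P a :&: P b + P c)%VS).
rewrite (mulnn (\dim U)) /=.
have : (0 < \dim U ^ 2)%N by rewrite expn_gt0 m_gt0.
(* Here [s] is the square of [\dim U]. The bounds on [ca], [cb], [cc] give a total of at most
   [59 s / 60], hence at most [s - 1]. So [sab + sabc] is at least [2 N], while neither summand
   exceeds [N]. *)
have arith (N pa pb pc pab pabc sab sabc h s ca cb cc : nat) : (0 < s)%N -> (sab <= N)%N -> (sabc <= N)%N ->
  (sabc + pabc = pab + pc)%N -> (sab + pab = pa + pb)%N ->
  (pabc <= h + 1)%N -> (h + s = N)%N -> (2 * 2 * cc <= 1 * s)%N ->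
  (2 * 3 * cb <= 2 * s)%N -> (2 * 5 * ca <= 4 * s)%N -> (pc + cc = N)%N ->
  (pb + cb = N)%N -> (pa + ca = N)%N -> (N <= sab)%N /\ (N <= sabc)%N by lia.
move=> s0 habc hab h3 h4 h5 h6 h7 h8 h9 h10 h11 h12.
have [dab dabc] := arith _ _ _ _ _ _ _ _ _ _ _ _ _ s0 hab habc h3 h4 h5 h6 h7 h8 h9 h10 h11 h12.
by split; apply/eqP; rewrite eqEdim subvf.
Qed.

Lemma sorted_chain Y : Y \in [:: a; b; c] -> sorted subsetv Y.
Proof. by rewrite !inE => /or3P[] /eqP ->. Qed.

Lemma sub_poset Y X : Y \in [:: a; b; c] -> X \in Y -> X \in a ++ b ++ c.
Proof. by rewrite !mem_cat !inE => /or3P[] /eqP -> ->; rewrite ?orbT. Qed.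

Lemma decomposes_left K A B A1 B1 :
  decomposes K A B -> decomposes A A1 B1 -> decomposes K A1 (B1 + B).
Proof.
move=> [AB_K AB0 AB_X] [AB_A AB1 AB1_X]; split.
- by rewrite addvA AB_A.
- apply/eqP; rewrite -subv0; apply/subvP => u; rewrite memv_cap => /andP[uA1].
  case/memv_addP => v vB1 [w wB uE].
  have A1A : (A1 <= A)%VS by rewrite -AB_A addvSl.
  have B1A : (B1 <= A)%VS by rewrite -AB_A addvSr.
  have w0 : w = 0.
    apply/eqP; rewrite -memv0 -AB0 memv_cap wB andbT.
    have -> : w = u - v by rewrite uE addrAC subrr add0r.
    by apply: memvB; [exact: (subvP A1A) | exact: (subvP B1A)].
  by rewrite -AB1 memv_cap uA1 uE w0 addr0.
move=> X XY; apply: subv_trans (AB_X X XY) _; rewrite subv_add.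
apply/andP; split.
  by apply: subv_trans (AB1_X X XY) _; rewrite addvS // capvS // addvSl.
by rewrite (subv_trans _ (addvSr _ _)) // capvS // addvSr.
Qed.

Lemma decomposesC K A B : decomposes K A B -> decomposes K B A.
Proof.
move=> [AB_K AB0 AB_X]; split; first by rewrite addvC.
  by rewrite capvC.
by move=> X XY; rewrite addvC; exact: AB_X.
Qed.

Lemma poset_endo_comp U f g : poset_endo U f -> poset_endo U g ->
  poset_endo U (f \o g)%VF.
Proof.
move=> [fU fX] [gU gX]; split=> [u uU|X XY u uX]; rewrite comp_lfunE.
  by apply/fU/gU.
by apply: fX => //; apply: gX.
Qed.

(** [f] is injective on its image, so it maps [(f @: U) :&: Z] onto itself for every [Z] in [U] that
    it preserves. For [u] in [Z], therefore, [f u = f w] with [w] in [(f @: U) :&: Z], and [u - w]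
    is in the kernel. The cases [Z = U] and [Z = U :&: X] give a splitting compatible with the
    chains. *)
Lemma fitting U f : poset_endo U f -> (f @: (f @: U) = f @: U)%VS ->
  decomposes U (U :&: lker f) (f @: U).
Proof.
move=> [fU fX] ffU.
have fUU : (f @: U <= U)%VS by apply/subvP => _ /memv_imgP[u uU ->]; exact: fU.
have inj : ((f @: U) :&: lker f = 0)%VS.
  apply/eqP; rewrite -dimv_eq0; have := limg_ker_dim f (f @: U).
  by rewrite ffU -[RHS]add0n => /addIn ->.
have splitX Z : (Z <= U)%VS -> {in Z, forall u, f u \in Z} ->
    (Z <= (U :&: lker f) :&: Z + (f @: U) :&: Z)%VS.
  move=> ZU fZ; pose I := ((f @: U) :&: Z)%VS.
  have fI : (f @: I = I)%VS.
    apply/eqP; rewrite eqEdim limg_dim_eq ?leqnn ?andbT; last first.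
      by apply/eqP; rewrite -subv0 -inj capvS // capvSl.
    apply/subvP => _ /memv_imgP[u + ->]; rewrite !memv_cap => /andP[uI uZ].
    by rewrite memv_img ?fZ // (subvP fUU).
  apply/subvP => u uZ.
  have : f u \in (f @: I)%VS by rewrite fI memv_cap fZ // memv_img // (subvP ZU).
  case/memv_imgP => w wI fuw.
  have wZ : w \in Z by move: wI; rewrite memv_cap => /andP[].
  rewrite -(subrK w u) memv_add // !memv_cap memv_ker linearB /= fuw subrr eqxx andbT.
  by rewrite !memvB // (subvP ZU).
split.
- apply/eqP; rewrite eqEsubv subv_add capvSl fUU /=.
  by apply: subv_trans (splitX U (subvv U) fU) _; rewrite addvS ?capvSl.
- by apply/eqP; rewrite -subv0 -inj capvC capvS // capvSr.
move=> X XY; apply: subv_trans (splitX _ (capvSl U X) (fX X XY)) _.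
by rewrite addvS // capvS // capvSr.
Qed.

Lemma daddv_pi_homo K A B X : decomposes K A B -> X \in a ++ b ++ c ->
  {in (K :&: X)%VS, forall u, daddv_pi A B u \in (A :&: X)%VS}.
Proof.
move=> [_ AB0 AB_X] XY u /(subvP (AB_X X XY)) /memv_addP[v vA [w wB ->]].
move: vA wB; rewrite memv_cap => /andP[vA vX]; rewrite memv_cap => /andP[wB wX].
by rewrite linearD /= (daddv_pi0 AB0 wB) addr0 (daddv_pi_id AB0 vA) memv_cap vA vX.
Qed.

(* Ringel's argument.  A square-zero endomorphism [t] of minimal rank maps [U]
   into its kernel [K = A + B]; if [A] had no self-extensions then, as
   [t @: U] embeds into [A], the extension of [t @: U] by [A] obtained from [U]
   would split and [A] would be a direct summand of [U]. *)
Lemma summand_of_kernel U t A B :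
  indecomposable_in U -> poset_endo U t ->
  let K := (U :&: lker t)%VS in
  (t @: U <= K)%VS -> K != U -> decomposes K A B -> ~~ (t @: U <= B)%VS ->
  ((t @: U) :&: lker (daddv_pi A B) = 0)%VS ->
  indecomposable_in A -> brick A -> False.
Proof.
move=> indU [tU tX] K tK KU dec tB inj indA brA.
have [AB_K AB0 AB_X] := dec; pose p := daddv_pi A B.
have AK : (A <= K)%VS by rewrite -AB_K addvSl.
have KsubU : (K <= U)%VS by rewrite capvSl.
have A0 : A != 0%VS.
  by apply: contraNneq tB => A0; rewrite -[B]add0v -A0 AB_K.
have AC0 := capv_compl A; have ACf := addv_complf A.
have [Pab Pabc] := brick_rigid A0 AC0 ACf brA.
(* Along each chain separately the projection [p] of [K] onto [A] extends to [U]; the three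
   extensions need not agree. *)
have ext Y : Y \in [:: a; b; c] -> exists r : 'End(V), [/\ {in K, r =1 p},
    {in U, forall u, r u \in A} &
    forall X, X \in Y -> {in (U :&: X)%VS, forall u, r u \in (A :&: X)%VS}].
  move=> Yin; have [|r rK rY] := @chain_extension _ _ Y K U A p (sorted_chain Yin) KsubU.
    by move=> X XY; apply: daddv_pi_homo => //; exact: sub_poset XY.
  exists (p \o r)%VF; split => [u uK|u uU|X XY u uX]; rewrite comp_lfunE.
  - by rewrite rK // /p daddv_pi_proj.
  - by rewrite /p memv_pi.
  - by have := rY X XY u uX; rewrite memv_cap => /andP[ruA ruX]; rewrite /p daddv_pi_id // memv_cap ruA.
have [ra [raK raA raX]] : exists r, _ := ext a (mem_head _ _).
(* Two extensions agree on [K], the kernel of [t] in [U], and by [inj] this is also the kernel of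
   [p \o t] there. Their difference thus factors through [p \o t]; the factors [psi] are the cocycle
   of the extension. *)
have psiE Y : Y \in [:: a; b; c] -> exists (psi r : 'End(V)),
    [/\ {in U, forall u, psi (p (t u)) = r u - ra u}, {in U, forall u, r u \in A} &
    forall X, X \in Y -> {in (U :&: X)%VS, forall u, r u \in (A :&: X)%VS}].
  move=> /ext[r [rK rA rX]].
  have [|psi psiE] := @factor_through _ _ U (r - ra) (p \o t)%VF.
    move=> u uU /eqP; rewrite comp_lfunE -memv_ker => ptu.
    have : t u \in (t @: U :&: lker p)%VS by rewrite memv_cap memv_img.
    rewrite inj memv0 -memv_ker => ut.
    have uK : u \in K by rewrite memv_cap uU.
    by rewrite add_lfunE opp_lfunE rK // raK // subrr.
  exists psi, r; split=> // u uU.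
  by rewrite -[p (t u)]comp_lfunE psiE // add_lfunE opp_lfunE.
have b_in : b \in [:: a; b; c] by rewrite !inE eqxx orbT.
have c_in : c \in [:: a; b; c] by rewrite !inE eqxx !orbT.
have [psib [rb [psibE rbA rbX]]] := psiE b b_in.
have [psic [rc [psicE rcA rcX]]] := psiE c c_in.
(* The cocycle is a coboundary: [f] is to be congruent to 0, [psib], [psic] modulo the spaces
   attached to [a], [b], [c]. The first rigidity equality lets [xa] solve the first two congruences;
   the second corrects [xa] by an element [y] that does not disturb them. *)
have /memv_addP[xa xaP [xb xbP psibD]] : psib \in (preserving A A^C a + preserving A A^C b)%VS.
  by rewrite Pab memvf.
have /memv_addP[y] : xa - psic \in
    (preserving A A^C a :&: preserving A A^C b + preserving A A^C c)%VS.
  by rewrite Pabc memvf.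
rewrite memv_cap => /andP[yPa yPb] [z zPc fE].
pose f := xa - y.
have fa : f - 0 \in preserving A A^C a by rewrite subr0 memvB.
have fb : f - psib \in preserving A A^C b.
  by rewrite /f psibD opprD addrACA subrr add0r -opprD memvN memvD.
have fc : f - psic \in preserving A A^C c.
  by rewrite /f addrAC fE addrAC subrr add0r.
clearbody f.
(* A retraction of [U] onto [A] compatible with all three chains: along each of them it is that
   chain's own extension plus a term preserving the chain. *)
pose r := (ra + (projv A \o (f \o (p \o t))))%VF.
have rE u : r u = ra u + projv A (f (p (t u))).
  by rewrite [LHS]add_lfunE !comp_lfunE.
have ptX X : X \in a ++ b ++ c -> {in (U :&: X)%VS, forall u, p (t u) \in (A :&: X)%VS}.
  move=> XY u uX; apply: (daddv_pi_homo dec XY).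
  have uU : u \in U by move: uX; rewrite memv_cap => /andP[].
  rewrite memv_cap (subvP tK) ?memv_img //=.
  by have := tX X XY u uX; rewrite memv_cap => /andP[].
have rX Y psi rY : Y \in [:: a; b; c] -> f - psi \in preserving A A^C Y ->
    {in U, forall u, psi (p (t u)) = rY u - ra u} ->
    {in U, forall u, rY u \in A} ->
    (forall X, X \in Y -> {in (U :&: X)%VS, forall u, rY u \in (A :&: X)%VS}) ->
    forall X, X \in Y -> {in (U :&: X)%VS, forall u, r u \in (A :&: X)%VS}.
  move=> Yin fP psiE' rYA rYX X XY u uX.
  have uU : u \in U by move: uX; rewrite memv_cap => /andP[].
  have XP := sub_poset Yin XY.
  have -> : r u = rY u + projv A ((f - psi) (p (t u))).
    rewrite rE add_lfunE opp_lfunE linearB /= psiE' // [projv A (rY u - _)]projv_id.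
      by rewrite addrCA opprB subrKC addrC.
    by rewrite memvB ?rYA ?raA.
  rewrite memvD ?(rYX X XY) //.
  have /flag_homsetP /(_ _ _ (map_f _ XY)) H := fP.
  have /memv_addP[v vX [w wC ->]] := H _ (ptX X XP u uX).
  rewrite linearD /=.
  have -> : projv A w = 0 by apply/eqP; rewrite -memv_ker lker_proj.
  by rewrite addr0 projv_id //; move: vX; rewrite memv_cap => /andP[].
have rall X : X \in a ++ b ++ c -> {in (U :&: X)%VS, forall u, r u \in (A :&: X)%VS}.
  rewrite !mem_cat => /or3P[] XY; [apply: (rX a 0 ra)|apply: (rX b psib rb)|apply: (rX c psic rc)] => //.
  - by rewrite mem_head.
  - by move=> u _; rewrite zero_lfunE subrr.
have rA : {in U, forall u, r u \in A}.
  by move=> u uU; rewrite rE memvD ?raA ?memv_proj.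
have rid : {in A, forall u, r u = u}.
  move=> u uA; have uK := subvP AK _ uA; rewrite rE raK // /p daddv_pi_id //.
  have -> : t u = 0 by apply/eqP; rewrite -memv_ker; move: uK; rewrite memv_cap => /andP[].
  by rewrite !linear0 addr0.
have AU : (A <= U)%VS by exact: subv_trans AK KsubU.
case: (indU A (U :&: lker r)%VS).
- have splitr u : u \in U -> u - r u \in (U :&: lker r)%VS.
    move=> uU; rewrite memv_cap memvB // ?(subvP AU) ?rA //=.
    by rewrite memv_ker linearB /= (rid (r u)) ?rA // subrr.
  split.
  + apply/eqP; rewrite eqEsubv subv_add AU capvSl /=; apply/subvP => u uU.
    by rewrite -(subrKC (r u) u) memv_add ?rA // splitr.
  + apply/eqP; rewrite -subv0; apply/subvP => u; rewrite !memv_cap memv_ker.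
    by move=> /and3P[uA _]; rewrite rid // memv0.
  + move=> X XP; apply/subvP => u uX.
    have uU : u \in U by move: uX; rewrite memv_cap => /andP[].
    rewrite -(subrKC (r u) u) memv_add ?rall // memv_cap splitr //=.
    have := rall X XP u uX; rewrite memv_cap => /andP[_ ruX].
    by rewrite memvB //; move: uX; rewrite memv_cap => /andP[].
- by move/eqP; rewrite (negPf A0).
move=> Ukr; case/eqP: KU; apply/eqP; rewrite eqEsubv KsubU; apply: subv_trans AK.
apply/subvP => u uU.
have : u - r u \in (U :&: lker r)%VS.
  rewrite memv_cap memvB // ?(subvP AU) ?rA //=.
  by rewrite memv_ker linearB /= (rid (r u)) ?rA // subrr.
by rewrite Ukr memv0 subr_eq0 => /eqP ->; exact: rA.
Qed.

(** Subtracting an eigenvalue leaves an endomorphism that is not injective, so a nonzero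
    non-injective [t] has to be excluded. Three descents are nested: on [\dim U], which makes the
    summand [A] a brick; on the rank of [t], which makes [t \o t] vanish on [U] and the projection
    to [A] injective on [t @: U]; and on [\dim A], which makes [A] indecomposable. *)
Theorem indecomposable_brick U : indecomposable_in U -> brick U.
Proof.
have [n] := ubnP (\dim U); elim: n U => // n IHn U; rewrite ltnS => dimU indU f fP.
have [->|U0] := eqVneq U 0%VS.
  by exists 0 => u; rewrite memv0 => /eqP ->; rewrite linear0 scaler0.
have [fU fX] := fP; have [x [v [vU v0 fv]]] := eigenvector_in fU U0.
exists x; suff : (U <= lker (f - x *: \1%VF))%VS.
  move=> /subvP H u /H; rewrite memv_ker add_lfunE opp_lfunE scale_lfunE id_lfunE.
  by rewrite subr_eq0 => /eqP.
apply: contraT => Ug; exfalso.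
suff ranks k t : poset_endo U t -> ~~ (U <= lker t)%VS -> (\dim (t @: U) < k)%N ->
    (\dim (t @: U) < \dim U)%N -> False.
  apply: (ranks (\dim ((f - x *: \1%VF) @: U)).+1 (f - x *: \1%VF)) => //.
    split=> [u uU|X XY u]; rewrite add_lfunE opp_lfunE scale_lfunE id_lfunE.
      by rewrite memvB ?memvZ ?fU.
    by move=> uX; rewrite memvB ?memvZ // fX.
  rewrite -[X in (_ < X)%N](limg_ker_dim (f - x *: \1%VF)) -[X in (X < _)%N]add0n ltn_add2r.
  rewrite lt0n dimv_eq0; apply: contraNneq v0 => /vspaceP/(_ v).
  by rewrite memv0 => <-; rewrite memv_cap vU memv_ker add_lfunE opp_lfunE scale_lfunE id_lfunE fv subrr eqxx.
elim: k t => // k IHk t tP t0; rewrite ltnS => tk tU.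
have [tUU tX] := tP.
have tsubU : (t @: U <= U)%VS by apply/subvP => _ /memv_imgP[u uU ->]; exact: tUU.
have I0 : (t @: U != 0)%VS by rewrite -lkerE.
have [ttU|tt0] := boolP (t @: U <= t @: (t @: U))%VS.
  have ttE : (t @: (t @: U) = t @: U)%VS by apply/eqP; rewrite eqEsubv ttU limgS.
  have [K0|I0'] := indU _ _ (fitting tP ttE); last by rewrite I0' eqxx in I0.
  by move: tU; rewrite -(limg_ker_dim t U) K0 dimv0 add0n ltnn.
have tK : (t @: U <= U :&: lker t)%VS.
  rewrite subv_cap tsubU lkerE -limg_comp -lkerE; apply: contraT => ttn; exfalso.
  apply: (IHk (t \o t)%VF) => //; first exact: poset_endo_comp.
    rewrite limg_comp (leq_trans _ tk) //.
    by rewrite ltn_neqAle dimvS ?limgS // andbT (dimv_leqif_sup (limgS t tsubU)).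
  by rewrite limg_comp (leq_ltn_trans _ tU) // dimvS // limgS.
set K := (U :&: lker t)%VS in tK.
have KU : K != U by apply: contraNneq t0 => <-; rewrite capvSr.
suff summands m A B : decomposes K A B -> ~~ (t @: U <= B)%VS -> (\dim A < m)%N -> False.
  apply: (summands (\dim K).+1 K 0%VS) => //; last by rewrite subv0.
  by split=> [||X _]; rewrite ?addv0 ?capv0 ?addvSl.
elim: m A B => // m IHm A B dec tB; rewrite ltnS => Am.
have [AB_K AB0 AB_X] := dec.
have indA : indecomposable_in A.
  move=> A1 B1 decA; have [->|A10] := eqVneq A1 0%VS; first by left.
  have [->|B10] := eqVneq B1 0%VS; first by right.
  have [ABA AB1 _] := decA.
  have dimA : (\dim A1 + \dim B1)%N = \dim A by rewrite -ABA dimv_disjoint_sum.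
  exfalso; have dimA1 := A10; have dimB1 := B10.
  rewrite -dimv_eq0 -lt0n in dimA1; rewrite -dimv_eq0 -lt0n in dimB1.
  (* By minimality of [\dim A], neither [A1] nor [B1] can replace [A]; so [t @: U] lies in both
     [B1 + B] and [A1 + B], whose intersection is [B]. *)
  have [tB1|] := boolP (t @: U <= B1 + B)%VS; last first.
    by move=> /IHm; apply; [exact: decomposes_left dec decA | rewrite (leq_trans _ Am) // -dimA -ltn_subLR // subnn].
  have [tA1|] := boolP (t @: U <= A1 + B)%VS; last first.
    move=> /IHm; apply; first exact: decomposes_left dec (decomposesC decA).
    by rewrite (leq_trans _ Am) // -dimA -[X in (X < _)%N]add0n ltn_add2r.
  case/negP: tB; apply: subv_trans (_ : (A1 + B) :&: (B1 + B) <= B)%VS; first by rewrite subv_cap tA1.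
  have [_ cap _] := decomposes_left dec (decomposesC decA).
  apply/subvP => u; rewrite memv_cap => /andP[/memv_addP[v1 v1A [w wB ->]] uB1].
  suff -> : v1 = 0 by rewrite add0r.
  apply/eqP; rewrite -memv0.
  have [_ <- _] := decomposes_left dec decA; rewrite memv_cap v1A /=.
  by rewrite -(addrK w v1) memvB // (subvP (addvSr B1 B)).
have brA : brick A.
  apply: IHn => //; apply: leq_trans dimU.
  apply: (@leq_ltn_trans (\dim K)); first by rewrite dimvS // -AB_K addvSl.
  by rewrite ltn_neqAle dimvS ?capvSl // andbT (dimv_leqif_eq (capvSl _ _)).
apply: (summand_of_kernel indU tP tK KU dec tB _ indA brA).
apply/eqP; rewrite -dimv_eq0; apply: contraT => rk; exfalso.
pose p := daddv_pi A B.
have AK : (A <= K)%VS by rewrite -AB_K addvSl.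
apply: (IHk (p \o t)%VF).
- split=> [u uU|X XY u uX]; rewrite comp_lfunE.
    by rewrite (subvP (subv_trans AK (capvSl _ _))) // memv_pi.
  have uU : u \in U by move: uX; rewrite memv_cap => /andP[].
  have : t u \in (K :&: X)%VS.
    rewrite memv_cap (subvP tK) ?memv_img //=.
    by have := tX X XY u uX; rewrite memv_cap => /andP[].
  by move/(daddv_pi_homo dec XY); apply/subvP/capvS => //; exact: subv_trans AK (capvSl _ _).
- apply: contra tB => /subvP H; apply/subvP => _ /memv_imgP[u uU ->].
  have := H u uU; rewrite memv_ker comp_lfunE => /eqP ptu.
  have /(daddv_pi_add AB0) <- : t u \in (A + B)%VS by rewrite AB_K (subvP tK) // memv_img.
  by rewrite -/p ptu add0r memv_pi.
- rewrite limg_comp (leq_trans _ tk) //.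
  by rewrite -[X in (_ < X)%N](limg_ker_dim p) -[X in (X < _)%N]add0n ltn_add2r lt0n.
by rewrite limg_comp (leq_ltn_trans _ tU) // -[X in (_ <= X)%N](limg_ker_dim p) leq_addl.
Qed.

(** [brick_rigid], with the whole space as [U], puts the endomorphism spaces of the three chains in
    general position. Each [Q Y] contains the space of its chain, and enlarging the spaces keeps the
    sums full. *)
Lemma rigid_inequality U1 U2 : brick fullv ->
  (\sum_(Y <- [:: a; b; c]) flag_codim 0 [seq (U1 :&: X, U2 + X)%VS | X <- Y] <=
   \dim U1 * (\dim {:V} - \dim U2))%N.
Proof.
have [V0 _|V0 brV] := eqVneq (fullv : {vspace V}) 0%VS.
  have dim0 (X : {vspace V}) : \dim X = 0%N by have := dimvS (subvf X); rewrite V0 dimv0 leqn0 => /eqP.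
  rewrite big1 // => Y _; elim: Y {1}0%N => //= X Y IH n.
  by rewrite IH !dim0.
have [Pab Pabc] := brick_rigid V0 (capv0 _) (addv0 _) brV.
pose Q Y := flag_homset [seq (U1 :&: X, U2 + X)%VS | X <- Y].
have PQ Y : (preserving fullv 0 Y <= Q Y)%VS.
  apply/subvP => f /flag_homsetP fP; apply/flag_homsetP => A B /mapP[X XY [-> ->]] u.
  rewrite memv_cap => /andP[_ uX]; apply: (subvP (addvSr U2 X)).
  have := fP _ _ (map_f _ XY) u; rewrite capfv addv0; exact.
have Qab : (Q a + Q b = fullv)%VS.
  by apply/eqP; rewrite eqEsubv subvf -Pab addvS.
have Qabc : (Q a :&: Q b + Q c = fullv)%VS.
  by apply/eqP; rewrite eqEsubv subvf -Pabc addvS ?capvS.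
have QE Y : sorted subsetv Y ->
    (\dim (Q Y) + flag_codim 0 [seq (U1 :&: X, U2 + X)%VS | X <- Y] = \dim {:'End(V)})%N.
  move=> srt; apply: codim_flag_homset; rewrite sorted_map.
  by apply: sub_sorted srt => X X' XX' /=; rewrite capvS ?addvS.
have sub : (homset U1 U2 <= Q a :&: Q b :&: Q c)%VS.
  apply/subvP => f /homsetP fU; rewrite !memv_cap -andbA; apply/and3P.
  by split; apply/flag_homsetP => A B /mapP[X _ [-> ->]] u;
     rewrite memv_cap => /andP[uU _]; apply: (subvP (addvSl U2 X)); exact: fU.
have := dimvS sub; have := codim_homset U1 U2.
have := QE _ sorted_a; have := QE _ sorted_b; have := QE _ sorted_c.
have := dimv_sum_cap (Q a) (Q b); have := dimv_sum_cap (Q a :&: Q b) (Q c).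
rewrite Qab Qabc !big_cons big_nil addn0.
have arith (N pa pb pc pab pabc h s ca cb cc : nat) :
  (N + pabc = pab + pc)%N -> (N + pab = pa + pb)%N -> (pc + cc = N)%N ->
  (pb + cb = N)%N -> (pa + ca = N)%N -> (h + s = N)%N -> (h <= pabc)%N ->
  (ca + (cb + cc) <= s)%N by lia.
exact: arith.
Qed.

End ThreeChains.

(** * Dimensions of subspaces and the tables of inequalities *)

Fixpoint ext_codim (n x : nat) (A B : seq nat) : nat :=
  match A, B with
  | a :: A', b :: B' => (a - x) * (n - b) + ext_codim n a A' B'
  | _, _ => 0
  end.

(** Abel summation of [ext_codim]: the coefficients of [A] become successive differences of [B]
    completed by [n], nonnegative for a sorted [B], so monotonicity in [A] becomes visible. *)
Fixpoint ext_abel (n : nat) (A B : seq nat) : nat :=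
  match A, B with
  | a :: A', b :: B' => a * (head n B' - b) + ext_abel n A' B'
  | _, _ => 0
  end.

Lemma ext_codim_abel n x A B :
  size A = size B -> path leq x A -> sorted leq (rcons B n) ->
  ext_codim n x A B + x * (n - head n B) = ext_abel n A B.
Proof.
elim: A B x => [|a A IH] [|b B] x //=; first by rewrite subnn muln0.
case=> sAB /andP[xa aA] bB.
have [bh hn sB] : [/\ b <= head n B, head n B <= n & sorted leq (rcons B n)].
  case: B bB {IH sAB} => [|b' B] /=; first by rewrite andbT.
  move=> /andP[-> h]; split=> //.
  have := order_path_min leq_trans h; rewrite all_rcons => /andP[] //.
have := IH B a sAB aA sB; nia.
Qed.

Lemma ext_abel_leq n A A' B : size A = size B -> all2 leq A' A ->
  ext_abel n A' B <= ext_abel n A B.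
Proof.
elim: A A' B => [|a A IH] [|a' A'] [|b B] //= [sAB] /andP[aa AA].
by rewrite leq_add ?leq_mul2r ?aa ?orbT // IH.
Qed.

Lemma ext_codim_leq n x A B B' : all2 leq B B' ->
  ext_codim n x A B' <= ext_codim n x A B.
Proof.
elim: A x B B' => [|a A IH] x [|b B] [|b' B'] //= /andP[bb BB].
by rewrite leq_add ?IH // leq_mul2l leq_sub2l ?orbT.
Qed.

(** Replaces the true dimensions [A] of the [U1 :&: X] and [B] of the [U2 + X] by computable bounds
    [A'] and [B'] without raising the codimension. Sortedness is what the Abel form requires. *)
Lemma ext_codim_estimate n A A' B B' :
  size A = size B -> size A = size A' -> size B = size B' ->
  all2 leq A' A -> all2 leq B B' -> sorted leq A -> sorted leq A' ->
  sorted leq (rcons B' n) ->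
  ext_codim n 0 A' B' <= ext_codim n 0 A B.
Proof.
move=> sAB sA sB AA BB srtA srtA' srtB.
have p0 s : sorted leq s -> path leq 0 s by case: s => //= ? ? ->.
apply: leq_trans (ext_codim_leq n 0 A BB).
have := @ext_codim_abel n 0 A B'; have := @ext_codim_abel n 0 A' B'.
rewrite !mul0n !addn0 => -> //; last 2 first.
- by rewrite -sA sAB sB.
- exact: p0.
move=> -> //; [| by rewrite sAB sB | exact: p0].
by apply: ext_abel_leq => //; rewrite sAB sB.
Qed.

Fixpoint zip_with (f : nat -> nat -> nat) (s t : seq nat) : seq nat :=
  match s, t with
  | x :: s', y :: t' => f x y :: zip_with f s' t'
  | _, _ => [::]
  end.

(* Lazy variants of [has] and [all2] for call-by-value evaluation. *)
Fixpoint lazy_has (T : Type) (a : pred T) (s : seq T) : bool :=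
  if s is x :: s' then if a x then true else lazy_has a s' else false.

Lemma lazy_hasE (T : Type) (a : pred T) s : lazy_has a s = has a s.
Proof. by elim: s => //= x s ->; case: (a x). Qed.

Fixpoint all_leq (u v : seq nat) : bool :=
  match u, v with
  | x :: u', y :: v' => if x <= y then all_leq u' v' else false
  | [::], [::] => true
  | _, _ => false
  end.

Lemma all_leqE u v : all_leq u v = all2 leq u v.
Proof. by elim: u v => [|x u IH] [|y v] //=; rewrite IH; case: (x <= y). Qed.

(* In the following, [ds] and [es] list, for each of the three chains, the
   dimensions of its subspaces [X] and of their intersections [U :&: X]; [gs]
   lists those of the sums [U + X], and [n], [m] are the dimensions of the whole
   space and of [U]. *)

Definition join_dims (m : nat) (ds es : seq (seq nat)) : seq (seq nat) :=
  [seq zip_with (fun d e => m + d - e) p.1 p.2 | p <- zip ds es].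

Definition positions (es : seq (seq nat)) : seq (option (nat * nat)) :=
  None :: [seq Some (i, j) | i <- iota 0 (size es), j <- iota 0 (size (nth [::] es i))].

Definition entry (es : seq (seq nat)) (p : nat * nat) : nat :=
  nth 0 (nth [::] es p.1) p.2.

(* Lower bounds for the dimensions of [U :&: Y :&: X], with [Y] at position
   [y]. *)
Definition meet_bound (m : nat) (es : seq (seq nat)) (y : option (nat * nat)) :=
  if y is Some p then
    (entry es p,
     [seq if i == p.1 then [seq minn (entry es p) e | e <- nth [::] es i]
          else [seq entry es p + e - m | e <- nth [::] es i] | i <- iota 0 (size es)])
  else (m, es).

(* Upper bounds for the dimensions of [U + Y + X], with [Y] at position [y]. *)
Definition join_bound (n m : nat) (gs : seq (seq nat)) (y : option (nat * nat)) :=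
  if y is Some p then
    (entry gs p,
     [seq if i == p.1 then [seq maxn (entry gs p) g | g <- nth [::] gs i]
          else [seq minn n (entry gs p + g - m) | g <- nth [::] gs i] | i <- iota 0 (size gs)])
  else (m, gs).

(** [A.1] and [B.1] are the exact dimensions of [U1] and [U2], whereas the codimensions are computed
    from bounds. Unsorted bounds are passed over, as [ext_codim_estimate] does not apply to them. *)
Definition violates (n : nat) (A B : nat * seq (seq nat)) : bool :=
  [&& all (sorted leq) A.2, all (fun s => sorted leq (rcons s n)) B.2 &
      A.1 * (n - B.1) < sumn [seq ext_codim n 0 p.1 p.2 | p <- zip A.2 B.2]].

(* Some pair [U1 = U :&: Y], [U2 = U + Y'] contradicts the inequality satisfied
   by the brick (see [rigid_inequality]), for every subspace [U] with these
   dimensions. *)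
Definition excluded (n : nat) (ds : seq (seq nat)) (m : nat) (es : seq (seq nat)) : bool :=
  let gs := join_dims m ds es in
  lazy_has (fun y => lazy_has (fun x => violates n (meet_bound m es y) (join_bound n m gs x))
                    (positions ds)) (positions ds).

Fixpoint chains_below (m x : nat) (ds : seq nat) : seq (seq nat) :=
  if ds is d :: ds' then
    flatten [seq [seq v :: s | s <- chains_below m v ds'] | v <- iota x (minn d m - x).+1]
  else [:: [::]].

Lemma mem_chains_below m x ds es : path leq x es -> all2 leq es ds -> all (geq m) es ->
  es \in chains_below m x ds.
Proof.
elim: es ds x => [|e es IH] [|d ds] x //; rewrite [path _ _ _]/= [all2 _ _ _]/= [all _ _]/=.
move=> /andP[xe ees] /andP[ed eds] /andP[em esm].
rewrite [chains_below m x (d :: ds)]/chains_below -/chains_below.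
apply/flattenP; exists [seq e :: s | s <- chains_below m e ds]; last by apply/map_f/IH.
apply: (map_f (fun v => [seq v :: s | s <- chains_below m v ds])).
rewrite mem_iota xe /=.
have : e <= minn d m by rewrite leq_min ed.
lia.
Qed.

Fixpoint choices (T : Type) (ss : seq (seq T)) : seq (seq T) :=
  if ss is s :: ss' then [seq x :: t | x <- s, t <- choices ss'] else [:: [::]].

Lemma mem_choices (T : eqType) (ss : seq (seq T)) (t : seq T) :
  size t = size ss -> (forall i x0 y0, i < size t -> nth x0 t i \in nth y0 ss i) ->
  t \in choices ss.
Proof.
elim: ss t => [|s ss IH] [|x t] //= [sz] H.
apply: allpairs_f; first exact: (H 0 x [::]).
by apply: IH => // i x0 y0 it; apply: (H i.+1).
Qed.

(** The filter expresses that the sums [U + X] also increase along the chain and have dimension at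
    most [n]. *)
Definition chain_candidates (n m : nat) (d : seq nat) : seq (seq nat) :=
  [seq e <- chains_below m 0 d |
   sorted leq (rcons (zip_with (fun d e => m + d - e) d e) n)].

Definition candidates (n : nat) (ds : seq (seq nat)) (m : nat) : seq (seq (seq nat)) :=
  choices [seq chain_candidates n m d | d <- ds].

Definition flat (D : dimdata) : seq nat := D.1.1.1 ++ D.1.1.2 ++ [:: D.1.2; D.2].

Definition flat_dims (es : seq (seq nat)) (m : nat) : seq nat := flatten es ++ [:: m].

Fixpoint dotn (u v : seq nat) : nat :=
  match u, v with
  | x :: u', y :: v' => x * y + dotn u' v'
  | _, _ => 0
  end.

(** A bilinear form truncated at 0, because its values serve as natural coefficients. They are only
    proposals: [certified] checks the identity that results from them. *)
Definition pairing (f v : seq nat) : nat :=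
  last 0 f * last 0 v - dotn (belast (head 0 f) (behead f)) (belast (head 0 v) (behead v)).

(* Items 2, 3 and 4 after removing the subspaces [0] and [V] and the
   repetitions from the two chains. *)
Definition table234 : seq (dimdata * seq dimdata) := ([::
  (([:: 1], [:: 1], 1, 2),
   [:: ([:: 1], [:: 0], 0, 1);
       ([:: 0], [:: 1], 0, 1);
       ([:: 0], [:: 0], 1, 1)]);
  (([:: 1; 2], [:: 1; 2], 1, 3),
   [:: ([:: 1; 1], [:: 0; 0], 0, 1);
       ([:: 1; 1], [:: 0; 1], 1, 2);
       ([:: 0; 0], [:: 1; 1], 0, 1);
       ([:: 0; 1], [:: 1; 1], 1, 2);
       ([:: 0; 1], [:: 0; 1], 0, 1)]);
  (([:: 1; 2], [:: 1; 2], 2, 3),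
   [:: ([:: 0; 0], [:: 0; 1], 1, 1);
       ([:: 0; 1], [:: 1; 2], 1, 2);
       ([:: 0; 1], [:: 0; 0], 1, 1);
       ([:: 1; 2], [:: 0; 1], 1, 2);
       ([:: 1; 1], [:: 1; 1], 1, 2)]);
  (([:: 1; 2; 3], [:: 1; 2], 2, 4),
   [:: ([:: 1; 1; 1], [:: 0; 0], 0, 1);
       ([:: 1; 1; 1], [:: 0; 1], 1, 2);
       ([:: 1; 1; 2], [:: 1; 2], 1, 3);
       ([:: 0; 0; 1], [:: 0; 0], 1, 1);
       ([:: 0; 1; 2], [:: 0; 1], 1, 2);
       ([:: 0; 1; 1], [:: 1; 1], 1, 2)]);
  (([:: 1; 2; 3], [:: 1; 3], 2, 4),
   [:: ([:: 0; 0; 0], [:: 0; 1], 1, 1);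
       ([:: 0; 0; 1], [:: 1; 2], 1, 2);
       ([:: 0; 1; 2], [:: 1; 2], 2, 3);
       ([:: 0; 1; 1], [:: 0; 1], 0, 1);
       ([:: 1; 2; 2], [:: 1; 2], 1, 3);
       ([:: 1; 1; 2], [:: 0; 1], 1, 2)]);
  (([:: 1; 2; 3], [:: 2; 3], 2, 4),
   [:: ([:: 0; 0; 1], [:: 1; 1], 0, 1);
       ([:: 0; 1; 2], [:: 1; 1], 1, 2);
       ([:: 1; 2; 3], [:: 1; 2], 1, 3);
       ([:: 1; 1; 1], [:: 1; 1], 1, 2);
       ([:: 1; 1; 2], [:: 1; 2], 2, 3);
       ([:: 0; 1; 1], [:: 1; 2], 1, 2)])])%N.

(* One list for each entry of [full_table]: through [pairing], the functionals
   dual to the vectors of the inequalities, modulo the dimension vector. *)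
Definition dual_rays : seq (seq dimdata) := ([::
  [:: ([:: 0], [:: 1], 1, 1);
      ([:: 1], [:: 0], 1, 1);
      ([:: 1], [:: 1], 0, 1)];
  [:: ([:: 0; 0], [:: 0; 1], 1, 1);
      ([:: 0; 1], [:: 1; 0], 0, 1);
      ([:: 0; 1], [:: 0; 0], 1, 1);
      ([:: 1; 0], [:: 0; 1], 0, 1);
      ([:: 1; 0], [:: 1; 0], 1, 1)];
  [:: ([:: 0; 1], [:: 1; 0], 0, 1);
      ([:: 1; 0], [:: 0; 0], 1, 1);
      ([:: 1; 0], [:: 0; 1], 0, 1);
      ([:: 0; 0], [:: 1; 0], 1, 1);
      ([:: 0; 1], [:: 0; 1], 1, 2)];
  [:: ([:: 0; 0; 0], [:: 0; 1], 1, 1);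
      ([:: 0; 0; 1], [:: 1; 0], 0, 1);
      ([:: 0; 1; 0], [:: 0; 0], 1, 1);
      ([:: 0; 1; 0], [:: 0; 1], 0, 1);
      ([:: 1; 0; 0], [:: 1; 0], 1, 1);
      ([:: 1; 0; 1], [:: 0; 1], 1, 2)];
  [:: ([:: 0; 0; 1], [:: 1; 0], 0, 1);
      ([:: 0; 1; 0], [:: 0; 0], 1, 1);
      ([:: 1; 0; 0], [:: 0; 1], 0, 1);
      ([:: 1; 0; 0], [:: 1; 0], 1, 1);
      ([:: 0; 0; 1], [:: 0; 1], 1, 2);
      ([:: 0; 1; 0], [:: 1; 1], 1, 2)];
  [:: ([:: 0; 1; 0], [:: 0; 0], 1, 1);
      ([:: 1; 0; 0], [:: 0; 1], 0, 1);
      ([:: 0; 0; 0], [:: 1; 0], 1, 1);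
      ([:: 0; 0; 1], [:: 0; 1], 1, 2);
      ([:: 0; 1; 0], [:: 1; 0], 0, 1);
      ([:: 1; 0; 1], [:: 1; 0], 1, 2)];
  [:: ([:: 0; 0; 0; 0], [:: 0; 1], 1, 1);
      ([:: 0; 0; 0; 1], [:: 1; 0], 0, 1);
      ([:: 0; 0; 1; 0], [:: 0; 0], 1, 1);
      ([:: 0; 1; 0; 0], [:: 0; 1], 0, 1);
      ([:: 0; 1; 0; 0], [:: 1; 0], 1, 1);
      ([:: 1; 0; 0; 1], [:: 0; 1], 1, 2);
      ([:: 1; 0; 1; 0], [:: 1; 1], 1, 2)];
  [:: ([:: 0; 0; 0; 0], [:: 0; 1], 1, 1);
      ([:: 0; 0; 1; 0], [:: 0; 0], 1, 1);
      ([:: 0; 1; 0; 0], [:: 0; 1], 0, 1);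
      ([:: 1; 0; 0; 0], [:: 1; 0], 1, 1);
      ([:: 1; 0; 0; 1], [:: 0; 1], 1, 2);
      ([:: 0; 0; 1; 0], [:: 1; 0], 0, 1);
      ([:: 0; 1; 0; 1], [:: 1; 0], 1, 2)];
  [:: ([:: 0; 0; 1; 0], [:: 0; 0], 1, 1);
      ([:: 1; 0; 0; 0], [:: 1; 0], 1, 1);
      ([:: 0; 0; 0; 1], [:: 0; 1], 1, 2);
      ([:: 0; 0; 1; 0], [:: 1; 0], 0, 1);
      ([:: 0; 1; 0; 1], [:: 1; 0], 1, 2);
      ([:: 1; 0; 0; 0], [:: 0; 1], 0, 1);
      ([:: 0; 1; 0; 0], [:: 1; 1], 1, 2)];
  [:: ([:: 0; 0; 0; 1], [:: 1; 0], 0, 1);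
      ([:: 0; 1; 0; 0], [:: 0; 1], 0, 1);
      ([:: 1; 0; 0; 0], [:: 1; 0], 1, 1);
      ([:: 0; 0; 0; 1], [:: 0; 1], 1, 2);
      ([:: 0; 0; 1; 0], [:: 1; 1], 1, 2);
      ([:: 0; 1; 0; 0], [:: 0; 0], 1, 1);
      ([:: 1; 0; 1; 0], [:: 0; 1], 1, 2)];
  [:: ([:: 0; 1; 0; 0], [:: 0; 1], 0, 1);
      ([:: 0; 0; 0; 1], [:: 0; 1], 1, 2);
      ([:: 0; 0; 1; 0], [:: 1; 0], 0, 1);
      ([:: 0; 1; 0; 0], [:: 0; 0], 1, 1);
      ([:: 1; 0; 1; 0], [:: 0; 1], 1, 2);
      ([:: 0; 0; 0; 0], [:: 1; 0], 1, 1);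
      ([:: 1; 0; 0; 1], [:: 1; 0], 1, 2)];
  [:: ([:: 0; 0; 1; 0], [:: 1; 0], 0, 1);
      ([:: 0; 1; 0; 0], [:: 0; 0], 1, 1);
      ([:: 1; 0; 0; 0], [:: 0; 1], 0, 1);
      ([:: 0; 0; 0; 0], [:: 1; 0], 1, 1);
      ([:: 1; 0; 0; 1], [:: 1; 0], 1, 2);
      ([:: 0; 0; 1; 0], [:: 0; 1], 1, 2);
      ([:: 0; 1; 0; 1], [:: 1; 1], 1, 3)];
  [:: ([:: 0; 0; 0; 1], [:: 1; 0], 0, 1);
      ([:: 0; 0; 1; 0], [:: 0; 0], 1, 1);
      ([:: 0; 1; 0; 0], [:: 0; 1], 0, 1);
      ([:: 1; 0; 0; 0], [:: 1; 0], 1, 1);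
      ([:: 1; 0; 0; 1], [:: 0; 1], 1, 2);
      ([:: 0; 0; 1; 0], [:: 1; 1], 1, 2);
      ([:: 0; 1; 0; 1], [:: 1; 1], 2, 3)];
  [:: ([:: 0; 0; 1; 0], [:: 0; 0], 1, 1);
      ([:: 0; 1; 0; 0], [:: 0; 1], 0, 1);
      ([:: 1; 0; 0; 0], [:: 1; 0], 1, 1);
      ([:: 0; 0; 0; 1], [:: 0; 1], 1, 2);
      ([:: 0; 0; 1; 0], [:: 1; 1], 1, 2);
      ([:: 0; 1; 0; 1], [:: 1; 0], 1, 2);
      ([:: 1; 0; 1; 1], [:: 1; 1], 1, 3)];
  [:: ([:: 0; 1; 0; 0], [:: 0; 1], 0, 1);
      ([:: 1; 0; 0; 0], [:: 1; 0], 1, 1);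
      ([:: 0; 0; 0; 1], [:: 0; 1], 1, 2);
      ([:: 0; 0; 1; 0], [:: 1; 0], 0, 1);
      ([:: 0; 1; 0; 1], [:: 1; 0], 1, 2);
      ([:: 1; 0; 1; 0], [:: 0; 1], 1, 2);
      ([:: 0; 1; 1; 0], [:: 1; 1], 2, 3)];
  [:: ([:: 1; 0; 0; 0], [:: 1; 0], 1, 1);
      ([:: 0; 0; 0; 1], [:: 0; 1], 1, 2);
      ([:: 0; 0; 1; 0], [:: 1; 0], 0, 1);
      ([:: 0; 1; 0; 0], [:: 0; 0], 1, 1);
      ([:: 1; 0; 1; 0], [:: 0; 1], 1, 2);
      ([:: 0; 1; 0; 0], [:: 1; 1], 1, 2);
      ([:: 1; 1; 0; 1], [:: 1; 1], 1, 3)];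
  [:: ([:: 0; 0; 0; 1], [:: 0; 1], 1, 2);
      ([:: 0; 0; 1; 0], [:: 1; 0], 0, 1);
      ([:: 0; 1; 0; 0], [:: 0; 0], 1, 1);
      ([:: 1; 0; 0; 0], [:: 0; 1], 0, 1);
      ([:: 0; 1; 0; 0], [:: 1; 1], 1, 2);
      ([:: 1; 0; 0; 1], [:: 1; 0], 1, 2);
      ([:: 1; 0; 1; 0], [:: 1; 1], 2, 3)]])%N.

Definition chains_of (D : dimdata) : seq (seq nat) := [:: D.1.1.1; D.1.1.2; [:: D.1.2]].

Definition scale (k : nat) (v : seq nat) := [seq k * x | x <- v].

Definition combination (lam : seq nat) (qs : seq (seq nat)) (z : seq nat) : seq nat :=
  foldr (fun p s => zip_with addn (scale p.1 p.2) s) z (zip lam qs).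

(* Up to a multiple of [d], [v] is a combination of [qs] with nonnegative
   coefficients, not all zero.  The truncated differences give the multiple its
   sign, since at most one of [t] and [t'] is nonzero. *)
Definition certified (d : seq nat) (qs fs : seq (seq nat)) (v : seq nat) : bool :=
  let lam := [seq pairing f v | f <- fs] in
  let s := combination lam qs (nseq (size d) 0) in
  let t := (last 0 s - last 0 v) %/ last 0 d in
  let t' := (last 0 v - last 0 s) %/ last 0 d in
  (0 < sumn lam) && (size v == size d) &&
  (zip_with addn s (scale t' d) == zip_with addn v (scale t d)).

(** The weights of the intersections are nonnegative, so a larger vector gives a larger value. The
    last coordinate [\dim U] carries the opposite of [gamma] and therefore has to agree. *)
Definition dominated (u v : seq nat) : bool := if all_leq u v then last 0 v == last 0 u else false.

(** A surviving candidate need not be certified itself; it may lie below a certified one, which in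
    turn may be an excluded candidate. *)
Definition entry_ok (r : dimdata * seq dimdata * seq dimdata) : bool :=
  let: (D, qs, fs) := r in
  (size fs == size qs) && all (fun q => size (flat q) == size (flat D)) qs &&
  all (fun m =>
    let S := candidates D.2 (chains_of D) m in
    let C := [seq v <- [seq flat_dims es m | es <- S] |
              certified (flat D) [seq flat q | q <- qs] [seq flat f | f <- fs] v] in
    all (fun es => if excluded D.2 (chains_of D) m es then true
                   else lazy_has (dominated (flat_dims es m)) C) S)
    (iota 1 D.2.-1).

Definition full_table := table234 ++ table5 ++ table6.

Lemma full_table_ok : all entry_ok (zip full_table dual_rays).
Proof. by vm_compute. Qed.

(** * Correctness of the enumeration and of the exclusion test *)

Section SubspaceDimensions.
Variables (F : numClosedFieldType) (V : vectType F).
Implicit Types U X Z : {vspace V}.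

Lemma dim_meet_bound U (Y : {vspace V}) X :
  \dim (U :&: Y) + \dim (U :&: X) - \dim U <= \dim ((U :&: Y) :&: X).
Proof.
have <- : ((U :&: Y) :&: (U :&: X) = (U :&: Y) :&: X)%VS.
  by rewrite capvA; congr (_ :&: X)%VS; apply/capv_idPl; exact: capvSl.
have := dimv_sum_cap (U :&: Y) (U :&: X).
have : \dim ((U :&: Y) + (U :&: X)) <= \dim U.
  by rewrite dimvS // subv_add !capvSl.
lia.
Qed.

Lemma dim_join_bound U (Y : {vspace V}) X :
  \dim ((U + Y) + X) <= minn (\dim {:V}) (\dim (U + Y) + \dim (U + X) - \dim U).
Proof.
rewrite leq_min dimvS ?subvf //=.
have <- : ((U + Y) + (U + X) = (U + Y) + X)%VS.
  by rewrite addvA; congr (_ + X)%VS; apply/addv_idPl; exact: addvSl.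
have := dimv_sum_cap (U + Y) (U + X).
have : \dim U <= \dim ((U + Y) :&: (U + X)).
  by rewrite dimvS // subv_cap !addvSl.
lia.
Qed.

Lemma dim_join U X : \dim (U + X) = \dim U + \dim X - \dim (U :&: X).
Proof. by have := dimv_sum_cap U X; lia. Qed.

Lemma ext_codim_flag U1 U2 (Y : seq {vspace V}) x :
  flag_codim x [seq (U1 :&: X, U2 + X)%VS | X <- Y] =
  ext_codim (\dim {:V}) x [seq \dim (U1 :&: X) | X <- Y] [seq \dim (U2 + X) | X <- Y].
Proof. by elim: Y x => //= X Y IH x; rewrite IH. Qed.

Lemma all2_leq_map (T : eqType) (f g : T -> nat) (s : seq T) :
  {in s, forall x, f x <= g x} -> all2 leq (map f s) (map g s).
Proof.
elim: s => //= x s IH H; rewrite H ?mem_head // IH // => y ys.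
by rewrite H // inE ys orbT.
Qed.

Lemma sorted_subv_total (Y : seq {vspace V}) X Z :
  sorted subsetv Y -> X \in Y -> Z \in Y -> (X <= Z)%VS || (Z <= X)%VS.
Proof.
move=> srt /(nthP 0%VS)[i iY <-] /(nthP 0%VS)[j jY <-].
have mono := sorted_leq_nth (@subv_trans _ _) (@subvv _ _) 0%VS srt.
by case: (leqP i j) => [|/ltnW] ij; rewrite (mono _ _ _ _ ij) ?inE ?orbT.
Qed.

Definition meet_dims U (Ys : seq (seq {vspace V})) := [seq [seq \dim (U :&: X) | X <- Y] | Y <- Ys].

Definition space_dims (Ys : seq (seq {vspace V})) := [seq [seq \dim X | X <- Y] | Y <- Ys].

Definition sum_dims U (Ys : seq (seq {vspace V})) := [seq [seq \dim (U + X) | X <- Y] | Y <- Ys].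

Lemma join_dimsE U (Ys : seq (seq {vspace V})) :
  join_dims (\dim U) (space_dims Ys) (meet_dims U Ys) = sum_dims U Ys.
Proof.
rewrite /join_dims; elim: Ys => //= Y Ys ->; congr cons.
by elim: Y => //= X Y ->; rewrite dim_join.
Qed.

Variable Ys : seq (seq {vspace V}).
Hypothesis sortedYs : all (sorted subsetv) Ys.

Lemma nth_map_map (T : Type) (f : {vspace V} -> T) i :
  nth [::] [seq [seq f X | X <- Y] | Y <- Ys] i = [seq f X | X <- nth [::] Ys i].
Proof.
have [iYs|Ysi] := ltnP i (size Ys); first by rewrite (nth_map [::]).
by rewrite !nth_default ?size_map.
Qed.

Lemma sorted_nth i : sorted subsetv (nth [::] Ys i).
Proof.
have [iYs|Ysi] := ltnP i (size Ys); last by rewrite nth_default.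
by move/all_nthP: sortedYs => /(_ [::] i iYs).
Qed.

Definition subspace_at (y : option (nat * nat)) Z : {vspace V} :=
  if y is Some p then nth 0%VS (nth [::] Ys p.1) p.2 else Z.

Lemma mem_positions i j : Some (i, j) \in positions (space_dims Ys) ->
  i < size Ys /\ j < size (nth [::] Ys i).
Proof.
rewrite inE /= => /allpairsPdep[i' [j' [+ + [-> ->]]]].
rewrite !mem_iota /= !add0n size_map => iYs.
by rewrite nth_map_map size_map.
Qed.

(** Within the chain of [Y] the entries are exact, since one of [X] and [Y] contains the other;
    across chains only the dimension formula inside [U] is available. *)
Lemma meet_boundP U y : y \in positions (space_dims Ys) ->
  let A := meet_bound (\dim U) (meet_dims U Ys) y in
  let U1 := (U :&: subspace_at y fullv)%VS in
  [/\ A.1 = \dim U1, size A.2 = size Ys & forall i, i < size Ys ->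
    all2 leq (nth [::] A.2 i) [seq \dim (U1 :&: X) | X <- nth [::] Ys i] /\
    size (nth [::] A.2 i) = size (nth [::] Ys i)].
Proof.
case: y => [[i0 j0]|] yP; last first.
  rewrite /= capvf; split; rewrite ?size_map // => i iYs.
  by rewrite /meet_dims nth_map_map size_map; split=> //; apply: all2_leq_map => X _.
have [i0Ys j0Y] := mem_positions yP; rewrite /meet_bound /subspace_at /=.
set Y := nth 0%VS _ _; have YinY : Y \in nth [::] Ys i0 by rewrite mem_nth.
have entryE : entry (meet_dims U Ys) (i0, j0) = \dim (U :&: Y).
  by rewrite /entry /meet_dims nth_map_map /= (nth_map 0%VS).
rewrite entryE; split; rewrite ?size_map ?size_iota // => i iYs.
rewrite (nth_map 0) ?size_iota ?size_map // nth_iota ?size_map // add0n.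
rewrite /meet_dims nth_map_map.
have [-> | _] := eqVneq i i0; rewrite -!map_comp size_map; split=> //; apply: all2_leq_map => X XY /=.
  have := sorted_subv_total (sorted_nth i0) XY YinY; case/orP=> [XY'|YX'].
    by rewrite geq_min -capvA (capv_idPr XY') leqnn orbT.
  by rewrite geq_min -capvA (capv_idPl YX') leqnn.
exact: dim_meet_bound.
Qed.

Lemma join_boundP U y : y \in positions (space_dims Ys) ->
  let B := join_bound (\dim {:V}) (\dim U) (sum_dims U Ys) y in
  let U2 := (U + subspace_at y 0)%VS in
  [/\ B.1 = \dim U2, size B.2 = size Ys & forall i, i < size Ys ->
    all2 leq [seq \dim (U2 + X) | X <- nth [::] Ys i] (nth [::] B.2 i) /\
    size (nth [::] B.2 i) = size (nth [::] Ys i)].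
Proof.
case: y => [[i0 j0]|] yP; last first.
  rewrite /= addv0; split; rewrite ?size_map // => i iYs.
  by rewrite /sum_dims nth_map_map size_map; split=> //; apply: all2_leq_map => X _.
have [i0Ys j0Y] := mem_positions yP; rewrite /join_bound /subspace_at /=.
set Y := nth 0%VS _ _; have YinY : Y \in nth [::] Ys i0 by rewrite mem_nth.
have entryE : entry (sum_dims U Ys) (i0, j0) = \dim (U + Y).
  by rewrite /entry /sum_dims nth_map_map /= (nth_map 0%VS).
rewrite entryE; split; rewrite ?size_map ?size_iota // => i iYs.
rewrite (nth_map 0) ?size_iota ?size_map // nth_iota ?size_map // add0n.
rewrite /sum_dims nth_map_map.
have [-> | _] := eqVneq i i0; rewrite -!map_comp size_map; split=> //; apply: all2_leq_map => X XY /=.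
  have := sorted_subv_total (sorted_nth i0) XY YinY; case/orP=> [XY'|YX'].
    by rewrite leq_max -addvA (addv_idPl XY') leqnn.
  by rewrite leq_max -addvA (addv_idPr YX') leqnn orbT.
exact: dim_join_bound.
Qed.

Lemma not_excluded U :
  (forall U1 U2, (\sum_(Y <- Ys) flag_codim 0 [seq (U1 :&: X, U2 + X)%VS | X <- Y] <=
     \dim U1 * (\dim {:V} - \dim U2))%N) ->
  ~~ excluded (\dim {:V}) (space_dims Ys) (\dim U) (meet_dims U Ys).
Proof.
move=> RI; rewrite /excluded join_dimsE lazy_hasE; apply/hasPn => y yP.
rewrite lazy_hasE; apply/hasPn => x xP.
have [A1 sA A2] := meet_boundP U yP; have [B1 sB B2] := join_boundP U xP.
move: A1 sA A2 B1 sB B2.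
set A := meet_bound _ _ _; set B := join_bound _ _ _ _.
set U1 := (U :&: _)%VS; set U2 := (U + _)%VS => A1 sA A2 B1 sB B2.
apply/negP => /and3P[/allP srtA /allP srtB]; rewrite ltnNge => /negP; apply.
rewrite A1 B1; apply: leq_trans (RI U1 U2).
rewrite sumnE big_map (big_nth ([::], [::])) (big_nth [::]) size_zip sA sB minnn.
rewrite !big_nat; apply: leq_sum => i /andP[_ iYs].
have [AiL sAi] := A2 i iYs; have [BiL sBi] := B2 i iYs.
rewrite ext_codim_flag nth_zip ?sA ?sB //=.
apply: ext_codim_estimate => //.
- by rewrite !size_map.
- by rewrite size_map sAi.
- by rewrite size_map sBi.
- have := sorted_nth i; rewrite sorted_map; apply: sub_sorted => X X' XX' /=.
  by rewrite dimvS // capvS.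
- by apply: srtA; rewrite mem_nth ?sA.
- by apply: srtB; rewrite mem_nth ?sB.
Qed.

Lemma mem_candidates U :
  meet_dims U Ys \in candidates (\dim {:V}) (space_dims Ys) (\dim U).
Proof.
apply: mem_choices; first by rewrite !size_map.
move=> i x0 y0; rewrite size_map => iYs.
rewrite (nth_map [::]) // (nth_map [::]) ?size_map // (nth_map [::]) //.
have srt := sorted_nth i; move: (nth _ Ys i) srt => Y srt {x0 y0}.
rewrite mem_filter; apply/andP; split.
  have -> : zip_with (fun d e => \dim U + d - e) [seq \dim X | X <- Y] [seq \dim (U :&: X) | X <- Y]
      = [seq \dim (U + X) | X <- Y].
    by elim: Y {srt} => //= X Y ->; rewrite dim_join.
  rewrite -cats1 (sorted_pairwise leq_trans) pairwise_cat allrel1r /= andbT.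
  rewrite -(sorted_pairwise leq_trans).
  apply/andP; split; first by apply/allP => _ /mapP[X _ ->]; rewrite dimvS ?subvf.
  rewrite sorted_map; apply: sub_sorted srt => X X' XX' /=.
  by rewrite dimvS ?addvS.
apply: mem_chains_below.
- have p0 s : sorted leq s -> path leq 0 s by case: s => //= ? ? ->.
  apply: p0; rewrite sorted_map; apply: sub_sorted srt => X X' XX' /=.
  by rewrite dimvS ?capvS.
- by apply: all2_leq_map => X _; rewrite dimvS ?capvSr.
- by apply/allP => _ /mapP[X _ ->]; rewrite /= dimvS ?capvSl.
Qed.

End SubspaceDimensions.

(** * From certificates to strict inequalities *)

Section Weights.
Local Open Scope ring_scope.
Variable R : realDomainType.
Implicit Types (w : seq R) (u v d : seq nat).

Fixpoint wdot w v : R :=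
  match w, v with
  | x :: w', y :: v' => x * y%:R + wdot w' v'
  | _, _ => 0
  end.

Lemma wdot_cat w1 w2 v1 v2 : size w1 = size v1 ->
  wdot (w1 ++ w2) (v1 ++ v2) = wdot w1 v1 + wdot w2 v2.
Proof.
elim: w1 v1 => [|x w1 IH] [|y v1] //=; first by rewrite add0r.
by case=> /IH ->; rewrite addrA.
Qed.

Lemma size_zip_with f u v : size (zip_with f u v) = minn (size u) (size v).
Proof. by elim: u v => [|x u IH] [|y v] //=; rewrite IH minnSS. Qed.

Lemma wdotD w u v : size u = size v -> wdot w (zip_with addn u v) = wdot w u + wdot w v.
Proof.
elim: w u v => [|x w IH] [|y u] [|z v] //=; rewrite ?addr0 //.
by case=> /IH ->; rewrite natrD mulrDr addrACA.
Qed.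

Lemma wdotZ w k v : wdot w (scale k v) = k%:R * wdot w v.
Proof.
elim: w v => [|x w IH] [|y v] //=; rewrite ?mulr0 //.
by rewrite IH natrM mulrCA mulrDr mulrCA.
Qed.

Lemma wdot_nseq0 w n : wdot w (nseq n 0%N) = 0.
Proof. by elim: n w => [|n IH] [|x w] //=; rewrite mulr0 add0r. Qed.

Lemma wdot_leq w u v : all (>= 0) w -> all2 leq u v -> wdot w u <= wdot w v.
Proof.
elim: w u v => [|x w IH] [|y u] [|z v] //= /andP[x0 w0] /andP[yz uv].
by rewrite lerD ?IH // ler_wpM2l // ler_nat.
Qed.

Lemma wdot_combination w lam (qs : seq (seq nat)) n :
  all (fun q => size q == n) qs ->
  size (combination lam qs (nseq n 0%N)) = n /\
  wdot w (combination lam qs (nseq n 0%N)) =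
    \sum_(p <- zip lam qs) p.1%:R * wdot w p.2.
Proof.
elim: lam qs => [|k lam IH] [|q qs] //=; rewrite /combination /= ?big_nil ?size_nseq ?wdot_nseq0 //.
move=> /andP[/eqP sq sqs]; have [sz E] := IH qs sqs.
rewrite size_zip_with size_map sq sz minnn; split=> //.
by rewrite wdotD ?size_map ?sq // wdotZ big_cons E.
Qed.

(** As [wdot w d = 0], the multiples of [d] drop out of the certified identity, and the value at [v]
    is a nontrivial nonnegative combination of negative numbers. *)
Lemma certified_lt0 w d qs fs v : all (fun q => size q == size d) qs ->
  size fs = size qs ->
  wdot w d = 0 -> (forall q, q \in qs -> wdot w q < 0) -> certified d qs fs v -> wdot w v < 0.
Proof.
move=> sqs sfs wd wq; rewrite /certified; lazy zeta.
set lam := [seq _ | _ <- fs]; set s := combination _ _ _.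
have [ssz sE] := wdot_combination w lam sqs.
case/andP => /andP[lam0 /eqP sv] /eqP/(congr1 (wdot w)).
rewrite !wdotD ?size_map // !wdotZ wd !mulr0 !addr0 sE => <-.
have : size lam = size qs by rewrite size_map.
move: lam lam0 {sv sfs sqs s ssz sE} => lam.
elim: lam qs wq => [|k lam IH] [|q qs] //= wq lam0 [sz]; rewrite big_cons /=.
have wq' q' : q' \in qs -> wdot w q' < 0 by move=> q'qs; apply: wq; rewrite inE q'qs orbT.
have wq0 := wq q (mem_head _ _).
have [lam_gt0|] := boolP (0 < sumn lam)%N.
  by rewrite -[ltRHS]addr0 ler_ltD ?(IH qs) // mulr_ge0_le0 // ltW.
rewrite -leqNgt leqn0 => /eqP lamE; rewrite lamE addn0 in lam0.
rewrite big_seq big1 ?addr0; first by rewrite pmulr_rlt0 // ltr0n.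
move=> -[k' q'] /(map_f fst); rewrite -/(unzip1 _) unzip1_zip ?sz //= => k'lam.
suff -> : k' = 0%N by rewrite mul0r.
apply/eqP; rewrite -leqn0 -lamE; elim: {IH sz lam0 lamE} lam k'lam => //= x lam IH.
by rewrite inE => /predU1P[-> | /IH]; [rewrite leq_addr | move/leq_trans; apply; rewrite leq_addl].
Qed.

Lemma dominated_leq w g u v : all (>= 0) w -> dominated u v -> size u = (size w).+1 ->
  wdot (rcons w g) u <= wdot (rcons w g) v.
Proof.
rewrite /dominated all_leqE; case: ifP => // uv w0 /eqP luv su; move: uv luv.
case/lastP: u su => // u x; rewrite size_rcons => -[su].
case/lastP: v => [|v y]; first by case: (u).
rewrite !last_rcons => + yx; rewrite -!cats1 => uv.
have sz : size u = size v.
  by move: uv; rewrite all2E !size_cat /= !addn1 eqSS => /andP[/eqP].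
rewrite !wdot_cat ?su -?sz ?su // yx lerD2r wdot_leq //.
by move: uv; rewrite !all2E !size_cat zip_cat // all_cat sz !eqxx => /and3P[].
Qed.

Lemma table_stability (D : dimdata) (qs : seq dimdata) w g m es :
  (D, qs) \in full_table -> all (>= 0) w -> size (flat D) = (size w).+1 ->
  wdot (rcons w g) (flat D) = 0 ->
  (forall q, q \in qs -> wdot (rcons w g) (flat q) < 0) ->
  (0 < m < D.2)%N -> es \in candidates D.2 (chains_of D) m ->
  ~~ excluded D.2 (chains_of D) m es ->
  wdot (rcons w g) (flat_dims es m) < 0.
Proof.
move=> Dqs w0 sD wD wq /andP[m0 mD] es_cand not_ex.
have [i iT iE] : exists2 i, (i < size full_table)%N & nth (D, qs) full_table i = (D, qs).
  by exists (index (D, qs) full_table); rewrite ?index_mem ?nth_index.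
have sz : size full_table = size dual_rays by [].
have : all entry_ok (zip full_table dual_rays) := full_table_ok.
move/all_nthP => /(_ ((D, qs), [::]) i); rewrite size_zip -sz minnn => /(_ iT).
rewrite nth_zip // iE; set fs := nth _ _ _.
rewrite /entry_ok => /andP[/andP[/eqP sfs sqs] /allP/(_ m)].
rewrite mem_iota; have -> : (1 <= m < 1 + D.2.-1)%N by lia.
move=> /(_ isT).
move/allP => /(_ _ es_cand); rewrite (negPf not_ex) lazy_hasE.
case/hasP => v; rewrite mem_filter => /andP[cert _] dom.
have sv : size v = size (flat D) by move: cert; rewrite /certified; lazy zeta => /andP[/andP[_ /eqP]].
apply: le_lt_trans (certified_lt0 (w := rcons w g) _ _ wD _ cert).
- apply: dominated_leq => //; rewrite -sD -sv.
  by move: dom; rewrite /dominated all_leqE all2E; case: eqP.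
- by rewrite all_map.
- by rewrite !size_map.
- by move=> _ /mapP[q qqs ->]; exact: wq.
Qed.

End Weights.

(** * Minimization of the Kempf-Ness function *)

Section PositiveDefinite.
Local Open Scope ring_scope.
Local Open Scope sesquilinear_scope.
Variable C : numClosedFieldType.

Lemma trmxC_mul m n p (A : 'M[C]_(m, n)) (B : 'M[C]_(n, p)) :
  (A *m B)^t* = B^t* *m A^t*.
Proof. by rewrite trmx_mul map_mxM. Qed.

Lemma trmxCE m n (A : 'M[C]_(m, n)) i j : A^t* i j = (A j i)^*.
Proof. by rewrite !mxE. Qed.

Lemma trmxC1 n : (1%:M : 'M[C]_n)^t* = 1%:M.
Proof. by rewrite trmx1 map_mx1. Qed.

Lemma trmxCD m n (A B : 'M[C]_(m, n)) : (A + B)^t* = A^t* + B^t*.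
Proof. by rewrite linearD /= map_mxD. Qed.

Lemma trmxCZ m n k (A : 'M[C]_(m, n)) : (k *: A)^t* = k^* *: A^t*.
Proof. by rewrite linearZ /= map_mxZ. Qed.

Definition posdefmx n (A : 'M[C]_n) :=
  A^t* = A /\ forall v : 'rV_n, v != 0 -> 0 < (v *m A *m v^t*) 0 0.

Lemma posdef_unit n (A : 'M[C]_n) : posdefmx A -> A \in unitmx.
Proof.
move=> [_ Apos]; rewrite -row_free_unit -kermx_eq0; apply/rowV0P => v /sub_kermxP vA.
by apply: contraTeq isT => /Apos; rewrite vA mul0mx mxE ltxx.
Qed.

Lemma posdef_gram k n (X : 'M[C]_(k, n)) : row_free X -> posdefmx (X *m X^t*).
Proof.
move=> freeX; split; first by rewrite trmxC_mul trmxCK.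
move=> v v0; rewrite -mulmxA -mulmxA mulmxA -trmxC_mul -dotmxE.
by apply: dotmx_is_dotmx; rewrite mulmx_free_eq0.
Qed.

Lemma spectral_posdef n (A : 'M[C]_n) : posdefmx A ->
  exists u : 'M[C]_n, exists d : 'rV[C]_n,
    [/\ u \is unitarymx, forall i, 0 < d 0 i & A = u^t* *m diag_mx d *m u].
Proof.
move=> [Aherm Apos]; exists (spectralmx A), (spectral_diag A).
have uu := spectral_unitarymx A.
have AE : A = (spectralmx A)^t* *m diag_mx (spectral_diag A) *m spectralmx A.
  rewrite -invmx_unitary //; apply/orthomx_spectralP/normalmxP.
  by rewrite Aherm.
split=> // i; pose v := row i (spectralmx A).
have uuE := unitarymxP uu.
have v0 : v != 0.
  apply/eqP => v0; have := congr1 (row i) uuE.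
  rewrite row_mul -/v v0 mul0mx row1 => /matrixP/(_ 0 i); rewrite !mxE !eqxx /=.
  by move/esym/eqP; rewrite oner_eq0.
have vu : v *m (spectralmx A)^t* = delta_mx 0 i.
  by rewrite /v rowE -mulmxA uuE mulmx1.
have := Apos v v0; rewrite {1}AE !mulmxA vu -mulmxA -[spectralmx A *m _]trmxCK.
rewrite trmxC_mul trmxCK vu -rowE row_diag_mx -scalemxAl mxE.
rewrite trmx_delta map_delta_mx.
by rewrite mul_delta_mx mxE !eqxx mulr1.
Qed.

Lemma det_unitary n (u : 'M[C]_n) : u \is unitarymx -> \det (u^t*) * \det u = 1.
Proof. by rewrite -trmxC_unitary => /unitarymxP; rewrite trmxCK -det_mulmx => ->; rewrite det1. Qed.

Lemma posdef_det_gt0 n (A : 'M[C]_n) : posdefmx A -> 0 < \det A.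
Proof.
move=> /spectral_posdef[u [d [uu d0 ->]]].
rewrite !det_mulmx mulrAC det_unitary // mul1r det_diag.
by apply: prodr_gt0 => i _; exact: d0.
Qed.

Lemma posdef_inv n (A : 'M[C]_n) : posdefmx A -> posdefmx (invmx A).
Proof.
move=> Apd; have Aunit := posdef_unit Apd; have [Aherm Apos] := Apd.
have iherm : (invmx A)^t* = invmx A by rewrite trmx_inv map_invmx Aherm.
split=> // v v0.
have -> : v *m invmx A *m v^t* = (v *m invmx A) *m A *m (v *m invmx A)^t*.
  by rewrite mulmxKV // trmxC_mul iherm mulmxA.
apply: Apos; apply: contraNneq v0 => vA0.
by rewrite -(mulmxKV Aunit v) vA0 mul0mx.
Qed.

(** The products of the same two block matrices in the two orders have equal determinants. *)
Lemma det_1D_mulmx n (a : 'cV[C]_n) (b : 'rV[C]_n) :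
  \det (1%:M + a *m b) = 1 + (b *m a) 0 0.
Proof.
have E1 : block_mx 1%:M (- b) 0 1%:M *m block_mx 1%:M b (- a) 1%:M
    = block_mx (1%:M + b *m a) 0 (- a) (1%:M : 'M_n).
  by rewrite mulmx_block !mul1mx !mulmx1 !mul0mx mulNmx mulmxN opprK subrr !add0r.
have E2 : block_mx 1%:M b (- a) 1%:M *m block_mx 1%:M (- b) 0 1%:M
    = block_mx 1%:M 0 (- a) (1%:M + a *m b : 'M_n).
  by rewrite mulmx_block !mul1mx !mulmx1 !mulmx0 mulNmx mulmxN opprK !addr0 addNr addrC.
have := congr1 determinant E1; rewrite det_mulmx mulrC -det_mulmx E2.
rewrite !det_lblock !det1 mul1r mulr1 => ->.
by rewrite det_mx11 !mxE.
Qed.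

Lemma det_rank1_update n (A : 'M[C]_n) (a : 'cV[C]_n) (b : 'rV[C]_n) :
  A \in unitmx -> \det (A + a *m b) = \det A * (1 + (b *m invmx A *m a) 0 0).
Proof.
move=> Au; have -> : A + a *m b = A *m (1%:M + (invmx A *m a) *m b).
  by rewrite mulmxDr mulmx1 !mulmxA mulmxV // mul1mx.
by rewrite det_mulmx det_1D_mulmx mulmxA.
Qed.

Lemma posdefD_rank1 n (A : 'M[C]_n) (w : 'cV[C]_n) : posdefmx A ->
  posdefmx (A + w *m w^t*) /\ \det A <= \det (A + w *m w^t*).
Proof.
move=> Apd; have [Aherm Apos] := Apd.
have form_ge0 (v : 'rV[C]_n) : 0 <= (v *m (w *m w^t*) *m v^t*) 0 0.
  have -> : v *m (w *m w^t* ) *m v^t* = (v *m w) *m (v *m w)^t* by rewrite trmxC_mul !mulmxA.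
  by rewrite mxE big_ord1 trmxCE mul_conjC_ge0.
split.
  split; first by rewrite trmxCD trmxC_mul trmxCK Aherm.
  by move=> v v0; rewrite mulmxDr mulmxDl mxE ltr_wpDr // Apos.
rewrite det_rank1_update ?posdef_unit // ler_pMr ?posdef_det_gt0 //.
rewrite lerDl; have [->|w0] := eqVneq (w^t*) 0; first by rewrite !mul0mx mxE.
have [_ /(_ _ w0)] := posdef_inv Apd; rewrite trmxCK; exact: ltW.
Qed.

(** Each column outside [P] contributes a positive semidefinite term of rank at most one, and by
    [posdefD_rank1] such terms do not lower the determinant. *)
Lemma posdef_weighted_gram k n (D : 'M[C]_(k, n)) (P : {set 'I_n}) (d : 'rV[C]_n) :
  posdefmx (\sum_(i in P) d 0 i *: (col i D *m (col i D)^t*)) ->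
  (forall i, 0 <= d 0 i) ->
  \det (\sum_(i in P) d 0 i *: (col i D *m (col i D)^t*)) <=
  \det (D *m diag_mx d *m D^t*).
Proof.
move=> Ppd d0.
have -> : D *m diag_mx d *m D^t* = \sum_i d 0 i *: (col i D *m (col i D)^t*).
  apply/matrixP => i j; rewrite mxE summxE; apply: eq_bigr => l _.
  by rewrite mul_mx_diag !mxE big_ord1 !mxE mulrA [d 0 l * _]mulrC.
rewrite [X in _ <= \det X](bigID (fun i => i \in P)) /=; move: (\sum_(i in P) _) Ppd => A Apd.
suff : posdefmx (A + \sum_(i | i \notin P) d 0 i *: (col i D *m (col i D)^t*)) /\
  \det A <= \det (A + \sum_(i | i \notin P) d 0 i *: (col i D *m (col i D)^t*)); first by case.
elim/big_rec: _ => [|i S _ [Spd SA]]; first by rewrite addr0.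
rewrite addrCA addrC.
have -> : d 0 i *: (col i D *m (col i D)^t*) =
    (sqrtC (d 0 i) *: col i D) *m (sqrtC (d 0 i) *: col i D)^t*.
  rewrite trmxCZ -scalemxAl -scalemxAr scalerA geC0_conj ?sqrtC_ge0 //.
  by rewrite -expr2 sqrtCK.
have [pd le] := posdefD_rank1 (sqrtC (d 0 i) *: col i D) Spd.
by split=> //; exact: le_trans SA le.
Qed.

Lemma posdef_diag_gram k n (D : 'M[C]_(k, n)) (d : 'rV[C]_n) :
  row_free D -> (forall i, 0 < d 0 i) -> posdefmx (D *m diag_mx d *m D^t*).
Proof.
move=> freeD d0; pose r : 'rV[C]_n := \row_j sqrtC (d 0 j).
have -> : D *m diag_mx d *m D^t* = (D *m diag_mx r) *m (D *m diag_mx r)^t*.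
  rewrite trmxC_mul tr_diag_mx map_diag_mx !mulmxA; congr (_ *m _).
  rewrite -!mulmxA mulmx_diag; congr (_ *m diag_mx _); apply/rowP => j.
  by rewrite /r !mxE /= geC0_conj ?sqrtC_ge0 ?ltW // -expr2 sqrtCK.
apply: posdef_gram; rewrite /row_free mxrankMfree //.
rewrite row_free_unit unitmxE det_diag.
by rewrite unitfE; apply/prodf_neq0 => j _; rewrite mxE sqrtC_eq0 gt_eqF.
Qed.

(* A Cauchy-Binet lower bound: one term of the expansion of the determinant. *)
Lemma det_weighted_gram_ge k n (D : 'M[C]_(k, n)) (S : 'I_k -> 'I_n) (d : 'rV[C]_n) :
  injective S -> colsub S D \in unitmx -> (forall i, 0 < d 0 i) ->
  (\prod_j d 0 (S j)) * \det (colsub S D *m (colsub S D)^t*) <=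
  \det (D *m diag_mx d *m D^t*).
Proof.
move=> Sinj Du d0; pose P := [set S j | j in 'I_k].
have E : \sum_(i in P) d 0 i *: (col i D *m (col i D)^t*) =
    colsub S D *m diag_mx (\row_j d 0 (S j)) *m (colsub S D)^t*.
  rewrite big_imset /=; last by move=> ? ? _ _; exact: Sinj.
  apply/matrixP => i j; rewrite mxE summxE; apply: eq_bigr => l _.
  by rewrite mul_mx_diag !mxE big_ord1 !mxE mulrA [d 0 _ * _]mulrC.
have Epd : posdefmx (\sum_(i in P) d 0 i *: (col i D *m (col i D)^t*)).
  by rewrite E; apply: posdef_diag_gram; rewrite ?row_free_unit // => j; rewrite mxE.
apply: le_trans (posdef_weighted_gram Epd (fun i => ltW (d0 i))).
have DE : \det (diag_mx (\row_j d 0 (S j))) = \prod_j d 0 (S j).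
  by rewrite det_diag; apply: eq_bigr => j _; rewrite mxE.
by rewrite E !det_mulmx DE mulrCA mulrA lexx.
Qed.

(** Polarization: the values at [e i + z *: e j] give a linear relation between [A i j] and [A j i],
    and [z = 1] together with [z = 'i] forces both to vanish. *)
Lemma sesquilinear_eq0 n (A : 'M[C]_n) :
  (forall v : 'rV_n, (v *m A *m v^t*) 0 0 = 0) -> A = 0.
Proof.
move=> A0; apply/matrixP => i j; rewrite mxE.
pose e k : 'rV[C]_n := delta_mx 0 k.
have entry k l : (e k *m A *m (e l)^t*) 0 0 = A k l.
  rewrite /e trmx_delta map_delta_mx.
  have -> : delta_mx 0 k *m A = row k A by rewrite rowE.
  have -> : row k A *m delta_mx l 0 = col l (row k A) by rewrite colE.
  by rewrite !mxE.
have polar z : z^* * A i j + z * A j i = 0.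
  pose h (u v : 'rV[C]_n) := (u *m A *m v^t*) 0 0.
  have hDl u1 u2 v : h (u1 + u2) v = h u1 v + h u2 v by rewrite /h !mulmxDl mxE.
  have hDr u v1 v2 : h u (v1 + v2) = h u v1 + h u v2 by rewrite /h trmxCD mulmxDr mxE.
  have hZl k u v : h (k *: u) v = k * h u v by rewrite /h -!scalemxAl mxE.
  have hZr k u v : h u (k *: v) = k^* * h u v by rewrite /h trmxCZ -scalemxAr mxE.
  have := A0 (e i + z *: e j); rewrite -/(h _ _) !hDl !hDr !hZl !hZr.
  by rewrite /h !A0 !entry !mulr0 add0r addr0 addrC => ->.
have := polar 1; have := polar 'i; rewrite rmorph1 !mul1r conjCi mulNr.
move=> /eqP; rewrite addrC subr_eq0 => /eqP /(mulfI (neq0Ci _)) ->.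
by move=> /eqP; rewrite -mulr2n mulrn_eq0 => /eqP.
Qed.

End PositiveDefinite.

(** * Pivot rows adapted to all initial segments *)

Section Pivots.
Local Open Scope ring_scope.
Variables (F : fieldType) (n k : nat) (E : 'M[F]_(n, k)).

Definition first_rows m : 'M[F]_(n, k) := pid_mx m *m E.

Lemma row_first_rows m (i : 'I_n) : row i (first_rows m) = if (i < m)%N then row i E else 0.
Proof.
rewrite /first_rows row_mul; have -> : row i (pid_mx m : 'M[F]_n) =
    if (i < m)%N then delta_mx 0 i else 0.
  by apply/rowP => j; rewrite !mxE; case: ltnP => _; rewrite !mxE ?andbF // andbT eqxx eq_sym.
by case: ifP; rewrite ?mul0mx // -rowE.
Qed.

Lemma first_rowsS (i : 'I_n) : (first_rows i.+1 :=: first_rows i + row i E)%MS.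
Proof.
apply/eqmxP/andP; split.
  apply/row_subP => j; rewrite row_first_rows ltnS leq_eqVlt.
  have [/val_inj ->|_] /= := eqVneq (j : nat) i; first exact: addsmxSr.
  case: ltnP => ji; last exact: sub0mx.
  apply: submx_trans (addsmxSl _ _).
  by have := row_sub j (first_rows i); rewrite row_first_rows ji.
rewrite addsmx_sub; apply/andP; split.
  apply/row_subP => j; rewrite row_first_rows; case: ltnP => ji; last exact: sub0mx.
  by have := row_sub j (first_rows i.+1); rewrite row_first_rows (ltnW ji : (j < i.+1)%N).
by have := row_sub i (first_rows i.+1); rewrite row_first_rows ltnSn.
Qed.

Definition pivot_set : {set 'I_n} := [set i : 'I_n | ~~ (row i E <= first_rows i)%MS].

Lemma rank_first_rows m : (m <= n)%N ->
  \rank (first_rows m) = #|[set i in pivot_set | (i < m)%N]| /\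
  (first_rows m <= \sum_(i in pivot_set) <<row i E>>)%MS.
Proof.
elim: m => [_|m IH mn].
  rewrite /first_rows pid_mx_0 mul0mx mxrank0 sub0mx; split=> //.
  by rewrite (eq_card0 (A := [set i in pivot_set | (i < 0)%N])) // => i; rewrite inE andbF.
have [rE sE] := IH (ltnW mn); pose i := Ordinal mn.
have rS : \rank (first_rows m.+1) = \rank (first_rows i + row i E)%MS.
  by rewrite -(first_rowsS i).
have le_first : (first_rows m.+1 <= first_rows i + row i E)%MS by rewrite -(first_rowsS i).
have [iP|iP] := boolP (i \in pivot_set).
  have -> : [set j in pivot_set | (j < m.+1)%N] = i |: [set j in pivot_set | (j < m)%N].
    apply/setP => j; rewrite !inE ltnS leq_eqVlt -(inj_eq val_inj) /=.
    have [/= jm|_ //] := eqVneq (j : nat) m.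
    have -> : j = i by apply: val_inj.
    by move: iP; rewrite inE => ->.
  rewrite cardsU1 inE ltnn andbF add1n -rE rS; split.
    move: iP; rewrite inE => iP; apply/eqP; rewrite eqn_leq; apply/andP; split.
      apply: leq_trans (mxrank_adds_leqif _ _) _.
      by apply: leq_trans (leq_add (leqnn _) (rank_leq_row _)) _; rewrite addn1.
    apply: rank_ltmx; rewrite /ltmx addsmxSl /=; apply: contra iP.
    by apply: submx_trans; exact: addsmxSr.
  apply: submx_trans le_first _; rewrite addsmx_sub sE /=.
  by apply: (sumsmx_sup i) => //; rewrite genmxE.
have -> : [set j in pivot_set | (j < m.+1)%N] = [set j in pivot_set | (j < m)%N].
  apply/setP => j; rewrite [LHS]inE [RHS]inE ltnS leq_eqVlt.
  have [/= jm|_ //] := eqVneq (j : nat) m.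
  have -> : j = i by apply: val_inj.
  by rewrite (negPf iP).
have siE : (first_rows i + row i E <= first_rows m)%MS.
  by rewrite addsmx_sub submx_refl /=; move: iP; rewrite inE negbK.
split; last by apply: submx_trans le_first _; exact: submx_trans siE sE.
rewrite -rE rS; apply/eqP; rewrite eqn_leq mxrankS //=.
by apply: mxrankS; exact: addsmxSl.
Qed.

(** A row is chosen when it is not in the span of the earlier rows. This greedy basis is adapted to
    every initial segment, so one [S] serves all [m]. *)
Lemma exists_pivots : \rank E = k -> exists S : 'I_k -> 'I_n,
  [/\ injective S, rowsub S E \in unitmx &
      forall m, (m <= n)%N -> #|[set j | (S j < m)%N]| = \rank (first_rows m)].
Proof.
move=> rE; have [rn sn] := rank_first_rows (leqnn n).
have first_n : first_rows n = E by rewrite /first_rows pid_mx_1 mul1mx.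
have cardP : #|pivot_set| = k.
  rewrite -rE -{1}first_n rn; apply: eq_card => i; rewrite !inE.
  by rewrite ltn_ord andbT.
pose S (j : 'I_k) : 'I_n := enum_val (cast_ord (esym cardP) j).
have Sinj : injective S by move=> i j /enum_val_inj /cast_ord_inj.
have SP j : S j \in pivot_set by exact: enum_valP.
have Ssurj i : i \in pivot_set -> exists j, S j = i.
  move=> iP; exists (cast_ord cardP (enum_rank_in iP i)).
  by rewrite /S cast_ordK enum_rankK_in.
exists S; split=> // [|m mn].
  rewrite -row_full_unit /row_full eqn_leq rank_leq_col /= -{1}rE -{1}first_n.
  apply: mxrankS; apply: submx_trans sn _; apply/sumsmx_subP => i /Ssurj[j <-].
  by rewrite genmxE; have := row_sub j (rowsub S E); rewrite row_rowsub.
have [-> _] := rank_first_rows mn.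
rewrite -(card_imset _ Sinj); apply: eq_card => i; rewrite inE.
apply/imsetP/andP => [[j + ->]|[/Ssurj[j <-] jm]]; first by rewrite inE SP.
by exists j; rewrite // inE.
Qed.

End Pivots.

(** * Continuity of complex determinants through real and imaginary parts *)

Section ComplexContinuity.
Local Open Scope ring_scope.
Local Open Scope classical_set_scope.
Local Open Scope sesquilinear_scope.
Variables (R : realType) (T : topologicalType) (x : T).
Local Notation C := (R[i])%C.
Local Notation Re := complex.Re.
Local Notation Im := complex.Im.

Definition ccont (f : T -> C) :=
  {for x, continuous (fun t => Re (f t))} /\ {for x, continuous (fun t => Im (f t))}.

Lemma ccont_cst c : ccont (fun=> c).
Proof. by split; apply: cst_continuous. Qed.

Lemma ccontD f g : ccont f -> ccont g -> ccont (fun t => f t + g t).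
Proof.
move=> [f1 f2] [g1 g2]; split.
  rewrite (_ : (fun t => _) = (fun t => Re (f t)) \+ (fun t => Re (g t))).
    exact: continuousD.
  by apply/funext => t /=; case: (f t) (g t) => a b [].
rewrite (_ : (fun t => _) = (fun t => Im (f t)) \+ (fun t => Im (g t))).
  exact: continuousD.
by apply/funext => t /=; case: (f t) (g t) => a b [].
Qed.

Lemma ccontM f g : ccont f -> ccont g -> ccont (fun t => f t * g t).
Proof.
move=> [f1 f2] [g1 g2]; split.
  rewrite (_ : (fun t => _) = (fun t => Re (f t) * Re (g t) - Im (f t) * Im (g t))).
    by apply: continuousB; apply: continuousM.
  by apply/funext => t /=; case: (f t) (g t) => a b [].
rewrite (_ : (fun t => _) = (fun t => Re (f t) * Im (g t) + Im (f t) * Re (g t))).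
  by apply: continuousD; apply: continuousM.
by apply/funext => t /=; case: (f t) (g t) => a b [].
Qed.

Lemma ccont_conj f : ccont f -> ccont (fun t => Num.conj (f t)).
Proof.
move=> [f1 f2]; split.
  rewrite (_ : (fun t => _) = (fun t => Re (f t))) //.
  by apply/funext => t /=; case: (f t).
rewrite (_ : (fun t => _) = (fun t => - Im (f t))); first exact: continuousN.
by apply/funext => t /=; case: (f t).
Qed.

Lemma ccont_sum (I : Type) (r : seq I) (P : pred I) (F : I -> T -> C) :
  (forall i, P i -> ccont (F i)) -> ccont (fun t => \sum_(i <- r | P i) F i t).
Proof.
move=> H; elim: r => [|i r IH].
  rewrite (_ : (fun t => _) = fun=> 0); first exact: ccont_cst.
  by apply/funext => t; rewrite big_nil.
case Pi: (P i).
  rewrite (_ : (fun t => _) = (fun t => F i t + \sum_(j <- r | P j) F j t)).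
    by apply: ccontD IH; exact: H.
  by apply/funext => t; rewrite big_cons Pi.
by rewrite (_ : (fun t => _) = (fun t => \sum_(j <- r | P j) F j t)) //;
  apply/funext => t; rewrite big_cons Pi.
Qed.

Lemma ccont_prod (I : Type) (r : seq I) (F : I -> T -> C) :
  (forall i, ccont (F i)) -> ccont (fun t => \prod_(i <- r) F i t).
Proof.
move=> H; elim: r => [|i r IH].
  rewrite (_ : (fun t => _) = fun=> 1); first exact: ccont_cst.
  by apply/funext => t; rewrite big_nil.
rewrite (_ : (fun t => _) = (fun t => F i t * \prod_(j <- r) F j t)).
  by apply: ccontM IH; exact: H.
by apply/funext => t; rewrite big_cons.
Qed.

Definition mcont m n (A : T -> 'M[C]_(m, n)) := forall i j, ccont (fun t => A t i j).

Lemma mcont_cst m n (A : 'M[C]_(m, n)) : mcont (fun=> A).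
Proof. by move=> i j; exact: ccont_cst. Qed.

Lemma mcont_mul m n p (A : T -> 'M[C]_(m, n)) (B : T -> 'M[C]_(n, p)) :
  mcont A -> mcont B -> mcont (fun t => A t *m B t).
Proof.
move=> cA cB i j; rewrite (_ : (fun t => _) = (fun t => \sum_k A t i k * B t k j)).
  by apply: ccont_sum => k _; apply: ccontM.
by apply/funext => t; rewrite mxE.
Qed.

Lemma mcont_trC m n (A : T -> 'M[C]_(m, n)) : mcont A -> mcont (fun t => (A t)^t*).
Proof.
move=> cA i j; rewrite (_ : (fun t => _) = (fun t => Num.conj (A t j i))).
  by apply: ccont_conj.
by apply/funext => t; rewrite trmxCE.
Qed.

Lemma mcont_colsub m n p (S : 'I_p -> 'I_n) (A : T -> 'M[C]_(m, n)) :
  mcont A -> mcont (fun t => colsub S (A t)).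
Proof.
move=> cA i j; rewrite (_ : (fun t => _) = (fun t => A t i (S j))); first exact: cA.
by apply/funext => t; rewrite mxE.
Qed.

Lemma ccont_det n (A : T -> 'M[C]_n) : mcont A -> ccont (fun t => \det (A t)).
Proof.
move=> cA; apply: ccont_sum => s _; apply: ccontM; first exact: ccont_cst.
by apply: ccont_prod => i; exact: cA.
Qed.

End ComplexContinuity.

Section Encoding.
Local Open Scope ring_scope.
Local Open Scope classical_set_scope.
Local Open Scope sesquilinear_scope.
Variables (R : realType) (n : nat).
Local Notation C := (R[i])%C.
Local Notation Re := complex.Re.
Local Notation Im := complex.Im.
Local Notation coded := 'rV[R]_(n * n + n * n).

(* Complex matrices are parametrised by real row vectors, for which the
   Heine-Borel theorem is available. *)
Definition decode (x : coded) : 'M[C]_n :=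
  \matrix_(i, j) ((x 0 (lshift _ (mxvec_index i j))) +i* (x 0 (rshift _ (mxvec_index i j))))%C.

Definition encode (A : 'M[C]_n) : coded :=
  row_mx (mxvec (map_mx (@complex.Re R) A)) (mxvec (map_mx (@complex.Im R) A)).

Lemma encodeK : cancel encode decode.
Proof.
move=> A; apply/matrixP => i j; rewrite mxE row_mxEl row_mxEr !mxvecE !mxE.
by case: (A i j).
Qed.

Lemma decode_cont x : mcont x decode.
Proof.
move=> i j; split.
  rewrite (_ : (fun t => _) = (fun t : coded => t 0 (lshift _ (mxvec_index i j)))).
    exact: coord_continuous.
  by apply/funext => t; rewrite mxE.
rewrite (_ : (fun t => _) = (fun t : coded => t 0 (rshift _ (mxvec_index i j)))).
  exact: coord_continuous.
by apply/funext => t; rewrite mxE.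
Qed.

Definition sqnorm (A : 'M[C]_n) : R := Re (\tr (A *m A^t*)).

Lemma sqnormE (A : 'M[C]_n) : sqnorm A = \sum_i \sum_j (Re (A i j) ^+ 2 + Im (A i j) ^+ 2).
Proof.
rewrite /sqnorm /mxtrace (raddf_sum (@complex.Re R : Rcomplex R -> R)).
apply: eq_bigr => i _; rewrite mxE (raddf_sum (@complex.Re R : Rcomplex R -> R)).
apply: eq_bigr => j _; rewrite trmxCE.
by case: (A i j) => a b /=; rewrite mulrN opprK !expr2.
Qed.

Lemma sqnorm_ge0 (A : 'M[C]_n) : 0 <= sqnorm A.
Proof. by rewrite sqnormE; do 2!apply: sumr_ge0 => ? _; rewrite addr_ge0 ?sqr_ge0. Qed.

Lemma sqnorm_entry (A : 'M[C]_n) i j : Re (A i j) ^+ 2 + Im (A i j) ^+ 2 <= sqnorm A.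
Proof.
rewrite sqnormE (bigD1 i) //= (bigD1 j) //= -addrA lerDl.
by rewrite addr_ge0 // sumr_ge0 // => *; rewrite ?sumr_ge0 // => *; rewrite addr_ge0 ?sqr_ge0.
Qed.

Lemma sqnorm_eq0 (A : 'M[C]_n) : sqnorm A = 0 -> A = 0.
Proof.
move=> A0; apply/matrixP => i j; have := sqnorm_entry A i j; rewrite A0 mxE.
case: (A i j) => a b /= ab; have [-> ->] : a = 0 /\ b = 0 by split; nra.
by [].
Qed.

Lemma sqnorm_cont (T : topologicalType) (x : T) (A : T -> 'M[C]_n) :
  mcont x A -> {for x, continuous (fun x => sqnorm (A x))}.
Proof.
move=> cA; have [] : ccont x (fun x => \tr (A x *m (A x)^t*)); last by [].
by apply: ccont_sum => i _; apply: mcont_mul => //; exact: mcont_trC.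
Qed.

Lemma compact_sphere (b : R) (Q : set coded) : closed Q ->
  compact ([set x | sqnorm (decode x) = b] `&` Q).
Proof.
move=> cQ; apply: bounded_closed_compact; last first.
  apply: closedI => //.
  apply: (@preimage_closed _ _ (fun x => sqnorm (decode x)) [set b]).
    by move=> y _; exact/sqnorm_cont/decode_cont.
  exact: closed_eq.
(* [x ^+ 2 <= b] implies that [b + 1] bounds the absolute value of [x]; this avoids a square
   root. *)
exists (b + 1); split; first by rewrite num_real.
move=> M bM x [/= xb _]; rewrite [leLHS]/Num.norm /= mx_normrE.
have b0 : 0 <= b by rewrite -xb sqnorm_ge0.
apply: bigmax_le => [|[i k] _ /=]; first lra.
rewrite (ord1 i) {i}.
suff : x 0 k ^+ 2 <= b.
  by move=> h; apply: le_trans (ltW bM); rewrite ler_norml; nra.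
rewrite -xb; case: (split_ordP k) => k' -> /=; case: (mxvec_indexP k') => i j.
  have := sqnorm_entry (decode x) i j; rewrite mxE /=; apply: le_trans.
  by rewrite lerDl sqr_ge0.
have := sqnorm_entry (decode x) i j; rewrite mxE /=; apply: le_trans.
by rewrite lerDr sqr_ge0.
Qed.

End Encoding.

(** * Coercivity, minimum and critical point of the Kempf-Ness function *)

Section RealDeterminant.
Local Open Scope ring_scope.
Local Open Scope sesquilinear_scope.
Variable R : realType.
Local Notation C := (R[i])%C.
Local Notation "x %:C" := (real_complex R x) : ring_scope.

Definition rdet n (A : 'M[C]_n) : R := complex.Re (\det A).

Lemma gt0_Re (z : C) : 0 < z -> (complex.Re z)%:C = z /\ 0 < complex.Re z.
Proof. by move=> z0; rewrite RRe_real ?gtr0_real //; move: z0; rewrite ltcE => /andP[]. Qed.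

Lemma rdetE n (A : 'M[C]_n) : posdefmx A -> (rdet A)%:C = \det A.
Proof. by move/posdef_det_gt0/gt0_Re => []. Qed.

Lemma rdet_gt0 n (A : 'M[C]_n) : posdefmx A -> 0 < rdet A.
Proof. by move/posdef_det_gt0/gt0_Re => []. Qed.

Lemma ln_prod (J : Type) (r : seq J) (f : J -> R) : (forall i, 0 < f i) ->
  0 < \prod_(i <- r) f i /\ ln (\prod_(i <- r) f i) = \sum_(i <- r) ln (f i).
Proof.
move=> f0; elim: r => [|i r [p0 IH]]; first by rewrite !big_nil ln1 ltr01.
by rewrite !big_cons lnM ?posrE // IH mulr_gt0.
Qed.

Lemma posdef_sorted n (A : 'M[C]_n) : posdefmx A ->
  exists u : 'M[C]_n, exists l : 'I_n -> R,
    [/\ u \is unitarymx, forall i, 0 < l i,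
        forall i j : 'I_n, (i <= j)%N -> l j <= l i &
        A = u^t* *m diag_mx (\row_i (l i)%:C) *m u].
Proof.
move=> /spectral_posdef[u [d [uu d0 ->]]].
pose l i := complex.Re (d 0 i).
have dE i : d 0 i = (l i)%:C by case: (gt0_Re (d0 i)).
pose s := sort (fun i j => l j <= l i) (enum 'I_n).
have sz : size s = n by rewrite size_sort size_enum_ord.
have suniq : uniq s by rewrite sort_uniq enum_uniq.
have srt : sorted (fun i j => l j <= l i) s.
  by apply: sort_sorted => i j; exact: le_total.
pose f (i : 'I_n) := nth i s i.
have finj : injective f.
  move=> i j /eqP; rewrite /f (set_nth_default i) ?sz // nth_uniq ?sz //.
  by move/eqP/val_inj.
pose p := perm finj.
exists (row_perm p u), (fun i => l (p i)); split.
- apply/unitarymxP; rewrite row_permE trmxC_mul mulmxA -(mulmxA _ u).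
  rewrite (unitarymxP uu) mulmx1 tr_perm_mx map_perm_mx -perm_mxM.
  by rewrite fingroup.mulgV perm_mx1.
- by move=> i; case: (gt0_Re (d0 (p i))).
- move=> i j ij; rewrite !permE /f (set_nth_default i (s := s) j) ?sz //.
  have tr : transitive (fun i j => l j <= l i) by move=> x y z /[swap]; exact: le_trans.
  apply: (sorted_leq_nth tr (fun x => lexx _) i srt) => //; by rewrite inE sz.
have entry (v : 'M[C]_n) (e : 'rV[C]_n) i j :
    (v^t* *m diag_mx e *m v) i j = \sum_k Num.conj (v k i) * e 0 k * v k j.
  by rewrite mxE; apply: eq_bigr => k _; rewrite mul_mx_diag mxE trmxCE.
apply/matrixP => i j; rewrite !entry (reindex_inj (@perm_inj _ p)).
by apply: eq_bigr => k _; rewrite !mxE dE.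
Qed.

Variables (I : finType) (n : nat) (d : I -> nat) (B : forall x, 'M[C]_(d x, n.+1)).
Variables (c : I -> R) (gamma : R).
Hypotheses (c_gt0 : forall x, 0 < c x) (gamma_ge0 : 0 <= gamma).
Hypothesis B_free : forall x, row_free (B x).
Hypothesis trace_eq : \sum_x c x * (d x)%:R = gamma * n.+1%:R.
Hypothesis stable : forall U : 'M[C]_n.+1, (0 < \rank U < n.+1)%N ->
  \sum_x c x * (\rank (B x :&: U)%MS)%:R < gamma * (\rank U)%:R.

(** For unitary [u], the coordinates of the rows of [B x] in the orthonormal basis formed by the
    rows of [u]. *)
Definition columns (u : 'M[C]_n.+1) x : 'M[C]_(d x, n.+1) := B x *m u^t*.

Lemma columns_free (u : 'M[C]_n.+1) x : u \is unitarymx -> row_free (columns u x).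
Proof.
rewrite -trmxC_unitary => /unitarymx_unit uu.
by rewrite /row_free mxrankMfree ?row_free_unit //; exact: B_free.
Qed.

(** Rank-nullity for the first [m] coordinates: a combination of rows of [B x] on which they vanish
    lies in the span of the rows of [u] with index at least [m], which is [copid_mx m *m u]. *)
Lemma rank_pivots (u : 'M[C]_n.+1) x m : u \is unitarymx -> (m <= n.+1)%N ->
  (d x <= \rank (first_rows (columns u x)^T m) +
         \rank (B x :&: (copid_mx m *m u))%MS)%N.
Proof.
move=> uu mn; set D := columns u x.
have -> : \rank (first_rows D^T m) = \rank (D *m (pid_mx m : 'M_n.+1)).
  by rewrite -mxrank_tr /first_rows trmx_mul trmxK tr_pid_mx.
have DB (w : 'M[C]_(d x)) : w *m D *m u = w *m B x.
  by rewrite /D /columns !mulmxA mulmxKtV.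
set K := kermx (D *m (pid_mx m : 'M_n.+1)).
have K0 : K *m D *m (pid_mx m : 'M_n.+1) = 0 by rewrite -mulmxA mulmx_ker.
have dE : d x = (\rank (D *m (pid_mx m : 'M_n.+1)) + \rank K)%N.
  by rewrite /K mxrank_ker subnKC // rank_leq_row.
rewrite [X in (X <= _)%N]dE leq_add2l -(mxrankMfree K (B_free x)) mxrankS // sub_capmx submxMl /=.
rewrite -DB; have -> : K *m D = K *m D *m copid_mx m.
  by rewrite /copid_mx mulmxBr mulmx1 K0 subr0.
by rewrite -[X in (X <= _)%MS]mulmxA; exact: submxMl.
Qed.

(** Here stability enters, applied to the span [U] of the last [n.+1 - m] rows of [u]. At least
    [d x - \rank (B x :&: U)] pivots lie below [m], and the trace equality turns the upper bound on
    the intersections into a strict lower bound on the pivots. *)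
Lemma pivots (u : 'M[C]_n.+1) : u \is unitarymx -> exists S : forall x, 'I_(d x) -> 'I_n.+1,
  [/\ forall x, injective (S x), forall x, colsub (S x) (columns u x) \in unitmx &
     forall m, (0 < m < n.+1)%N ->
       0 < \sum_x c x * #|[set j | (S x j < m)%N]%SET|%:R - gamma * m%:R].
Proof.
move=> uu.
have rE x : \rank (columns u x)^T = d x.
  by rewrite mxrank_tr; apply/eqP/columns_free.
have SP x := cid (exists_pivots (rE x)); pose S x := sval (SP x).
exists S; split=> [x|x|m /andP[m0 mn]]; first by case: (svalP (SP x)).
  have [_ + _] := svalP (SP x); rewrite -unitmx_tr.
  by congr (_ \in unitmx); apply/matrixP => i j; rewrite !mxE.
set U : 'M[C]_n.+1 := copid_mx m *m u.
have rU : \rank U = (n.+1 - m)%N.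
  rewrite /U mxrankMfree ?row_free_unit ?unitarymx_unit //.
  by rewrite rank_copid_mx // ltnW.
have := @stable U; rewrite rU subn_gt0 mn /= => /(_ _)/wrap[]; first lia.
rewrite natrB ?(ltnW mn) // mulrBr -trace_eq => st.
suff : \sum_x c x * (d x)%:R <= \sum_x c x * #|[set j | (S x j < m)%N]%SET|%:R +
    \sum_x c x * (\rank (B x :&: U)%MS)%:R by lra.
rewrite -big_split /=; apply: ler_sum => x _; rewrite -mulrDr ler_pM2l // -natrD ler_nat.
have [_ _ ->] := svalP (SP x); last exact: ltnW.
exact: rank_pivots uu (ltnW mn).
Qed.

(** [kappa] is kept apart from the squared minors that it bounds, so that the same [kappa] and [S]
    can serve all unitary matrices near a given one. *)
Lemma weyl_lower_bound (u : 'M[C]_n.+1) (S : forall x, 'I_(d x) -> 'I_n.+1)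
    (kappa : I -> R) (l : 'I_n.+1 -> R) :
  u \is unitarymx -> (forall i, 0 < l i) ->
  (forall x, injective (S x)) -> (forall x, 0 < kappa x) ->
  (forall x, kappa x <= rdet (colsub (S x) (columns u x) *m (colsub (S x) (columns u x))^t*)) ->
  \sum_x c x * (ln (kappa x) + \sum_j ln (l (S x j))) <=
  \sum_x c x * ln (rdet (columns u x *m diag_mx (\row_i (l i)%:C) *m (columns u x)^t*)).
Proof.
move=> uu l0 Sinj k0 kS; apply: ler_sum => x _; rewrite ler_pM2l //.
set D := columns u x; pose M := colsub (S x) D.
have M0 : 0 < rdet (M *m M^t*) := lt_le_trans (k0 x) (kS x).
have Mu : M \in unitmx.
  rewrite unitmxE unitfE; apply: contraTneq M0 => M0.
  by rewrite /rdet det_mulmx M0 mul0r ltxx.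
have ME := rdetE (posdef_gram (_ : row_free M)).
rewrite row_free_unit in ME; have {}ME := ME Mu.
have := det_weighted_gram_ge (d := \row_i (l i)%:C) (Sinj x) Mu.
move=> /(_ _)/wrap[]; first by move=> i; rewrite mxE ltcR.
rewrite -ME => le_det.
have Dpd : posdefmx (D *m diag_mx (\row_i (l i)%:C) *m D^t*).
  apply: posdef_diag_gram => [|i]; last by rewrite mxE ltcR.
  exact: columns_free.
move: le_det; rewrite -(rdetE Dpd).
have -> : \prod_j (\row_i (l i)%:C) 0 (S x j) = (\prod_j l (S x j))%:C.
  by rewrite rmorph_prod; apply: eq_bigr => j _; rewrite mxE.
rewrite -rmorphM lecR => le_det.
have [p0 <-] := ln_prod (index_enum 'I_(d x)) (f := fun j => l (S x j)) (fun j => l0 (S x j)).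
rewrite -lnM ?posrE // ler_ln ?posrE ?mulr_gt0 ?rdet_gt0 //.
by apply: le_trans le_det; rewrite mulrC ler_pM2l.
Qed.

Lemma abel_identity (f : nat -> R) m i : (i <= m)%N ->
  f i = f m + \sum_(j < m) (i <= j)%N%:R * (f j - f j.+1).
Proof.
elim: m => [|m IH]; first by rewrite leqn0 => /eqP ->; rewrite big_ord0 addr0.
rewrite leq_eqVlt => /predU1P[->|im].
  by rewrite big1 ?addr0 // => j _; rewrite leqNgt ltn_ord mul0r.
by rewrite big_ord_recr /= -ltnS im mul1r IH //; ring.
Qed.

Lemma uniform_pos_bound (w : nat -> R) m : (forall i, (i < m)%N -> 0 < w i) ->
  exists2 e : R, 0 < e & forall i, (i < m)%N -> e <= w i.
Proof.
elim: m => [_|m IH w0]; first by exists 1.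
have [i im|e e0 ew] := IH; first by apply: w0; exact: ltnW.
exists (Num.min e (w m)); first by rewrite lt_min e0 w0.
move=> i; rewrite ltnS leq_eqVlt => /predU1P[->|im]; first by rewrite ge_min lexx orbT.
by rewrite ge_min ew.
Qed.

(* Abel summation in terms of the successive differences of the weights. *)
Lemma weyl_chamber_bound (S : forall x, 'I_(d x) -> 'I_n.+1) :
  (forall m, (0 < m < n.+1)%N ->
     0 < \sum_x c x * #|[set j | (S x j < m)%N]%SET|%:R - gamma * m%:R) ->
  exists2 e : R, 0 < e & forall f : 'I_n.+1 -> R,
    (forall i j : 'I_n.+1, (i <= j)%N -> f j <= f i) ->
    e * (f ord0 - f ord_max) <= \sum_x c x * (\sum_j f (S x j)) - gamma * \sum_i f i.
Proof.
move=> Spos.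
have [|e e0 eS] := @uniform_pos_bound (fun m =>
    \sum_x c x * #|[set j | (S x j < m.+1)%N]%SET|%:R - gamma * m.+1%:R) n.
  by move=> m mn; apply: Spos.
exists e => // f anti; pose h m := f (inord m).
have hE (i : 'I_n.+1) : f i = h n + \sum_(j < n) (i <= j)%N%:R * (h j - h j.+1).
  by rewrite -[in LHS](inord_val i) -/(h i); apply: abel_identity; rewrite -ltnS.
have delta0 (j : 'I_n) : 0 <= h j - h j.+1.
  by rewrite subr_ge0 anti // !inordK // ltnS // ltnW.
have sum1 x : \sum_j f (S x j) =
    h n *+ d x + \sum_(m < n) #|[set j | (S x j < m.+1)%N]%SET|%:R * (h m - h m.+1).
  under eq_bigr do rewrite hE.
  rewrite big_split /= sumr_const card_ord exchange_big /=; congr (_ + _).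
  apply: eq_bigr => m _; rewrite -mulr_suml; congr (_ * _).
  rewrite -sumr_const [RHS]big_mkcond /=; apply: eq_bigr => j _.
  by rewrite inE ltnS; case: leqP.
have sum2 : \sum_i f i = h n *+ n.+1 + \sum_(m < n) m.+1%:R * (h m - h m.+1).
  under eq_bigr do rewrite hE.
  rewrite big_split /= sumr_const card_ord exchange_big /=; congr (_ + _).
  apply: eq_bigr => m _; rewrite -mulr_suml; congr (_ * _).
  have -> : \sum_(i < n.+1) (i <= m)%N%:R = \sum_(i < n.+1 | (i < m.+1)%N) (1 : R).
    by rewrite [RHS]big_mkcond; apply: eq_bigr => i _; rewrite ltnS; case: leqP.
  rewrite -(big_ord_widen n.+1 (fun=> 1)) ?sumr_const ?card_ord //.
  by rewrite !ltnS ltnW.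
have -> : \sum_x c x * (\sum_j f (S x j)) - gamma * \sum_i f i =
    \sum_(m < n) (\sum_x c x * #|[set j | (S x j < m.+1)%N]%SET|%:R - gamma * m.+1%:R) * (h m - h m.+1).
  have -> : \sum_x c x * (\sum_j f (S x j)) = h n * (gamma * n.+1%:R) +
      \sum_(m < n) (\sum_x c x * #|[set j | (S x j < m.+1)%N]%SET|%:R) * (h m - h m.+1).
    under eq_bigr do rewrite sum1 mulrDr -mulr_natr mulrCA.
    rewrite big_split /= -mulr_sumr trace_eq; congr (_ + _).
    under eq_bigr do rewrite mulr_sumr.
    rewrite exchange_big /=; apply: eq_bigr => m _; rewrite mulr_suml.
    by apply: eq_bigr => x _; rewrite mulrA.
  have -> : \sum_(m < n) (\sum_x c x * #|[set j | (S x j < m.+1)%N]%SET|%:R - gamma * m.+1%:R) * (h m - h m.+1)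
    = \sum_(m < n) (\sum_x c x * #|[set j | (S x j < m.+1)%N]%SET|%:R) * (h m - h m.+1)
      - gamma * \sum_(m < n) m.+1%:R * (h m - h m.+1).
    by rewrite mulr_sumr -sumrB; apply: eq_bigr => m _; ring.
  by rewrite sum2 -mulr_natr; ring.
have -> : f ord0 - f ord_max = \sum_(m < n) (h m - h m.+1).
  rewrite (hE ord0) (hE ord_max) opprD addrACA subrr add0r.
  rewrite [X in _ - X]big1 ?subr0; last by move=> j _; rewrite /= leqNgt ltn_ord mul0r.
  by apply: eq_bigr => j _; rewrite mul1r.
rewrite mulr_sumr; apply: ler_sum => m _; rewrite ler_wpM2r //.
exact: eS.
Qed.

(** [M] is at once the inverse of the slope and the offset. For positive [M] the condition weakens
    as [M] grows, so it can be handled as a property holding near infinity. *)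
Definition coercive_at (M : R) (u : 'M[C]_n.+1) := forall l : 'I_n.+1 -> R,
  (forall i, 0 < l i) -> (forall i j : 'I_n.+1, (i <= j)%N -> l j <= l i) ->
  M^-1 * (ln (l ord0) - ln (l ord_max)) - M <=
  \sum_x c x * ln (rdet (columns u x *m diag_mx (\row_i (l i)%:C) *m (columns u x)^t*))
  - gamma * \sum_i ln (l i).

Lemma mcontD (T : topologicalType) (x : T) m p (A1 A2 : T -> 'M[C]_(m, p)) :
  mcont x A1 -> mcont x A2 -> mcont x (fun t => A1 t + A2 t).
Proof.
move=> c1 c2 i j; rewrite (_ : (fun t => _) = (fun t => A1 t i j + A2 t i j)).
  exact: ccontD.
by apply/funext => t; rewrite mxE.
Qed.

Lemma rdet_cont (T : topologicalType) (x : T) m (A : T -> 'M[C]_m) :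
  mcont x A -> {for x, continuous (fun t => rdet (A t))}.
Proof. by case/ccont_det. Qed.

Lemma compact_unitary : compact [set x | decode x \is @unitarymx C n.+1 n.+1]%classic.
Proof.
rewrite (_ : [set x | _]%classic =
    ([set x | sqnorm (decode x) = n.+1%:R] `&`
     [set x | sqnorm (decode x *m (decode x)^t* + (- 1%:M)) = 0])%classic).
  apply: compact_sphere; apply: (@preimage_closed _ _
      (fun x => sqnorm (decode x *m (decode x)^t* + (- 1%:M))) [set 0]%classic).
    move=> x _; apply: sqnorm_cont; apply: mcontD; last exact: mcont_cst.
    by apply: mcont_mul; [|apply: mcont_trC]; exact: decode_cont.
  exact: closed_eq.
apply/seteqP; split=> x /=.
  move/unitarymxP => xu; split; last by rewrite xu subrr /sqnorm mul0mx mxtrace0.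
  rewrite /sqnorm xu mxtrace1; have -> : n.+1%:R = (n.+1%:R : R)%:C by rewrite rmorph_nat.
  by [].
by case=> _ /sqnorm_eq0/eqP; rewrite subr_eq0 => /eqP/unitarymxP.
Qed.

Lemma coercive : exists2 M : R, 0 < M & forall u, u \is unitarymx -> coercive_at M u.
Proof.
have /compact_near_coveringP/near_covering_withinP cov := compact_unitary.
have : \forall M \near +oo%R, ([set x | decode x \is @unitarymx C n.+1 n.+1] `<=`
    (fun x => coercive_at M (decode x)))%classic.
  apply: cov => x /= ux.
  have [S [Sinj Sunit Spos]] := pivots ux.
  have [e e0 eS] := weyl_chamber_bound Spos.
  pose gram u y := colsub (S y) (columns u y) *m (colsub (S y) (columns u y))^t*.
  have gram0 y : 0 < rdet (gram (decode x) y).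
    by apply/rdet_gt0/posdef_gram; rewrite row_free_unit; exact: Sunit.
  (* Half of the value at [x]: by continuity the Gram determinants of the same columns stay above it
     near [x], so the pivots of [x] also serve its neighbours. *)
  pose kappa y := rdet (gram (decode x) y) / 2.
  have k0 y : 0 < kappa y by rewrite divr_gt0.
  have gram_cont y : {for x, continuous (fun x' => rdet (gram (decode x') y))}.
    have cu : mcont x (fun x' => colsub (S y) (columns (decode x') y)).
      apply: mcont_colsub; apply: mcont_mul; first exact: mcont_cst.
      by apply: mcont_trC; exact: decode_cont.
    by apply: rdet_cont; apply: mcont_mul => //; exact: mcont_trC.
  have kgram y : kappa y < rdet (gram (decode x) y).
    by have := gram0 y; rewrite /kappa /=; lra.
  have near_gram : \forall x' \near x, forall y, kappa y < rdet (gram (decode x') y).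
    have nF : Filter (nbhs x) by exact: nbhs_filter.
    apply: (@filter_forall _ I (fun y x' => kappa y < rdet (gram (decode x') y)) _ nF) => y.
    exact: (cvgr_gt _ (gram_cont y) _ (kgram y)).
  near=> x' M => /= ux' l l0 lanti.
  have fanti (i j : 'I_n.+1) : (i <= j)%N -> ln (l j) <= ln (l i).
    by move=> ij; rewrite ler_ln ?posrE //; exact: lanti.
  have kM y : kappa y <= rdet (gram (decode x') y).
    apply/ltW; move: y; near: x'; exact: near_gram.
  have := weyl_lower_bound ux' l0 Sinj k0 kM.
  have := eS _ fanti.
  have t0 : 0 <= ln (l ord0) - ln (l ord_max) by rewrite subr_ge0 fanti.
  have M0 : 0 < M by near: M; exact: nbhs_pinfty_gt.
  have Me : M^-1 <= e.
    rewrite invf_ple ?posrE //; near: M; exact: nbhs_pinfty_ge.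
  have MK : - M <= \sum_y c y * ln (kappa y).
    rewrite lerNl; near: M; apply: nbhs_pinfty_ge; exact: num_real.
  have := ler_wpM2r t0 Me.
  under [X in _ -> _ -> X <= _ -> _]eq_bigr do rewrite mulrDr.
  by rewrite big_split /=; lra.
move=> cov'; have [M [M0 HM]] : exists M : R, 0 < M /\
    ([set x | decode x \is @unitarymx C n.+1 n.+1] `<=` (fun x => coercive_at M (decode x)))%classic.
  near (pinfty_nbhs R) => M; exists M; split; first by near: M; exact: nbhs_pinfty_gt.
  by near: M.
exists M => // u uu; rewrite -(encodeK u); apply: HM => /=.
by rewrite encodeK.
Unshelve. all: by end_near.
Qed.

Definition gram (g : 'M[C]_n.+1) x := (B x *m g) *m (B x *m g)^t*.

Definition kempf_ness (g : 'M[C]_n.+1) : R :=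
  \sum_x c x * ln (rdet (gram g x)) - gamma * ln (rdet (g *m g^t*)).

Lemma posdef_gram_unit g x : g \in unitmx -> posdefmx (gram g x).
Proof.
move=> gu; apply: posdef_gram; rewrite /row_free mxrankMfree ?row_free_unit //.
exact: B_free.
Qed.

Lemma posdef_unit_gram (g : 'M[C]_n.+1) : g \in unitmx -> posdefmx (g *m g^t*).
Proof. by move=> gu; apply: posdef_gram; rewrite row_free_unit. Qed.

Lemma kempf_ness_polar (M : R) g : (forall u, u \is unitarymx -> coercive_at M u) ->
  g \in unitmx -> exists l : 'I_n.+1 -> R,
    [/\ forall i, 0 < l i, forall i j : 'I_n.+1, (i <= j)%N -> l j <= l i,
        \sum_i l i = sqnorm g, \prod_i l i = rdet (g *m g^t*) &
        M^-1 * (ln (l ord0) - ln (l ord_max)) - M <= kempf_ness g].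
Proof.
move=> HM gu; have [u [l [uu l0 lanti gE]]] := posdef_sorted (posdef_unit_gram gu).
have detE : \prod_i l i = rdet (g *m g^t*).
  rewrite /rdet gE !det_mulmx mulrAC det_unitary // mul1r det_diag.
  rewrite (eq_bigr (fun i => (l i)%:C)); last by move=> i _; rewrite mxE.
  by rewrite -rmorph_prod.
exists l; split=> //.
  rewrite /sqnorm gE mxtrace_mulC mulmxA (unitarymxP uu) mul1mx mxtrace_diag.
  rewrite (eq_bigr (fun i => (l i)%:C)); last by move=> i _; rewrite mxE.
  by rewrite -rmorph_sum.
have -> : kempf_ness g = \sum_x c x * ln (rdet (columns u x *m diag_mx (\row_i (l i)%:C) *m (columns u x)^t*))
  - gamma * \sum_i ln (l i).
  have E1 x : gram g x = columns u x *m diag_mx (\row_i (l i)%:C) *m (columns u x)^t*.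
    by rewrite /gram /columns !trmxC_mul trmxCK !mulmxA -(mulmxA (B x) g) gE !mulmxA.
  have E2 : \sum_x c x * ln (rdet (gram g x)) = \sum_x c x *
      ln (rdet (columns u x *m diag_mx (\row_i (l i)%:C) *m (columns u x)^t*)).
    by apply: eq_bigr => x _; rewrite (E1 x).
  have E3 : ln (rdet (g *m g^t*)) = \sum_i ln (l i).
    by rewrite -detE; case: (ln_prod (index_enum 'I_n.+1) l0).
  exact: (f_equal2 (fun a b : R => a - gamma * b) E2 E3).
exact: HM.
Qed.

(** By the trace equality the two logarithmic terms shift by the same amount; this permits the
    normalization [sqnorm g = 1]. *)
Lemma kempf_ness_scale (t : R) g : 0 < t -> g \in unitmx -> kempf_ness (t%:C *: g) = kempf_ness g.
Proof.
move=> t0 gu; have t2_gt0 : 0 < t ^+ 2 by rewrite exprn_gt0.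
have rdetZ k (A : 'M[C]_k) : posdefmx A ->
    ln (rdet ((t ^+ 2)%:C *: A)) = k%:R * ln (t ^+ 2) + ln (rdet A).
  move=> Apd; rewrite /rdet detZ -rmorphXn /= -(rdetE Apd) -rmorphM /=.
  by rewrite lnM ?posrE ?(exprn_gt0 _ t2_gt0) ?rdet_gt0 // (lnXn _ t2_gt0) mulr_natl.
have tt : t%:C * (t%:C)^* = (t ^+ 2)%:C by rewrite geC0_conj ?ler0c ?ltW // -rmorphM expr2.
have EZ : t%:C *: g *m (t%:C *: g)^t* = (t ^+ 2)%:C *: (g *m g^t*).
  by rewrite trmxCZ -scalemxAl -scalemxAr scalerA tt.
have gramZ x : gram (t%:C *: g) x = (t ^+ 2)%:C *: gram g x.
  by rewrite /gram -scalemxAr trmxCZ -scalemxAl -scalemxAr scalerA tt.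
have E1 : \sum_x c x * ln (rdet (gram (t%:C *: g) x)) =
    \sum_x c x * ((d x)%:R * ln (t ^+ 2) + ln (rdet (gram g x))).
  by apply: eq_bigr => x _; rewrite (gramZ x) (rdetZ _ _ (posdef_gram_unit x gu)).
have E2 : ln (rdet (t%:C *: g *m (t%:C *: g)^t*)) = n.+1%:R * ln (t ^+ 2) + ln (rdet (g *m g^t*)).
  by rewrite EZ (rdetZ _ _ (posdef_unit_gram gu)).
have E3 (a : I -> R) (L : R) : \sum_x c x * ((d x)%:R * L + a x) = gamma * n.+1%:R * L + \sum_x c x * a x.
  by rewrite -trace_eq mulr_suml -big_split /=; apply: eq_bigr => x _; ring.
have E4 (L S q : R) : (gamma * n.+1%:R * L + S) - gamma * (n.+1%:R * L + q) = S - gamma * q by ring.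
exact: etrans (f_equal2 (fun a b => a - gamma * b) (etrans E1 (E3 _ _)) E2) (E4 _ _ _).
Qed.

Lemma kempf_ness_cont (x : 'rV[R]_(n.+1 * n.+1 + n.+1 * n.+1)) : decode x \in unitmx ->
  {for x, continuous (fun x => kempf_ness (decode x))}.
Proof.
move=> gu.
have ln_cont (T : topologicalType) (y : T) m (A : T -> 'M[C]_m) : mcont y A -> posdefmx (A y) ->
    {for y, continuous (fun t => ln (rdet (A t)))}.
  move=> cA Apd; apply: (@continuous_comp _ _ _ (fun t => rdet (A t)) (@ln R)).
    exact: rdet_cont.
  by apply: continuous_ln; exact: rdet_gt0.
apply: continuousB; last first.
  apply: continuousM; first exact: cst_continuous.
  apply: ln_cont; last exact: posdef_unit_gram.
  by apply: mcont_mul; [|apply: mcont_trC]; exact: decode_cont.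
have gram_cont y : mcont x (fun x => gram (decode x) y).
  have cu : mcont x (fun x' => B y *m decode x').
    by apply: mcont_mul; [exact: mcont_cst | exact: decode_cont].
  by apply: mcont_mul => //; exact: mcont_trC.
have term_cont y : {for x, continuous (fun x => c y * ln (rdet (gram (decode x) y)))}.
  apply: continuousM; first exact: cst_continuous.
  by apply: ln_cont; [exact: gram_cont | exact: posdef_gram_unit].
elim: (index_enum I) => [|y r IH].
  rewrite (_ : (fun _ => _) = fun=> 0); first exact: cst_continuous.
  by apply/funext => t; rewrite big_nil.
rewrite (_ : (fun _ => _) = (fun t => c y * ln (rdet (gram (decode t) y)) +
    \sum_(z <- r) c z * ln (rdet (gram (decode t) z)))).
  exact: continuousD.
by apply/funext => t; rewrite big_cons.
Qed.

(** Among matrices of norm one only those with a value at most that of [g0] matter. Coercivity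
    bounds the ratio of the extreme eigenvalues of [g *m g^t*], which keeps the determinant away
    from 0 and leaves a compact set [K] of invertible matrices. *)
Lemma kempf_ness_minimum : exists2 g : 'M[C]_n.+1, g \in unitmx &
  forall g', g' \in unitmx -> kempf_ness g <= kempf_ness g'.
Proof.
have [M M0 HM] := coercive.
pose N : R := n.+1%:R; have N0 : 0 < N by rewrite ltr0n.
pose s : R := (Num.sqrt N)^-1.
have s0 : 0 < s by rewrite invr_gt0 sqrtr_gt0.
pose g0 : 'M[C]_n.+1 := s%:C *: 1%:M.
have scale_unit (t : R) (g : 'M[C]_n.+1) : 0 < t -> g \in unitmx -> t%:C *: g \in unitmx.
  by move=> t0 gu; rewrite scaler_unit // unitfE gt_eqF // ltcR.
have g0u : g0 \in unitmx by apply: scale_unit => //; exact: unitmx1.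
have sqZ (t : R) (g : 'M[C]_n.+1) : 0 < t -> sqnorm (t%:C *: g) = t ^+ 2 * sqnorm g.
  move=> t0; rewrite !sqnormE mulr_sumr; apply: eq_bigr => i _.
  rewrite mulr_sumr; apply: eq_bigr => j _; rewrite !mxE.
  by case: (g i j) => a b /=; ring.
have sq1 : sqnorm (1%:M : 'M[C]_n.+1) = N.
  rewrite /sqnorm trmxC1 mulmx1 mxtrace1.
  by have -> : n.+1%:R = (n.+1%:R : R)%:C by rewrite rmorph_nat.
have sq0 : sqnorm g0 = 1.
  by rewrite sqZ // sq1 exprVn sqr_sqrtr ?ltW // mulVf // gt_eqF.
(* The [N] eigenvalues have sum 1, so the largest is at least [N^-1]; their logarithms differ by at
   most [L], so all are at least [eta]. The minimum in [delta] ensures that [g0] belongs to [K]. *)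
pose L := M * (kempf_ness g0 + M).
pose eta := expR (- ln N - L).
pose delta := Num.min (eta ^+ n.+1) (rdet (g0 *m g0^t*)).
have arith1 (a b e f : R) : - e <= a -> a - b <= f -> - e - f <= b by lra.
have arith2 (D k1 k2 : R) : M^-1 * D - M <= k1 -> k1 <= k2 -> D <= M * (k2 + M).
  by move=> *; rewrite -ler_pdivrMl //; lra.
have low g : g \in unitmx -> sqnorm g = 1 -> kempf_ness g <= kempf_ness g0 ->
    delta <= rdet (g *m g^t*).
  move=> gu g1 gle; have [l [l0 lanti lsum lprod lb]] := kempf_ness_polar HM gu.
  rewrite ge_min; apply/orP; left; rewrite -lprod.
  have lmax : N^-1 <= l ord0.
    rewrite -(ler_pM2l N0) mulfV ?gt_eqF // -g1 -lsum.
    rewrite (le_trans (_ : _ <= \sum_(i < n.+1) l ord0)) //.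
      by apply: ler_sum => i _; apply: lanti.
    by rewrite sumr_const card_ord mulr_natl.
  have llast : eta <= l ord_max.
    rewrite /eta -ler_ln ?posrE ?expR_gt0 // expRK.
    have lnN : - ln N <= ln (l ord0) by rewrite -lnV ?posrE // ler_ln ?posrE ?invr_gt0.
    exact: arith1 lnN (arith2 _ _ _ lb gle).
  rewrite -[X in _ ^+ X]card_ord -prodr_const; apply: ler_prod => i _.
  by rewrite expR_ge0 (le_trans llast) // lanti // -ltnS.
pose K := ([set x : 'rV[R]_(n.+1 * n.+1 + n.+1 * n.+1) | sqnorm (decode x) = 1] `&`
  [set x | delta <= rdet (decode x *m (decode x)^t*)])%classic.
have delta0 : 0 < delta.
  by rewrite lt_min exprn_gt0 ?expR_gt0 // rdet_gt0 //; exact: posdef_unit_gram.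
have cK : compact K.
  apply: compact_sphere.
  apply: (@preimage_closed _ _ (fun x => rdet (decode x *m (decode x)^t*)) [set y | delta <= y]%classic).
    move=> x _; apply: (@rdet_cont _ x _ (fun x => decode x *m (decode x)^t*)).
    by apply: mcont_mul; [|apply: mcont_trC]; exact: decode_cont.
  exact: closed_ge.
have Kunit x : K x -> decode x \in unitmx.
  move=> [_ /= dx]; have : 0 < rdet (decode x *m (decode x)^t*) by exact: lt_le_trans dx.
  rewrite unitmxE unitfE; apply: contraTneq => d0.
  by rewrite /rdet det_mulmx d0 mul0r ltxx.
have K0 : (K !=set0)%classic.
  exists (encode g0); split; rewrite /= encodeK //.
  by rewrite ge_min lexx orbT.
have [] := compact_EVT_min (f := fun x => kempf_ness (decode x)) K0 cK.
  by apply: continuous_in_subspaceT => x /set_mem Kx; apply: kempf_ness_cont; exact: Kunit.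
move=> x /set_mem Kx xmin; exists (decode x); first exact: Kunit.
have min0 g : g \in unitmx -> sqnorm g = 1 -> kempf_ness (decode x) <= kempf_ness g.
  move=> gu g1; case/orP: (le_total (kempf_ness g) (kempf_ness g0)) => gle.
    rewrite -(encodeK g); apply: xmin; rewrite inE; split; rewrite /= encodeK //.
    exact: low.
  apply: le_trans gle; rewrite -(encodeK g0); apply: xmin; rewrite inE.
  by split; rewrite /= encodeK // ge_min lexx orbT.
move=> g gu.
have gn0 : 0 < sqnorm g.
  rewrite lt_def sqnorm_ge0 andbT; apply: contraTneq gu => /sqnorm_eq0 ->.
  by rewrite unitmxE det0 unitr0.
pose t := (Num.sqrt (sqnorm g))^-1.
have t0 : 0 < t by rewrite invr_gt0 sqrtr_gt0.
rewrite -(kempf_ness_scale t0 gu); apply: min0; first exact: scale_unit.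
by rewrite sqZ // exprVn sqr_sqrtr ?ltW // mulVf // gt_eqF.
Qed.

(** For row-free [X], the orthogonal projection onto its row space, acting on row vectors from the
    right. *)
Definition row_projection k m (X : 'M[C]_(k, m)) : 'M[C]_m :=
  X^t* *m invmx (X *m X^t*) *m X.

(** A comparison of slopes at 0 without derivatives: [p0 * ln (1 + tau * q)] is at most [tau * s1]
    for [tau] of both signs, and both sides vanish at 0. *)
Lemma ln_first_order (s1 q p0 : R) (f : R -> R) : 0 < q -> 0 <= s1 ->
  (forall tau, 0 < 1 + tau * q -> f tau <= tau * s1) ->
  (forall tau, 0 < 1 + tau * q -> p0 * ln (1 + tau * q) <= f tau) -> 0 <= p0 ->
  s1 = p0 * q.
Proof.
move=> q0 s10 fle fge p00.
have key tau : 0 < 1 + tau * q -> p0 * (tau * q) <= tau * s1 * (1 + tau * q).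
  move=> h; have lnge : (tau * q) / (1 + tau * q) <= ln (1 + tau * q).
    have := @le_ln1Dx R ((1 + tau * q)^-1 - 1).
    rewrite subrKC lnV ?posrE // => /(_ _)/wrap[].
      by rewrite ltrBrDl subrr invr_gt0.
    have : (1 + tau * q) * (1 + tau * q)^-1 = 1 by rewrite divff // gt_eqF.
    by set y := (1 + tau * q)^-1; nra.
  have le1 := le_trans (fge _ h) (fle _ h).
  have le2 := le_trans (ler_wpM2l p00 lnge) le1.
  by have := ler_wpM2r (ltW h) le2; rewrite -mulrA divfK // gt_eqF.
have [lt|gt|//] := ltrgtP s1 (p0 * q).
  (* With this [t], the product [t * s1 * q] is less than half of the gap [p0 * q - s1], against
     [key]. For the opposite gap [tau] is [- t], and [t <= 1 / (2 * q)] keeps the logarithm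
     defined. *)
  pose t := (p0 * q - s1) / (2 * (s1 * q + 1)).
  have d0 : 0 < s1 * q + 1 by rewrite ltr_wpDl // mulr_ge0 // ltW.
  have t0 : 0 < t by rewrite divr_gt0 ?subr_gt0 // mulr_gt0.
  have tE : t * (2 * (s1 * q + 1)) = p0 * q - s1 by rewrite mulfVK // gt_eqF // mulr_gt0.
  have h : 0 < 1 + t * q by rewrite ltr_pwDl // mulr_ge0 // ltW.
  have := key t h.
  rewrite mulrCA -mulrA ler_pM2l //; nra.
pose t := Num.min (1 / (2 * q)) ((s1 - p0 * q) / (2 * (s1 * q + 1))).
have d0 : 0 < s1 * q + 1 by rewrite ltr_wpDl // mulr_ge0 // ltW.
have t0 : 0 < t by rewrite lt_min !divr_gt0 ?subr_gt0 // mulr_gt0.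
have t1 : t * (2 * q) <= 1 by rewrite -ler_pdivlMr ?mulr_gt0 // ge_min lexx.
have t2 : t * (2 * (s1 * q + 1)) <= s1 - p0 * q.
  by rewrite -ler_pdivlMr ?mulr_gt0 // ge_min lexx orbT.
have := key (- t) => /(_ _)/wrap[]; first by rewrite mulNr; nra.
rewrite !mulNr mulrN lerN2 mulrCA -mulrA ler_pM2l //; nra.
Qed.

Lemma rdet_rank1 k m (X : 'M[C]_(k, m)) (v : 'rV[C]_m) (t : R) : row_free X ->
  let p := complex.Re ((v *m row_projection X *m v^t*) 0 0) in
  [/\ (v *m row_projection X *m v^t*) 0 0 = p%:C, 0 <= p &
      rdet (X *m X^t* + t%:C *: (X *m v^t*) *m (X *m v^t*)^t*) = rdet (X *m X^t*) * (1 + t * p)].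
Proof.
move=> freeX p; have Xpd := posdef_gram freeX; have Xu := posdef_unit Xpd.
have formE : (v *m row_projection X *m v^t*) 0 0 =
    ((X *m v^t*)^t* *m invmx (X *m X^t*) *m (X *m v^t*)) 0 0.
  by rewrite /row_projection trmxC_mul trmxCK !mulmxA.
have form0 : 0 <= (v *m row_projection X *m v^t*) 0 0.
  rewrite formE; set w := X *m v^t*.
  have [->|w0] := eqVneq (w^t*) 0; first by rewrite !mul0mx mxE.
  have [_ /(_ _ w0)] := posdef_inv Xpd; rewrite trmxCK; exact: ltW.
have pE : (v *m row_projection X *m v^t*) 0 0 = p%:C by rewrite /p RRe_real ?ger0_real.
split=> //; first by rewrite -(ler0c p) -pE.
rewrite /rdet det_rank1_update // -scalemxAr mxE -formE pE -(rdetE Xpd).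
by rewrite -rmorphM -[1 in LHS](rmorph1 (real_complex R)) -rmorphD -rmorphM.
Qed.

Lemma row_projection_unit m (g : 'M[C]_m) : g \in unitmx -> row_projection g = 1%:M.
Proof.
move=> gu; have pdu : g *m g^t* \in unitmx.
  by apply/posdef_unit/posdef_gram; rewrite row_free_unit.
apply: (can_inj (mulKmx gu)).
by rewrite mulmx1 /row_projection !mulmxA mulmxV // mul1mx.
Qed.

(** [E] fixes the orthogonal complement of [v] and multiplies [v] by [r], the square root of
    [1 + t * q]; this determines [s]. *)
Lemma sqrt_rank1 m (v : 'rV[C]_m) (q t : R) : (v *m v^t*) 0 0 = q%:C -> 0 < q -> 0 < 1 + t * q ->
  exists2 E : 'M[C]_m, E \in unitmx & E *m E^t* = 1%:M + t%:C *: (v^t* *m v).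
Proof.
move=> qE q0 tq; pose r := Num.sqrt (1 + t * q); pose s := (r - 1) / q.
have r0 : 0 < r by rewrite sqrtr_gt0.
have r2 : r ^+ 2 = 1 + t * q by rewrite sqr_sqrtr // ltW.
have sq : s * q = r - 1 by rewrite mulfVK // gt_eqF.
exists (1%:M + s%:C *: (v^t* *m v)).
  rewrite unitmxE scalemxAl det_1D_mulmx -scalemxAr mxE qE unitfE.
  by rewrite -rmorphM sq -(rmorph1 (real_complex R)) -rmorphD subrKC gt_eqF // ltcR.
set W := v^t* *m v.
have WW : W *m W = q%:C *: W.
  by rewrite /W mulmxA -(mulmxA _ v) [v *m v^t*]mx11_scalar qE mul_mx_scalar -scalemxAl.
have conjs : Num.conj s%:C = s%:C by exact: conjc_real.
have -> : (1%:M + s%:C *: W)^t* = 1%:M + s%:C *: W.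
  by rewrite trmxCD trmxC1 trmxCZ conjs /W trmxC_mul trmxCK.
rewrite mulmxDl mul1mx mulmxDr mulmx1 -scalemxAl -scalemxAr WW !scalerA -addrA.
rewrite -!scalerDl -!rmorphM -!rmorphD; congr (1%:M + _%:C *: W).
apply: (mulIf (lt0r_neq0 q0)).
have -> : (s + (s + s * s * q)) * q = (s * q) * (s * q + 2) by ring.
rewrite sq; have -> : (r - 1) * (r - 1 + 2) = r ^+ 2 - 1 by ring.
by rewrite r2; ring.
Qed.

Lemma le_increment (k a b e f : R) : a - k * b <= a + e - k * (b + f) -> k * f <= e.
Proof. lra. Qed.

(** Varying [g] to [g *m E], with [E] from [sqrt_rank1], multiplies the determinants by
    [1 + t * p x] and [1 + t * q]. Minimality thus becomes an inequality between explicit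
    logarithms, whose first order is the wanted identity evaluated as a quadratic form at [v]. *)
Lemma kempf_ness_critical g : g \in unitmx ->
  (forall g', g' \in unitmx -> kempf_ness g <= kempf_ness g') ->
  \sum_x (c x)%:C *: row_projection (B x *m g) = gamma%:C *: 1%:M.
Proof.
move=> gu gmin; apply/eqP; rewrite -subr_eq0; apply/eqP/sesquilinear_eq0 => v.
have [->|v0] := eqVneq v 0; first by rewrite !mul0mx mxE.
pose p x := complex.Re ((v *m row_projection (B x *m g) *m v^t*) 0 0).
pose q := complex.Re ((v *m v^t*) 0 0).
have [qE q0] : (v *m v^t*) 0 0 = q%:C /\ 0 < q.
  by have := dotmx_is_dotmx v0; rewrite dotmxE => /gt0_Re[<-].
have freeX x : row_free (B x *m g).
  by rewrite /row_free mxrankMfree ?row_free_unit //; exact: B_free.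
have pE x t := rdet_rank1 v t (freeX x).
have perturb t : 0 < 1 + t * q -> (forall x, 0 < 1 + t * p x) /\
    gamma * ln (1 + t * q) <= \sum_x c x * ln (1 + t * p x).
  move=> tq; have [E Eu EE] := sqrt_rank1 qE q0 tq.
  have gEu : g *m E \in unitmx by rewrite unitmx_mul gu.
  have gramE k (X : 'M[C]_(k, n.+1)) : (X *m E) *m (X *m E)^t* =
      X *m X^t* + t%:C *: (X *m v^t*) *m (X *m v^t*)^t*.
    rewrite trmxC_mul !mulmxA -(mulmxA X) EE mulmxDr mulmx1 mulmxDl; congr (_ + _).
    by rewrite -!scalemxAr -!scalemxAl trmxC_mul trmxCK !mulmxA.
  have detx x : rdet (gram (g *m E) x) = rdet (gram g x) * (1 + t * p x).
    by rewrite /gram mulmxA gramE; have [_ _ ->] := pE x t.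
  have det1' : rdet (g *m E *m (g *m E)^t*) = rdet (g *m g^t*) * (1 + t * q).
    have freeg : row_free g by rewrite row_free_unit.
    have [_ _] := rdet_rank1 v t freeg; rewrite row_projection_unit // mulmx1 => <-.
    by rewrite gramE.
  have pos x : 0 < 1 + t * p x.
    have := rdet_gt0 (posdef_gram_unit x gEu).
    by rewrite detx pmulr_rgt0 // rdet_gt0 //; exact: posdef_gram_unit.
  split=> //.
  have lnx x : ln (rdet (gram (g *m E) x)) = ln (rdet (gram g x)) + ln (1 + t * p x).
    by rewrite detx lnM ?posrE // rdet_gt0 //; exact: posdef_gram_unit.
  have ln1' : ln (rdet (g *m E *m (g *m E)^t*)) = ln (rdet (g *m g^t*)) + ln (1 + t * q).
    by rewrite det1' lnM ?posrE // rdet_gt0 //; exact: posdef_unit_gram.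
  have sumx : \sum_x c x * ln (rdet (gram (g *m E) x)) =
      \sum_x c x * ln (rdet (gram g x)) + \sum_x c x * ln (1 + t * p x).
    by rewrite -big_split; apply: eq_bigr => x _; rewrite lnx mulrDr.
  have kE : kempf_ness (g *m E) = _ := f_equal2 (fun a b => a - gamma * b) sumx ln1'.
  have := gmin _ gEu; rewrite kE.
  exact: le_increment.
have p0 x : 0 <= p x by have [_] := pE x 0.
have s1E : \sum_x c x * p x = gamma * q.
  apply: (ln_first_order (f := fun t => \sum_x c x * ln (1 + t * p x))) => //.
  - by apply: sumr_ge0 => x _; rewrite mulr_ge0 // ltW.
  - move=> t /perturb[pos _]; rewrite mulr_sumr; apply: ler_sum => x _.
    rewrite mulrCA ler_pM2l //; apply: le_ln1Dx.
    by rewrite -subr_gt0 opprK addrC.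
  - by move=> t /perturb[].
have -> : v *m (\sum_x (c x)%:C *: row_projection (B x *m g) - gamma%:C *: 1%:M) *m v^t* =
    \sum_x (c x)%:C *: (v *m row_projection (B x *m g) *m v^t*) - gamma%:C *: (v *m v^t*).
  rewrite mulmxBr mulmxBl mulmx_sumr mulmx_suml -scalemxAr mulmx1 -scalemxAl.
  by congr (_ - _); apply: eq_bigr => x _; rewrite -scalemxAr -scalemxAl.
have sub00 (X Y : 'M[C]_1) : (X - Y) 0 0 = X 0 0 - Y 0 0 by rewrite !mxE.
have scale00 k (X : 'M[C]_1) : (k *: X) 0 0 = k * X 0 0 by rewrite mxE.
rewrite sub00 summxE scale00 qE.
have -> : \sum_x ((c x)%:C *: (v *m row_projection (B x *m g) *m v^t*)) 0 0 = (\sum_x c x * p x)%:C.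
  by rewrite rmorph_sum; apply: eq_bigr => x _; rewrite scale00; have [-> _ _] := pE x 0; rewrite -rmorphM.
by rewrite s1E -rmorphM subrr.
Qed.

Theorem stable_balanced : exists2 g : 'M[C]_n.+1, g \in unitmx &
  \sum_x (c x)%:C *: row_projection (B x *m g) = gamma%:C *: 1%:M.
Proof.
have [g gu gmin] := kempf_ness_minimum.
by exists g => //; exact: kempf_ness_critical.
Qed.

End RealDeterminant.

Corollary exists_balanced (R : realType) (I : finType) (n : nat) (d : I -> nat)
    (B : forall x, 'M[(R[i])%C]_(d x, n)) (c : I -> R) (gamma : R) :
  (0 < n)%N -> (forall x, 0 < c x)%R -> (0 <= gamma)%R -> (forall x, row_free (B x)) ->
  (\sum_x c x * (d x)%:R = gamma * n%:R)%R ->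
  (forall U : 'M_n, (0 < \rank U < n)%N ->
    \sum_x c x * (\rank (B x :&: U)%MS)%:R < gamma * (\rank U)%:R)%R ->
  exists2 g : 'M_n, g \in unitmx &
    (\sum_x (real_complex R (c x)) *: row_projection (B x *m g) =
     (real_complex R gamma) *: 1%:M)%R.
Proof. by case: n B => // n B _ *; apply: stable_balanced. Qed.

(** * Unitarization *)

Section PullbackDot.
Local Open Scope ring_scope.
Local Open Scope sesquilinear_scope.
Import VectorInternalTheory.
Variables (C : numClosedFieldType) (V : vectType C) (g : 'M[C]_(dim V)).

Definition pullback_dot (u v : V) : C := dotmx (v2r u *m g) (v2r v *m g).

Fact pullback_dot_bilinear : bilinear_for
  (GRing.Scale.Law.clone _ _ *%R _)
  (GRing.Scale.Law.clone _ _ (Num.conj \; *%R) _) pullback_dot.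
Proof.
split=> [v|u] a x y; rewrite /pullback_dot linearP mulmxDl -scalemxAl.
  by rewrite linearPl.
by rewrite linearPr.
Qed.

HB.instance Definition _ := bilinear_isBilinear.Build C V V C
  (GRing.Scale.Law.clone _ _ *%R _)
  (GRing.Scale.Law.clone _ _ (Num.conj \; *%R) _) pullback_dot pullback_dot_bilinear.

Fact pullback_dot_hermitian u v :
  pullback_dot u v = (-1) ^+ false * (pullback_dot v u)^*.
Proof. by rewrite /pullback_dot hermC. Qed.

HB.instance Definition _ := isHermitianSesquilinear.Build C V false Num.conj
  pullback_dot pullback_dot_hermitian.

Lemma exists_pullback_dot : g \in unitmx ->
  exists h : {dot V for Num.conj}, forall u v, h u v = ((v2r u *m g) *m (v2r v *m g)^t*) 0 0.
Proof.
move=> gu; have pos u : u != 0 -> 0 < pullback_dot u u.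
  move=> u0; apply: dotmx_is_dotmx; apply: contra_neq u0 => ug0.
  by apply: v2r_inj; rewrite linear0 -(mulmxK gu (v2r u)) ug0 mul0mx.
pose mix := isDotProduct.Build C V pullback_dot pos.
pose h : {dot V for Num.conj} := HB.pack pullback_dot mix.
by exists h => u v; rewrite -dotmxE.
Qed.

End PullbackDot.

Section Balance.
Local Open Scope ring_scope.
Local Open Scope sesquilinear_scope.
Import VectorInternalTheory.
Variables (R : realType) (k l : nat) (pi : representation R (primitive3 k l)).
Local Notation V := (rspace pi).
Local Notation C := (R[i])%C.

Definition weight_at (chi : weight R k l) (x : primitive3 k l) : R :=
  match x with
  | inl (inl i) => tnth (walpha chi) i
  | inl (inr i) => tnth (wbeta chi) i
  | inr _ => wdelta chi
  end.

Lemma sum_primitive3 (W : zmodType) (F : primitive3 k l -> W) :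
  \sum_(x : 'I_k + 'I_l + 'I_1) F x =
  \sum_(i < k) F (eltx i) + \sum_(i < l) F (elty i) + F eltz.
Proof.
rewrite big_sumType big_sumType /= big_ord1; congr (_ + _ + F _).
Qed.

(** For the standard inner product pulled back along [g], the orthogonal projection onto [pi x] is
    the conjugate by [g] of [row_projection (B x *m g)]; conjugation leaves the scalar right-hand
    side of the balance equation unchanged. *)
Lemma stable_unitarizable (chi : weight R k l) :
  (0 < \dim {:V})%N ->
  \sum_(x : 'I_k + 'I_l + 'I_1) weight_at chi x * (\dim (pi x))%:R =
    wgamma chi * (\dim {:V})%:R ->
  (forall U : {vspace V}, (0 < \dim U < \dim {:V})%N ->
    \sum_(x : 'I_k + 'I_l + 'I_1) weight_at chi x * (\dim (pi x :&: U))%:R <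
      wgamma chi * (\dim U)%:R) ->
  unitarizable pi chi.
Proof.
move=> V0 tr st.
pose B (x : 'I_k + 'I_l + 'I_1) := row_base (vs2mx (pi x)).
have [g gu gE] : exists2 g : 'M[C]_(dim V), g \in unitmx &
    \sum_x (real_complex R (weight_at chi x)) *: row_projection (B x *m g) =
    (real_complex R (wgamma chi)) *: 1%:M.
  apply: exists_balanced => [|x||x||U rU].
  - by rewrite -dimvf.
  - by case: x => [[i|i]|i]; [exact: walpha_gt0|exact: wbeta_gt0|exact: wdelta_gt0].
  - exact: wgamma_ge0.
  - exact: row_base_free.
  - by move: tr; rewrite dimvf.
  have rE : \dim (mx2vs U) = \rank U by rewrite /dimv mx2vsK.
  have := st (mx2vs U); rewrite rE dimvf => /(_ rU).
  apply: le_lt_trans; apply: ler_sum => x _; rewrite ler_pM2l.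
    rewrite ler_nat /dimv mx2vsK; apply: mxrankS; apply: capmxS; first by rewrite eq_row_base.
    by rewrite mx2vsK.
  by case: x => [[i|i]|i]; [exact: walpha_gt0|exact: wbeta_gt0|exact: wdelta_gt0].
have [h hE] := exists_pullback_dot gu.
pose P x : 'End(V) := Hom (g *m row_projection (B x *m g) *m invmx g).
have PE x v : v2r (P x v) = v2r v *m g *m row_projection (B x *m g) *m invmx g.
  by rewrite unlock /= r2vK !mulmxA.
have memE (u : V) x : (u \in pi x) = (v2r u <= B x)%MS.
  by rewrite memvE /subsetv mx2vsK /B eq_row_base.
exists h, P; split.
  move=> x v; split.
    rewrite memE PE /row_projection; set Y := _ *m invmx (_ *m _).
    have -> : v2r v *m g *m (Y *m (B x *m g)) *m invmx g = v2r v *m g *m Y *m B x.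
      by rewrite -!mulmxA (mulmxV gu) mulmx1.
    exact: submxMl.
  move=> u; rewrite memE => /submxP[y yE]; rewrite hE linearB /= PE yE.
  have Xu : (B x *m g) *m (B x *m g)^t* \in unitmx.
    apply/posdef_unit/posdef_gram; rewrite /row_free mxrankMfree ?row_free_unit //.
    exact: row_base_free.
  rewrite -(mulmxA y); set X := B x *m g in Xu *; clearbody X.
  have QX : row_projection X *m X ^t* = X ^t*.
    rewrite /row_projection -(mulmxA _ X) -(mulmxA (X ^t*)) (mulVmx Xu).
    by rewrite mulmx1.
  rewrite mulmxBl mulmxKV // trmxC_mul mulmxA mulmxBl -(mulmxA (_ *m g)) QX.
  by rewrite subrr mul0mx mxE.
rewrite -(sum_primitive3 (fun x => real_complex R (weight_at chi x) *: P x)).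
apply/lfunP => v; apply: v2r_inj; rewrite sum_lfunE linear_sum scale_lfunE id_lfunE linearZ /=.
transitivity (v2r v *m g *m (\sum_x (real_complex R (weight_at chi x)) *: row_projection (B x *m g)) *m invmx g).
  rewrite mulmx_sumr mulmx_suml; apply: eq_bigr => x _.
  by rewrite scale_lfunE linearZ /= PE -scalemxAr -scalemxAl.
by rewrite gE -scalemxAr mulmx1 -scalemxAl mulmxK.
Qed.

End Balance.

(** * Internal decompositions as direct sums of representations *)

Section Decomposition.
Local Open Scope ring_scope.
Variables (R : realType) (disp : Order.disp_t) (N : finPOrderType disp)
  (pi : representation R N).
Local Notation V := (rspace pi).
Implicit Types A B : {vspace V}.

Fact restrict_homo A (x y : N) : (x < y)%O ->
  ((linfun (@vsval _ _ A)) @^-1: pi x <= (linfun (@vsval _ _ A)) @^-1: pi y)%VS.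
Proof.
move=> /(rsub_homo pi) xy; apply/subvP => v; rewrite -!memv_preim.
exact: (subvP xy).
Qed.

Definition restrict_rep A : representation R N := Representation (@restrict_homo A).

Lemma mem_restrict_rep A x (v : subvs_of A) : (v \in restrict_rep A x) = (vsval v \in pi x).
Proof. by rewrite -memv_preim lfunE. Qed.

Lemma nonzero_restrict_rep A : A != 0%VS -> nonzero_rep (restrict_rep A).
Proof. by rewrite /nonzero_rep -!dimv_eq0 dimvf. Qed.

Section Split.
Variables A B : {vspace V}.
Hypotheses (AB1 : (A + B = fullv)%VS) (AB0 : (A :&: B = 0)%VS)
  (ABpi : forall x, (pi x <= A :&: pi x + B :&: pi x)%VS).

Definition split_pair (v : V) : subvs_of A * subvs_of B :=
  (vsproj A (daddv_pi A B v), vsproj B (daddv_pi B A v)).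

Fact split_pair_is_linear : linear split_pair.
Proof. by move=> c u v; rewrite /split_pair !linearP. Qed.

HB.instance Definition _ := GRing.isLinear.Build _ _ _ _ split_pair split_pair_is_linear.

Lemma split_pair_sum (u : subvs_of A) (w : subvs_of B) :
  split_pair (vsval u + vsval w) = (u, w).
Proof.
have BA0 : (B :&: A = 0)%VS by rewrite capvC.
congr pair; rewrite !linearD /=.
  by rewrite (daddv_pi_id AB0) ?(daddv_pi0 AB0) ?subvsP // linear0 addr0 vsvalK.
by rewrite (daddv_pi0 BA0) ?(daddv_pi_id BA0) ?subvsP // linear0 add0r vsvalK.
Qed.

Lemma split_ex (v : V) : exists (u : subvs_of A) (w : subvs_of B), v = vsval u + vsval w.
Proof.
have /memv_addP[u uA [w wB ->]] : v \in (A + B)%VS by rewrite AB1 memvf.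
by exists (vsproj A u), (vsproj B w); rewrite !vsprojK.
Qed.

Lemma split_isomorphic : isomorphic pi (dsum (restrict_rep A) (restrict_rep B)).
Proof.
exists (linfun split_pair); split.
- apply/eqP/lker0P => v v'; rewrite !lfunE /=.
  have [u [w ->]] := split_ex v; have [u' [w' ->]] := split_ex v'.
  by rewrite !split_pair_sum => -[-> ->].
- apply/vspaceP => -[u w]; rewrite memvf; apply/memv_imgP.
  by exists (vsval u + vsval w); rewrite ?memvf // lfunE /= split_pair_sum.
move=> x; apply/vspaceP => -[u w]; rewrite mem_dsumv !mem_restrict_rep /=.
apply/memv_imgP/andP => [[v vx]|[ux wx]]; last first.
  by exists (vsval u + vsval w); rewrite ?memvD // lfunE /= split_pair_sum.
have /memv_addP[u' ] := subvP (ABpi x) v vx; rewrite memv_cap => /andP[u'A u'x].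
case=> w'; rewrite memv_cap => /andP[w'B w'x] ->.
rewrite lfunE /= -{1}(vsprojK u'A) -{1}(vsprojK w'B) split_pair_sum => -[-> ->].
by rewrite !vsprojK.
Qed.

End Split.

Lemma indecomposable_split A B : indecomposable pi ->
  (A + B = fullv)%VS -> (A :&: B = 0)%VS ->
  (forall x, (pi x <= A :&: pi x + B :&: pi x)%VS) -> A = 0%VS \/ B = 0%VS.
Proof.
move=> ind AB1 AB0 ABpi.
have [->|A0] := eqVneq A 0%VS; first by left.
have [->|B0] := eqVneq B 0%VS; first by right.
case: ind; exists (restrict_rep A), (restrict_rep B).
by split; [exact: nonzero_restrict_rep|exact: nonzero_restrict_rep|exact: split_isomorphic].
Qed.

End Decomposition.

(** * Removing trivial members and repetitions from a chain *)

Section Collapse.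
Local Open Scope ring_scope.

Lemma wdot_map (R : realDomainType) (F : nat -> R) (G : nat -> nat) L :
  wdot [seq F j | j <- L] [seq G j | j <- L] = \sum_(j <- L) F j * (G j)%:R.
Proof. by elim: L => [|j L IH] /=; rewrite ?big_nil // big_cons IH. Qed.

(* [Y] is the chain [f] without repetitions and without the subspaces [0] and
   [V]; in it the weights of equal subspaces add up to the levels [A_j]. *)
Lemma collapse_chain (F : fieldType) (V : vectType F) (R : realType) (n : nat)
    (f : 'I_n -> {vspace V}) (s : n.-tuple nat) (w : n.-tuple R) (L : seq nat) :
  {homo f : i j / (i <= j)%N >-> (i <= j)%VS} ->
  (forall i, \dim (f i) = tnth s i) ->
  sorted ltn L -> all (fun j => 0 < j < \dim {:V})%N L -> {subset L <= s} ->
  {subset s <= [:: 0, \dim {:V} & L]%N} ->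
  exists Y : seq {vspace V},
    [/\ sorted subsetv Y, [seq \dim X | X <- Y] = L,
        forall i, f i \in [:: 0%VS, fullv & Y] &
        forall phi : {vspace V} -> nat, phi 0%VS = 0%N ->
          \sum_i tnth w i * (phi (f i))%:R =
          wdot [seq level s w j | j <- L] [seq phi X | X <- Y] +
          level s w (\dim {:V}) * (phi fullv)%:R].
Proof.
move=> fmono fdim Lsrt Lbnd Ls sL.
have fcomp i j : (\dim (f i) <= \dim (f j))%N -> (f i <= f j)%VS.
  case: (leqP i j) => [/fmono //|/ltnW/fmono ji ij].
  by have := dimv_leqif_eq ji => /geq_leqif; rewrite ij => /esym/eqP <-.
(* A member of a chain is determined by its dimension, so the first [f i] of dimension [j]
   represents them all. *)
pose X j := nth 0%VS [seq f i | i <- enum 'I_n] (index j s).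
have XE j : j \in (s : seq nat) -> exists2 i, X j = f i & tnth s i = j.
  move=> js; have js' := js; rewrite -index_mem size_tuple in js'.
  exists (Ordinal js'); last by rewrite (tnth_nth 0%N) nth_index.
  rewrite /X (nth_map (Ordinal js')) ?size_enum_ord //.
  by congr f; apply: val_inj; rewrite /= nth_enum_ord.
have fX i : f i = X (tnth s i).
  have [j ->] := XE _ (mem_tnth i s); rewrite -!fdim => ij.
  by apply/eqP; rewrite eqEsubv !fcomp ?ij.
have Xdim j : j \in L -> \dim (X j) = j.
  by move=> /Ls/XE[i -> <-].
have X0 i : tnth s i = 0%N -> f i = 0%VS.
  by move=> s0; apply/eqP; rewrite -dimv_eq0 fdim s0.
have Xm i : tnth s i = \dim {:V} -> f i = fullv.
  by move=> sm; apply/eqP; rewrite eqEdim subvf fdim sm leqnn.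
exists [seq X j | j <- L]; split.
- rewrite sorted_map; apply: (sub_in_sorted (P := mem L) (e := ltn) _ _ Lsrt); last by apply/allP.
  move=> j j' jL j'L jj' /=.
  have [i -> si] := XE _ (Ls _ jL); have [i' -> si'] := XE _ (Ls _ j'L).
  by apply: fcomp; rewrite !fdim si si' ltnW.
- by rewrite -map_comp; apply: map_id_in.
- move=> i; have := sL _ (mem_tnth i s); rewrite !inE => /or3P[/eqP/X0 ->|/eqP/Xm ->|iL].
  + by rewrite eqxx.
  + by rewrite eqxx orbT.
  by rewrite [X in _ || (_ || X)](_ : _ = true) ?orbT // fX map_f.
move=> phi phi0; rewrite -map_comp wdot_map.
have Luniq : uniq L by exact: (sorted_uniq ltn_trans ltnn).
rewrite /level [X in _ = _ + X]mulr_suml [X in _ = _ + X]big_mkcond.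
under [X in _ = X + _]eq_bigr => j _ do rewrite mulr_suml big_mkcond.
rewrite exchange_big -big_split; apply: eq_bigr => i _ /=.
have [iL|iL] := boolP (tnth s i \in L).
  rewrite (bigD1_seq (tnth s i)) //= eqxx big1 ?addr0 => [|j /negPf]; last by rewrite eq_sym => ->.
  rewrite -fX; case: eqP => [sm|_]; last by rewrite addr0.
  by have := allP Lbnd _ iL; rewrite sm ltnn andbF.
rewrite big1_seq => [|j /= jL]; last by case: eqP => // sj; rewrite -sj in jL; rewrite jL in iL.
rewrite add0r; have := sL _ (mem_tnth i s); rewrite !inE (negPf iL) orbF.
case/orP => [/eqP s0|/eqP sm]; last by rewrite sm eqxx (Xm i sm).
(* The level 0 could coincide with the level [\dim {:V}]; then [V] is zero and [phi] vanishes on it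
   as well. *)
rewrite (X0 i s0) phi0 mulr0 s0; case: eqP => // /esym m0.
have -> : (fullv : {vspace V}) = 0%VS by apply/eqP; rewrite -dimv_eq0 m0.
by rewrite phi0 mulr0.
Qed.

End Collapse.

Section Main.
Local Open Scope ring_scope.

Definition proper_levels (n : nat) (L : seq nat) : bool :=
  sorted ltn L && all (fun j => 0 < j < n)%N L.

Lemma full_table_shape : all (fun r : dimdata * seq dimdata =>
  [&& proper_levels r.1.2 r.1.1.1.1, proper_levels r.1.2 r.1.1.1.2,
      size r.1.1.1.1 <= 4, size r.1.1.1.2 <= 2 & 0 < r.1.2]%N) full_table.
Proof. by []. Qed.

Variables (R : realType) (k l : nat) (pi : representation R (primitive3 k l))
  (D : dimvec k l) (chi : weight R k l).
Local Notation V := (rspace pi).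

Definition level_weights (E : dimdata) : seq R :=
  [seq level (da D) (walpha chi) j | j <- E.1.1.1] ++
  [seq level (db D) (wbeta chi) j | j <- E.1.1.2] ++ [:: wdelta chi].

(** Chain members equal to [V] contribute their weight times [\dim U], which is moved to the
    right-hand side. In items 3 and 4 this is the number written as gamma with a prime. *)
Definition reduced_gamma : R :=
  wgamma chi - level (da D) (walpha chi) (d0 D) - level (db D) (wbeta chi) (d0 D).

Lemma trace_equality_weight_at : has_dimvec pi D -> trace_equality D chi ->
  \sum_(x : 'I_k + 'I_l + 'I_1) weight_at chi x * (\dim (pi x))%:R =
  wgamma chi * (\dim {:V})%:R.
Proof.
move=> [adim bdim zdim Vdim] tr.
rewrite (sum_primitive3 (fun x => weight_at chi x * (\dim (pi x))%:R)) /=.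
rewrite Vdim (mulrC (wgamma chi)) -tr zdim (mulrC (wdelta chi)).
by congr (_ + _ + _); apply: eq_bigr => i _; rewrite ?adim ?bdim mulrC.
Qed.

(** The defect in the stability inequality for [U] is a linear functional of the dimensions that [U]
    has with respect to the collapsed chains. It vanishes at [U = V] by the trace equality, and the
    table makes it negative at the proper nonzero [U]. *)
Lemma tabulated_unitarizable (E : dimdata) (qs : seq dimdata) :
  indecomposable pi -> has_dimvec pi D -> trace_equality D chi ->
  (E, qs) \in full_table -> E.2 = d0 D -> E.1.2 = dz D ->
  {subset E.1.1.1 <= da D} -> {subset da D <= [:: 0, d0 D & E.1.1.1]%N} ->
  {subset E.1.1.2 <= db D} -> {subset db D <= [:: 0, d0 D & E.1.1.2]%N} ->
  (forall q, q \in qs -> wdot (rcons (level_weights E) (- reduced_gamma)) (flat q) < 0) ->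
  unitarizable pi chi.
Proof.
move=> ind dimD tr Eqs E2 E12 Ea aE Eb bE neg.
have [adim bdim zdim Vdim] := dimD.
have /and5P[/andP[srta bnda] /andP[srtb bndb] sza szb E2gt0] := allP full_table_shape _ Eqs.
rewrite /= in srta bnda srtb bndb sza szb E2gt0.
rewrite E2 -Vdim in bnda bndb; rewrite -Vdim in aE bE.
have homo_le (x y : primitive3 k l) : (x <= y)%O -> (pi x <= pi y)%VS.
  by rewrite le_eqVlt => /predU1P[-> //|]; exact: rsub_homo.
have amono : {homo (fun i : 'I_k => pi (eltx i)) : i j / (i <= j)%N >-> (i <= j)%VS}.
  by move=> i j ij; apply: homo_le.
have bmono : {homo (fun i : 'I_l => pi (elty i)) : i j / (i <= j)%N >-> (i <= j)%VS}.
  by move=> i j ij; apply: homo_le.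
have [Ya [srtYa dimYa memYa sumYa]] := collapse_chain (walpha chi) amono adim srta bnda Ea aE.
have [Yb [srtYb dimYb memYb sumYb]] := collapse_chain (wbeta chi) bmono bdim srtb bndb Eb bE.
pose Ys := [:: Ya; Yb; [:: pi eltz]].
have dimsE : space_dims Ys = chains_of E.
  by rewrite /space_dims /= dimYa dimYb zdim /chains_of E12.
have szYa : size Ya = size E.1.1.1 by rewrite -dimYa size_map.
have szYb : size Yb = size E.1.1.2 by rewrite -dimYb size_map.
have sumE (U : {vspace V}) :
  \sum_(x : 'I_k + 'I_l + 'I_1) weight_at chi x * (\dim (pi x :&: U))%:R
    - wgamma chi * (\dim U)%:R =
  wdot (rcons (level_weights E) (- reduced_gamma)) (flat_dims (meet_dims U Ys) (\dim U)).
  rewrite (sum_primitive3 (fun x => weight_at chi x * (\dim (pi x :&: U))%:R)) /=.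
  have := sumYa (fun X => \dim (X :&: U)) => /(_ _)->; last by rewrite cap0v dimv0.
  have := sumYb (fun X => \dim (X :&: U)) => /(_ _)->; last by rewrite cap0v dimv0.
  rewrite /flat_dims /= capfv Vdim.
  rewrite -cats1 wdot_cat; last by rewrite !size_cat !size_map szYa szYb.
  rewrite /level_weights !wdot_cat ?size_map //= !addr0 /reduced_gamma.
  have capE Y : [seq \dim (X :&: U) | X <- Y] = [seq \dim (U :&: X) | X <- Y].
    by apply: eq_map => X; rewrite capvC.
  rewrite !capE (capvC U (pi eltz)).
  ring.
have Vgt0 : (0 < \dim {:V})%N by rewrite Vdim -E2.
have fullE : flat_dims (meet_dims fullv Ys) (\dim {:V}) = flat E.
  rewrite (_ : meet_dims fullv Ys = space_dims Ys).
    by rewrite dimsE /flat_dims /flat /= Vdim -E2 -!catA.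
  by apply: eq_map => Y; apply: eq_map => X; rewrite capfv.
have trE : \sum_(x : 'I_k + 'I_l + 'I_1) weight_at chi x * (\dim (pi x))%:R =
    wgamma chi * (\dim {:V})%:R.
  exact: trace_equality_weight_at dimD tr.
apply: stable_unitarizable => // U Uprop.
rewrite -subr_lt0 sumE.
have cand : meet_dims U Ys \in candidates E.2 (chains_of E) (\dim U).
  by rewrite E2 -Vdim -dimsE; apply: mem_candidates; rewrite /= srtYa srtYb.
apply: (table_stability Eqs) => //.
- rewrite /level_weights !all_cat /= (ltW (wdelta_gt0 chi)) !andbT.
  apply/andP; split; apply/allP => _ /mapP[j _ ->]; apply: sumr_ge0 => i _.
    exact/ltW/walpha_gt0.
  exact/ltW/wbeta_gt0.
- by rewrite /flat /level_weights !size_cat !size_map /= !addnS.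
- rewrite -fullE -sumE; under eq_bigr do rewrite capvf.
  by rewrite trE subrr.
- by rewrite E2 -Vdim.
rewrite E2 -Vdim -dimsE; apply: not_excluded => [|U1 U2]; first by rewrite /= srtYa srtYb.
apply: rigid_inequality => //; rewrite ?szYa ?szYb //.
apply: indecomposable_brick => //; rewrite ?szYa ?szYb // => A B [AB AB0 ABX].
apply: (indecomposable_split ind AB AB0) => x.
(* The subspaces 0 and [V] split along every decomposition, so a decomposition for the collapsed
   chains is one of [pi]. *)
have ABYs X : X \in [:: 0%VS, fullv & Ya ++ Yb ++ [:: pi eltz]] -> (X <= A :&: X + B :&: X)%VS.
  rewrite 2!inE => /or3P[/eqP ->|/eqP ->|/ABX]; last by rewrite capfv.
    exact: sub0v.
  by rewrite !capvf AB.
apply: ABYs; rewrite !inE !mem_cat; case: x => [[i|i]|i].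
- by have := memYa i; rewrite !inE => /or3P[->|->|->]; rewrite ?orbT.
- by have := memYb i; rewrite !inE => /or3P[->|->|->]; rewrite ?orbT.
by rewrite (ord1 i) inE eqxx !orbT.
Qed.
End Main.

(** * The six items *)

Section Items.
Local Open Scope ring_scope.

Section Level.
Variables (R : realType) (n : nat) (s : n.-tuple nat) (w : n.-tuple R).

Lemma level_notin j : j \notin (s : seq nat) -> level s w j = 0.
Proof.
move=> js; rewrite /level big_pred0 // => i; apply: contraNF js => /eqP <-.
exact: mem_tnth.
Qed.

Lemma level_uniq : uniq s -> [seq level s w j | j <- s] = w.
Proof.
move=> us; apply: (@eq_from_nth _ 0); rewrite size_map !size_tuple // => i ni.
rewrite (nth_map 0%N) ?size_tuple // /level (big_pred1 (Ordinal ni)) ?(tnth_nth 0) // => i'.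
by rewrite /= (tnth_nth 0%N) nth_uniq ?size_tuple.
Qed.

Lemma wdot_tuple (x : seq nat) : wdot w x = \sum_(i < n) (nth 0%N x i)%:R * tnth w i.
Proof.
have -> : wdot w x = \sum_(i < size w) (nth 0%N x i)%:R * w`_i.
  elim: (w : seq R) x => [|y v IH] [|z x] /=; rewrite ?big_ord0 //.
    by rewrite big1 // => i _; rewrite nth_nil mul0r.
  by rewrite big_ord_recl IH mulrC.
by rewrite size_tuple; apply: eq_bigr => i _; rewrite (tnth_nth 0).
Qed.

End Level.

Variables (R : realType) (k l : nat) (pi : representation R (primitive3 k l))
  (D : dimvec k l) (chi : weight R k l).
Hypotheses (ind : indecomposable pi) (dimD : has_dimvec pi D) (trD : trace_equality D chi).

(** A line has no proper nonzero subspace, so stability is vacuous. *)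
Lemma unitarizable_item1 : item1 D -> unitarizable pi chi.
Proof.
case=> d1 _ _ _; have [_ _ _ Vdim] := dimD.
apply: stable_unitarizable => [||U]; first by rewrite Vdim d1.
  exact: trace_equality_weight_at dimD trD.
by rewrite Vdim d1; lia.
Qed.

Lemma flag_dims_sub (m : nat) (s L : seq nat) : flag_dims m s ->
  all (fun j => j \in [:: 0, m & L]%N) (iota 0 m.+1) -> {subset s <= [:: 0, m & L]%N}.
Proof.
move=> /andP[_ /allP sm] /allP H j /sm jm; apply: H.
by rewrite mem_iota ltnS.
Qed.

Lemma unitarizable_item2 : item2 D chi -> unitarizable pi chi.
Proof.
case=> d2 z1 /andP[fa a1] /andP[fb b1] /and3P[i1 i2 i3].
(* The entry is addressed by its position in [table234]; the default value is never reached. *)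
have Eqs : nth (([::], [::], 0, 0), [::])%N table234 0 \in full_table by [].
apply: (tabulated_unitarizable ind dimD trD Eqs) => //=; rewrite ?d2 //.
- by move=> j; rewrite inE => /eqP ->.
- exact: flag_dims_sub.
- by move=> j; rewrite inE => /eqP ->.
- exact: flag_dims_sub.
apply/allP; rewrite /= /reduced_gamma d2 !andbT; apply/and3P; split; lra.
Qed.

Lemma level_pair x y : db D = [:: x; y] :> seq nat -> x != y ->
  level (db D) (wbeta chi) x = (wbeta chi)`_0 /\ level (db D) (wbeta chi) y = (wbeta chi)`_1.
Proof.
move=> bE xy; have := @level_uniq R l (db D) (wbeta chi); rewrite bE /= inE xy => /(_ isT) <- /=.
by [].
Qed.

Lemma levels_exact n (s : n.-tuple nat) (L : seq nat) (m : nat) : s = L :> seq nat ->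
  {subset L <= s} /\ {subset s <= [:: 0, m & L]%N}.
Proof. by move=> <-; split=> j js //; rewrite !inE js !orbT. Qed.

Lemma unitarizable_item3 : item3 D chi -> unitarizable pi chi.
Proof.
case=> _ d3 bE [fa a12] ineqs.
have [Lb bL] := levels_exact 3 bE.
have [B1 B2] := level_pair bE isT.
have B3 : level (db D) (wbeta chi) 3 = 0 by rewrite level_notin // bE.
have Ea : {subset da D <= [:: 0; 3; 1; 2]%N} by exact: flag_dims_sub.
case: ineqs => [[z1 /and5P[i1 i2 i3 i4 i5]]|[z2 /and5P[i1 i2 i3 i4 i5]]].
  have Eqs : nth (([::], [::], 0, 0), [::])%N table234 1 \in full_table by [].
  apply: (tabulated_unitarizable ind dimD trD Eqs) => //=; rewrite ?d3 //.
  apply/allP; rewrite /= /reduced_gamma d3 B1 B2 B3 !andbT; apply/and5P; split; lra.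
have Eqs : nth (([::], [::], 0, 0), [::])%N table234 2 \in full_table by [].
apply: (tabulated_unitarizable ind dimD trD Eqs) => //=; rewrite ?d3 //.
apply/allP; rewrite /= /reduced_gamma d3 B1 B2 B3 !andbT; apply/and5P; split; lra.
Qed.

Lemma unitarizable_item4 : item4 D chi -> unitarizable pi chi.
Proof.
case=> _ d4 z2 [fa a123] ineqs.
have Ea : {subset da D <= [:: 0; 4; 1; 2; 3]%N} by exact: flag_dims_sub.
case: ineqs => [[bE /and5P[i1 i2 i3 i4 /andP[i5 i6]]]
               |[bE /and5P[i1 i2 i3 i4 /andP[i5 i6]]]
               |[bE /and5P[i1 i2 i3 i4 /andP[i5 i6]]]].
- have Eqs : nth (([::], [::], 0, 0), [::])%N table234 3 \in full_table by [].
  have [B1 B2] := level_pair bE isT.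
  have [Lb bL] := levels_exact 4 bE.
  have B4 : level (db D) (wbeta chi) 4 = 0 by rewrite level_notin // bE.
  apply: (tabulated_unitarizable ind dimD trD Eqs) => //=; rewrite ?d4 //.
  apply/allP; rewrite /= /reduced_gamma d4 B1 B2 B4 !andbT.
  apply/and5P; split; [lra|lra|lra|lra|apply/andP; split; lra].
- have Eqs : nth (([::], [::], 0, 0), [::])%N table234 4 \in full_table by [].
  have [B1 B3] := level_pair bE isT.
  have [Lb bL] := levels_exact 4 bE.
  have B4 : level (db D) (wbeta chi) 4 = 0 by rewrite level_notin // bE.
  apply: (tabulated_unitarizable ind dimD trD Eqs) => //=; rewrite ?d4 //.
  apply/allP; rewrite /= /reduced_gamma d4 B1 B3 B4 !andbT.
  apply/and5P; split; [lra|lra|lra|lra|apply/andP; split; lra].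
have Eqs : nth (([::], [::], 0, 0), [::])%N table234 5 \in full_table by [].
have [B2 B3] := level_pair bE isT.
have [Lb bL] := levels_exact 4 bE.
have B4 : level (db D) (wbeta chi) 4 = 0 by rewrite level_notin // bE.
apply: (tabulated_unitarizable ind dimD trD Eqs) => //=; rewrite ?d4 //.
apply/allP; rewrite /= /reduced_gamma d4 B2 B3 B4 !andbT.
apply/and5P; split; [lra|lra|lra|lra|apply/andP; split; lra].
Qed.

Lemma tables56_shape : all (fun r : dimdata * seq dimdata =>
  all (fun q : dimdata => (size q.1.1.1 == size r.1.1.1.1) && (size q.1.1.2 == size r.1.1.1.2)) r.2)
  (table5 ++ table6).
Proof. by []. Qed.

(** The dimensions in these tables are distinct and strictly between 0 and [d0 D], so nothing
    collapses: the levels are the weights themselves, and each bracket is the value of the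
    functional at a listed vector. *)
Lemma unitarizable_tabulated (table : seq (dimdata * seq dimdata)) :
  {subset table <= table5 ++ table6} -> tabulated table D chi -> unitarizable pi chi.
Proof.
move=> sub [qs /sub Dqs /allP neg].
have Eqs : (dimdata_of D, qs) \in full_table by rewrite /full_table mem_cat Dqs orbT.
have /and5P[/andP[srta /allP bnda] /andP[srtb /allP bndb] _ _ _] := allP full_table_shape _ Eqs.
have /allP szq := allP tables56_shape _ Dqs.
apply: (tabulated_unitarizable ind dimD trD Eqs) => //=.
- exact: (levels_exact _ erefl).2.
- exact: (levels_exact _ erefl).2.
move=> [[[x y] z] c] qqs; have := neg _ qqs; have /andP[/eqP szx /eqP szy] := szq _ qqs.
rewrite /= in szx szy.
have notd0 n (s : n.-tuple nat) : {in s, forall j, (0 < j < d0 D)%N} -> d0 D \notin (s : seq nat).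
  by move=> H; apply/negP => /H; rewrite ltnn andbF.
rewrite /bracket /reduced_gamma !level_notin ?subr0; [|exact: notd0|exact: notd0].
rewrite /level_weights /= !level_uniq ?(sorted_uniq ltn_trans ltnn) //.
rewrite /flat /= -cats1 -!catA !wdot_cat; [|by rewrite szy !size_tuple|by rewrite szx !size_tuple].
rewrite (wdot_tuple (walpha chi)) (wdot_tuple (wbeta chi)) /=; lra.
Qed.

End Items.

Theorem theorem3p2 (R : realType) (k l : nat)
    (kl : (k, l) \in [:: (1, 1); (2, 1); (2, 2); (3, 2); (4, 2)])
    (D : dimvec k l) (pi : representation R (primitive3 k l))
    (chi : weight R k l) :
  indecomposable pi -> has_dimvec pi D -> trace_equality D chi ->
  item1 D \/ item2 D chi \/ item3 D chi \/ item4 D chi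
    \/ tabulated table5 D chi \/ tabulated table6 D chi ->
  unitarizable pi chi.
Proof.
move=> ind dimD trD [|[|[|[|[|]]]]].
- exact: unitarizable_item1.
- exact: unitarizable_item2.
- exact: unitarizable_item3.
- exact: unitarizable_item4.
- by apply: unitarizable_tabulated => // r; rewrite mem_cat => ->.
by apply: unitarizable_tabulated => // r; rewrite mem_cat => ->; rewrite orbT.
Qed.
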